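(* Let $p(\cdot)\in\mathcal P(0,\infty)$ satisfy $p(\cdot)\in LH_0(0,\infty)\cap LH_\infty(0,\infty)$ and $1<p^-\le p^+<\infty$. If $w$ is a weight on $(0,\infty)$, then the following are equivalent: (i) the maximal operator $N$ is of strong-type $(p(\cdot),p(\cdot))$ with respect to $w$; (ii) the maximal operator $N$ is of weak-type $(p(\cdot),p(\cdot))$ with respect to $w$; (iii) $w\in A_{p(\cdot),0}$.
   Context: $\mathcal P(0,\infty)$ is the set of bounded measurable functions $p(\cdot):(0,\infty)\to[1,\infty)$; $p^-=\inf_{x>0}p(x)$ and $p^+=\sup_{x>0}p(x)$. The conjugate exponent is defined pointwise by $1/p(x)+1/p'(x)=1$. For $r(\cdot)\in\mathcal P(0,\infty)$ and measurable $f$, $\|f\|_{r(\cdot)}=\inf\{\mu>0:\int_0^\infty(|f(x)|/\mu)^{r(x)}\,dx\le1\}\in[0,\infty]$. $p(\cdot)\in LH_0(0,\infty)$ means there are $C_0>0$, $p_0\ge1$ with $|p(x)-p_0|\le \frac{C_0}{-\log x}$ for all $0<x<1/2$. $p(\cdot)\in LH_\infty(0,\infty)$ means there are $C_\infty>0$, $p_\infty\ge1$ with $|p(x)-p_\infty|\le\frac{C_\infty}{\log(e+x)}$ for all $x\in(0,\infty)$. A weight is a non-negative, locally integrable function $w$ on $(0,\infty)$ with $0<w(x)<\infty$ a.e. $L^{p(\cdot)}_w(0,\infty)$ is the set of measurable $f$ with $\|fw\|_{p(\cdot)}<\infty$. The maximal operator is $Nf(x)=\sup_{b>x}\frac1b\int_0^b|f(y)|\,dy\in[0,\infty]$,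 $x\in(0,\infty)$. An operator $T$ is of strong-type $(p(\cdot),p(\cdot))$ with respect to $w$ if there is $K>0$ such that $\|(Tf)w\|_{p(\cdot)}\le K\|fw\|_{p(\cdot)}$ for all $f\in L^{p(\cdot)}_w(0,\infty)$; it is of weak-type $(p(\cdot),p(\cdot))$ with respect to $w$ if there is $K>0$ such that $\mu\|w\chi_{\{x\in(0,\infty):Tf(x)>\mu\}}\|_{p(\cdot)}\le K\|fw\|_{p(\cdot)}$ for all $\mu>0$ and all $f\in L^{p(\cdot)}_w(0,\infty)$. $w\in A_{p(\cdot),0}$ means there is $C>0$ such that $\|w\chi_{(0,b)}\|_{p(\cdot)}\|w^{-1}\chi_{(0,b)}\|_{p'(\cdot)}\le Cb$ for every $b>0$. *)

(* Defs.v *)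
From HB Require Import structures.
From mathcomp Require Import all_boot all_order all_algebra.
From mathcomp Require Import all_classical all_reals all_analysis measurable_realfun.

Set Implicit Arguments.
Unset Strict Implicit.
Unset Printing Implicit Defensive.

Import Order.TTheory GRing.Theory Num.Theory.
Import numFieldNormedType.Exports.

Local Open Scope classical_set_scope.
Local Open Scope ring_scope.
Local Open Scope ereal_scope.

(* Functions on (0, oo) are total functions on [R]; their values outside
   (0, oo) are never used. *)

(* The canonical measurable structure of [R] is the Borel one.  [lebesgueR R]
   is [R] with the Lebesgue (completed) sigma-algebra, the domain of
   [completed_lebesgue_measure]. *)
Notation leb := completed_lebesgue_measure.

Definition lebesgueR (R : realType) : measurableType _ :=
  caratheodory_type (R := R) (mu_ext (@wlength R idfun)).

Notation measurable_pos f :=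
  (measurable_fun (`]0%R, +oo[ : set (lebesgueR _)) (f : lebesgueR _ -> _)).

Section variable_exponents.
Context {R : realType}.
Implicit Types (p r : R -> R) (f w : R -> \bar R).

Definition exponent p :=
  [/\ measurable_pos p,
      forall x : R, (0 < x)%R -> (1 <= p x)%R &
      exists M : R, forall x : R, (0 < x)%R -> (p x <= M)%R].

Definition exponent_inf p : \bar R :=
  ereal_inf [set (p x)%:E | x in [set x : R | (0 < x)%R]].

Definition exponent_sup p : \bar R :=
  ereal_sup [set (p x)%:E | x in [set x : R | (0 < x)%R]].

Definition conj_exponent p : R -> R := fun x => ((1 - (p x)^-1)^-1)%R.

Lemma conj_exponentE p x : ((p x)^-1 + (conj_exponent p x)^-1 = 1)%R.
Proof. by rewrite /conj_exponent invrK addrC subrK. Qed.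

Definition LH0 p := exists C0 p0 : R, [/\ (0 < C0)%R, (1 <= p0)%R &
  forall x : R, (0 < x < 2^-1)%R -> (`|p x - p0| <= C0 / (- ln x))%R].

Definition LHoo p := exists Coo poo : R, [/\ (0 < Coo)%R, (1 <= poo)%R &
  forall x : R, (0 < x)%R -> (`|p x - poo| <= Coo / ln (expR 1 + x))%R].

Definition luxemburg r f : \bar R :=
  ereal_inf [set mu%:E | mu in [set mu : R | (0 < mu)%R /\
    \int[leb]_(x in `]0%R, +oo[) ((`|f x| / mu%:E) `^ r x) <= 1]].

Definition weight w :=
  [/\ measurable_pos w,
      forall x : R, (0 < x)%R -> 0 <= w x,
      forall K : set R, K `<=` `]0%R, +oo[ -> compact K ->
        \int[leb]_(x in K) `|w x| < +oo &
      {ae leb, forall x : R, (0 < x)%R -> 0 < w x < +oo}].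

Definition Lpw p w : set (R -> \bar R) :=
  [set f | measurable_pos f /\ luxemburg p (fun x => f x * w x) < +oo].

Definition maxN f (x : R) : \bar R :=
  ereal_sup [set (b^-1)%:E * \int[leb]_(y in `]0%R, b[) `|f y|
            | b in [set b : R | (x < b)%R]].

Definition strong_type p w (T : (R -> \bar R) -> R -> \bar R) :=
  exists2 K : R, (0 < K)%R & forall f, Lpw p w f ->
    luxemburg p (fun x => T f x * w x) <=
      K%:E * luxemburg p (fun x => f x * w x).

(* [g \_ A] is [g] multiplied by the characteristic function of [A]. *)
Definition weak_type p w (T : (R -> \bar R) -> R -> \bar R) :=
  exists2 K : R, (0 < K)%R & forall (mu : R) f, (0 < mu)%R -> Lpw p w f ->
    mu%:E * luxemburg p (w \_ [set x : R | (0 < x)%R /\ mu%:E < T f x]) <=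
      K%:E * luxemburg p (fun x => f x * w x).

Definition Ap0 p w :=
  exists2 C : R, (0 < C)%R & forall b : R, (0 < b)%R ->
    luxemburg p (w \_ `]0%R, b[) *
      luxemburg (conj_exponent p) ((fun x => (w x)^-1) \_ `]0%R, b[) <=
    (C * b)%:E.

End variable_exponents.

(* Main.v *)
(* The intervals (0, b) are nested, so the maximal function of a sequence of
   them, with means taken against a weight V, has a layer-cake formula that
   makes it bounded on L^s(V) for constant s > 1 (Doob).  If Phi is at least
   1 / V(0, b) on each interval (0, b), the function 1 / Phi is V-integrable
   and Phi^|p(x) - q| is bounded, then p(x) may be exchanged with the constant
   q at the price of an additive error 1 / Phi, and the V-weighted maximal
   operator is bounded on L^{p(.)}(V).  Log-Hoelder continuity provides such a
   Phi for V = w^p and V = w^{-p'}: a power of 1 / x on (0, 1), where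
   q = p(0), and a power of e + x on (0, oo), where q = p(oo).  Lerner's
   argument bounds the unweighted maximal function by composing the weighted
   ones for w^{-p'} and w^p, and the dyadic values of b suffice to control N.
   Conversely, testing the weak type inequality on truncations of
   w^{-p'} yields the weight condition. *)
Require Import Defs.
From mathcomp Require Import all_boot all_order all_algebra.
From mathcomp Require Import all_classical all_reals all_analysis measurable_realfun.
From mathcomp Require Import ring lra.

Set Implicit Arguments.
Unset Strict Implicit.
Unset Printing Implicit Defensive.

Import Order.TTheory GRing.Theory Num.Theory.
Import numFieldNormedType.Exports.

Local Open Scope classical_set_scope.
Local Open Scope ring_scope.

(** * Changing the exponent of a power *)

(** The modular of a variable exponent is not homogeneous, so the variable-exponent estimates are
    stated for functions normalized by a modular bound; homogeneity enters only at the end, through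
    the norm. Doob's inequality is used with a lower bound s > 1 of p and not with q: a Jensen
    inequality for the exponents p/s and q/s is spent first, and the outer power s is what remains
    for Doob. Two families of intervals are needed because p(0) and p(oo) may differ: the masses
    V(0, b) vanish as b tends to 0, so there [Phi] must blow up at 0, while at infinity it must grow
    to make 1 / Phi integrable for V, and its large values are tolerated only where p is close to q.
    Besides log-Hoelder continuity, such a [Phi] needs information on masses. Their lower bound near
    0 comes from comparing w^p with w^(-p'), since both cannot be small at the same point; their
    polynomial growth at infinity comes from the weight condition. *)

Section real_powers.
Context {R : realType}.
Implicit Types a b c u v m g s t x y D E A Phi : R.

Lemma powR_le2l a b t : 0 <= t -> 0 <= a -> a <= b -> a `^ t <= b `^ t.
Proof.
move=> t0 a0 ab; apply: ge0_ler_powR => //; rewrite nnegrE //.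
exact: le_trans ab.
Qed.

Lemma powR_ge1 a t : 1 <= a -> 0 <= t -> 1 <= a `^ t.
Proof. by move=> a1 t0; rewrite -(powRr0 a); exact: ler_powR. Qed.

Lemma powR_le1 a t : 0 <= a <= 1 -> 0 <= t -> a `^ t <= 1.
Proof.
move=> /andP[a0 a1] t0; rewrite (le_trans (powR_le2l t0 a0 a1))//.
by rewrite powR1.
Qed.

Lemma powR_D a s t : 0 < a -> a `^ (s + t) = a `^ s * a `^ t.
Proof. by move=> a0; rewrite powRD// (gt_eqF a0)/= implybT. Qed.

(** The upper bound on [u] serves [t >= 0]; the lower one serves [t < 0], through [u^-1 <= Phi]. *)
Lemma powR_bounded u t A Phi D E : 1 <= A -> 1 <= Phi ->
  Phi^-1 <= u <= A * Phi -> `|t| <= E -> Phi `^ `|t| <= D ->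
  u `^ t <= A `^ E * D.
Proof.
move=> A1 Phi1 /andP[lu uA] tE PD.
have Phi0 : 0 < Phi by exact: lt_le_trans Phi1.
have u0 : 0 < u by apply: lt_le_trans lu; rewrite invr_gt0.
have A0 : 0 < A by exact: lt_le_trans A1.
have E0 : 0 <= E by exact: le_trans tE.
have AE1 : 1 <= A `^ E by exact: powR_ge1.
have D0 : 0 <= D by apply: le_trans PD; exact: powR_ge0.
case: (leP 0 t) => [t0|t0].
  have tt : `|t| = t by rewrite ger0_norm.
  rewrite (le_trans (powR_le2l t0 (ltW u0) uA))// powRM ?(ltW A0) ?(ltW Phi0)//.
  rewrite ler_pM ?powR_ge0//; first by apply: ler_powR => //; rewrite -tt.
  by rewrite -tt.
have tt : `|t| = - t by rewrite ltr0_norm.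
have -> : u `^ t = (u^-1) `^ (- t).
  by rewrite -(powR_inv1 (ltW u0)) -powRrM mulrNN mul1r.
have uP : u^-1 <= Phi by rewrite -(invrK Phi) lef_pV2 ?posrE ?invr_gt0.
rewrite (@le_trans _ _ (Phi `^ (- t)))//.
  by apply: powR_le2l => //; [rewrite oppr_ge0 ltW|rewrite invr_ge0 ltW].
by rewrite -tt (le_trans PD)// ler_peMl.
Qed.

(** For [u >= Phi^-1] the factor u^(e' - e) is bounded. Below [Phi^-1], u^e' is at most Phi^(-e'),
    which the same bound compares with Phi^(-e), and [e >= 1] makes this at most [Phi^-1]: hence the
    additive error. *)
Lemma powR_switch u e e' A Phi D E : 1 <= A -> 1 <= Phi ->
  0 <= u <= A * Phi -> 1 <= e -> 0 <= e' -> `|e' - e| <= E ->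
  Phi `^ `|e' - e| <= D ->
  u `^ e' <= (A `^ E * D) * (u `^ e + Phi^-1).
Proof.
move=> A1 Phi1 /andP[u0 uA] e1 e'0 eE PD.
have Phi0 : 0 < Phi by exact: lt_le_trans Phi1.
have D1 : 1 <= D by apply: le_trans PD; apply: powR_ge1.
have E0 : 0 <= E by exact: le_trans eE.
have AE1 : 1 <= A `^ E by exact: powR_ge1.
have C1 : 1 <= A `^ E * D by exact: mulr_ege1.
case: (leP Phi^-1 u) => [lu|ul].
  have u00 : 0 < u by apply: lt_le_trans lu; rewrite invr_gt0.
  have -> : e' = e + (e' - e) by rewrite addrC subrK.
  rewrite powR_D// mulrC (@le_trans _ _ (A `^ E * D * u `^ e))//.
    rewrite ler_wpM2r ?powR_ge0//; apply: (@powR_bounded _ _ _ Phi) => //.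
    by rewrite lu.
  by rewrite ler_wpM2l ?lerDl ?invr_ge0 ?(ltW Phi0)// (le_trans ler01).
have Pi1 : Phi^-1 <= 1 by rewrite invf_le1.
have Pi0 : 0 < Phi^-1 by rewrite invr_gt0.
have h1 : u `^ e' <= (Phi^-1) `^ e'.
  by apply: powR_le2l => //; exact: ltW.
apply: (le_trans h1).
have -> : e' = e + (e' - e) by rewrite addrC subrK.
rewrite powR_D// mulrC.
apply: (@le_trans _ _ (A `^ E * D * (Phi^-1) `^ e)).
  rewrite ler_wpM2r ?powR_ge0//.
  apply: (@powR_bounded _ _ _ Phi) => //.
  by rewrite lexx/= (le_trans Pi1)// mulr_ege1.
rewrite ler_wpM2l ?(le_trans ler01)//.
apply: ler_wpDl; rewrite ?powR_ge0//.
by apply: ge1r_powR => //; rewrite Pi0.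
Qed.

(* Integrating this against the probability measure with mean [m] of [g]
   absorbs the term [m `^ q' / 2] and gives a Jensen inequality with exponent
   change. *)
Lemma powR_jensen g m q q' A Phi D E M : 1 <= A -> 1 <= Phi ->
  0 <= g -> 0 < m <= A * Phi -> 1 <= q <= M -> 1 <= q' -> `|q' - q| <= E ->
  Phi `^ `|q' - q| <= D ->
  g * m `^ (q' - 1) <=
    2^-1 * m `^ q' + (A `^ E * D * 2 `^ M) * g `^ q + Phi^-1.
Proof.
move=> A1 Phi1 g0 /andP[m0 mA] /andP[q1 qM] q'1 qE PD.
have Phi0 : 0 < Phi by exact: lt_le_trans Phi1.
have D1 : 1 <= D by apply: le_trans PD; apply: powR_ge1.
have E0 : 0 <= E by exact: le_trans qE.
have AE1 : 1 <= A `^ E by exact: powR_ge1.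
have C1 : 1 <= A `^ E * D by exact: mulr_ege1.
have M0 : 0 <= M by lra.
have M1 : 1 <= 2 `^ M by apply: powR_ge1 => //; lra.
have Pi0 : 0 < Phi^-1 by rewrite invr_gt0.
have K1 : 1 <= A `^ E * D * 2 `^ M by exact: mulr_ege1.
have X0 : 0 <= 2^-1 * m `^ q' by rewrite mulr_ge0 ?powR_ge0// invr_ge0.
have Y0 : 0 <= (A `^ E * D * 2 `^ M) * g `^ q.
  by rewrite mulr_ge0 ?powR_ge0// (le_trans ler01).
(* If g <= m / 2, the first term suffices. Otherwise m < 2 g and three cases remain: m >= 1 / Phi,
   where the exponent of m is changed; m < 1 / Phi <= g, where that of 1 / Phi is changed; both
   below 1 / Phi, where the left side is at most g. *)
have [gm|mg] := leP g (2^-1 * m).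
  rewrite -addrA; apply: ler_wpDr; first by rewrite addr_ge0 // ltW.
  rewrite (_ : m `^ q' = m * m `^ (q' - 1)); last by rewrite mulr_powRB1 ?(ltW m0)//; lra.
  by rewrite mulrA ler_wpM2r// powR_ge0.
have g00 : 0 < g by apply: lt_trans mg; rewrite mulr_gt0// invr_gt0.
have [lm|ml] := leP Phi^-1 m.
  apply: ler_wpDr; first exact: ltW.
  apply: ler_wpDl => //.
  have -> : q' - 1 = (q - 1) + (q' - q) by lra.
  rewrite powR_D//.
  have h1 : m `^ (q' - q) <= A `^ E * D by apply: (@powR_bounded _ _ _ Phi); rewrite ?lm.
  have h2 : m `^ (q - 1) <= 2 `^ M * g `^ (q - 1).
    apply: (@le_trans _ _ ((2 * g) `^ (q - 1))).
      apply: powR_le2l; [lra|exact: ltW|].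
      by rewrite mulrC -ler_pdivrMr// mulrC ltW.
    rewrite powRM//.
    by rewrite ler_wpM2r ?powR_ge0// ler_powR//; lra.
  rewrite -(mulr_powRB1 g0 (lt_le_trans ltr01 q1)).
  have -> : A `^ E * D * 2 `^ M * (g * g `^ (q - 1)) = g * ((2 `^ M * g `^ (q - 1)) * (A `^ E * D)) by ring.
  by rewrite ler_wpM2l// ler_pM// powR_ge0.
have [lg|gl] := leP Phi^-1 g.
  apply: ler_wpDr; first exact: ltW.
  apply: ler_wpDl => //.
  rewrite -(mulr_powRB1 g0 (lt_le_trans ltr01 q1)).
  rewrite [leRHS]mulrCA ler_wpM2l//.
  apply: (@le_trans _ _ ((Phi^-1) `^ (q' - 1))).
    by apply: powR_le2l; lra.
  have -> : q' - 1 = (q - 1) + (q' - q) by lra.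
  rewrite powR_D// mulrC ler_pM ?powR_ge0//.
    apply: (@le_trans _ _ (A `^ E * D)); last by rewrite ler_peMr// (le_trans ler01).
    apply: (@powR_bounded _ _ _ Phi) => //.
    rewrite lexx/= (@le_trans _ _ 1)//; first by rewrite invf_le1.
    by rewrite mulr_ege1.
  by apply: powR_le2l => //; lra.
apply: ler_wpDl; first exact: addr_ge0.
have mp1 : m `^ (q' - 1) <= 1.
  apply: powR_le1; last by lra.
  by rewrite (ltW m0)/= (le_trans (ltW ml))// invf_le1.
apply: (@le_trans _ _ (Phi^-1 * 1)); last by rewrite mulr1.
by rewrite ler_pM ?powR_ge0// ltW.
Qed.

(** Young's inequality for c^(s-1) a with the exponents s / (s-1) and s, multiplied by s / (s-1). In
    the application [c] is the running maximum and [a] the mean that exceeds it. *)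
Lemma powR_sub_le a c s : 1 < s -> 0 <= a -> 0 <= c ->
  a `^ s - c `^ s <= s / (s - 1) * (a `^ (s - 1) - c `^ (s - 1)) * a.
Proof.
move=> s1 a0 c0.
have s0 : 0 < s by lra.
have s10 : 0 < s - 1 by lra.
have q0 : 0 < s / (s - 1) by rewrite divr_gt0.
have := @conjugate_powR R (c `^ (s - 1)) a (s / (s - 1)) s (powR_ge0 _ _) a0 q0 s0.
have -> : (s / (s - 1))^-1 + s^-1 = 1 by rewrite invf_div; field; lra.
move=> /(_ erefl).
rewrite -powRrM.
have -> : (s - 1) * (s / (s - 1)) = s by field; lra.
move=> yg.
have as1 : a `^ (s - 1) * a = a `^ s by rewrite mulrC mulr_powRB1.
rewrite -mulrA mulrBl as1 mulrC.
rewrite invf_div in yg.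
have h : c `^ (s - 1) * a * (s / (s - 1)) <= c `^ s + a `^ s / (s - 1).
  apply: le_trans (ler_wpM2r (ltW q0) yg) _.
  rewrite le_eqVlt; apply/orP; left; apply/eqP; field; lra.
rewrite mulrBl.
have -> : a `^ s * (s / (s - 1)) = a `^ s + a `^ s / (s - 1) by field; lra.
lra.
Qed.

(** The free [e] is there to absorb the first term. When u > e v, v is at most u / e, whence the
    power 1 - s of e. *)
Lemma powR_young u v s e : 1 < s -> 0 < e -> 0 <= u -> 0 <= v ->
  v `^ (s - 1) * u <= e * v `^ s + e `^ (1 - s) * u `^ s.
Proof.
move=> s1 e0 u0 v0.
have A0 : 0 <= e * v `^ s by rewrite mulr_ge0 ?powR_ge0 ?(ltW e0).
have B0 : 0 <= e `^ (1 - s) * u `^ s by rewrite mulr_ge0 ?powR_ge0.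
rewrite -(@mulr_powRB1 _ v s v0); last by lra.
have [uv|vu] := leP u (e * v).
  apply: ler_wpDr => //.
  by rewrite mulrC mulrA ler_wpM2r ?powR_ge0.
apply: ler_wpDl; first by rewrite mulr_powRB1//; lra.
rewrite -(mulr_powRB1 u0); last by lra.
have -> : e `^ (1 - s) * (u * u `^ (s - 1)) = (u / e) `^ (s - 1) * u.
  rewrite powRM ?invr_ge0 ?(ltW e0)// -(powR_inv1 (ltW e0)) -powRrM.
  have -> : -1 * (s - 1) = 1 - s by ring.
  by ring.
rewrite ler_wpM2r//; apply: powR_le2l; rewrite ?subr_ge0 ?(ltW s1)//.
by rewrite ler_pdivlMr// mulrC ltW.
Qed.

Lemma powR_addr_le a b s : 0 <= s -> 0 <= a -> 0 <= b ->
  (a + b) `^ s <= 2 `^ s * (a `^ s + b `^ s).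
Proof.
move=> s0 a0 b0; wlog ab : a b a0 b0 / a <= b.
  move=> h; have [ab|/ltW ba] := leP a b; first exact: h.
  by rewrite addrC [X in _ * X]addrC; exact: h.
apply: (@le_trans _ _ ((2 * b) `^ s)); first by apply: powR_le2l; lra.
by rewrite powRM// ler_wpM2l ?powR_ge0// lerDr powR_ge0.
Qed.

End real_powers.

(** * Doob's inequality for a nested family *)

Section weighted_integrals.
Local Open Scope ereal_scope.
Context d (T : measurableType d) (R : realType).
Variable mu : {measure set T -> \bar R}.
Implicit Types (D E : set T) (f g h p : T -> R).

Lemma measurable_fun_powR D f p : measurable D -> measurable_fun D f -> measurable_fun D p ->
  measurable_fun D (fun x => f x `^ p x)%R.
Proof.
move=> mD mf mp; rewrite /powR.
apply: measurable_fun_if => //.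
- exact: measurable_fun_eqr.
- apply: (@measurable_funS _ _ _ _ D) => //.
  rewrite (_ : (fun _ => _) = (fun x => if p x == 0 then 1 else 0))%R; last first.
    by apply/funext => x; case: (p x == _).
  by apply: measurable_fun_if => //; apply: measurable_fun_eqr.
- apply: (@measurable_funS _ _ _ _ D) => //.
  apply: measurableT_comp; first exact: measurable_expR.
  by apply: measurable_funM => //; apply: measurableT_comp.
Qed.

Lemma integral_indicM D E h : measurable E -> E `<=` D ->
  \int[mu]_(x in D) (\1_E x * h x)%:E = \int[mu]_(x in E) (h x)%:E.
Proof.
move=> mE ED; rewrite -{2}(setIidr ED) integral_mkcondr.
apply: eq_integral => x _; rewrite patchE indicE.
by case: ifPn => xE; rewrite ?mul1r ?mul0r.
Qed.

Lemma integral_le_lincomb D f g h (a b A B : R) : measurable D ->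
  measurable_fun D f -> measurable_fun D g -> measurable_fun D h ->
  (0 <= a)%R -> (0 <= b)%R ->
  (forall x, D x -> 0 <= f x)%R -> (forall x, D x -> 0 <= g x)%R ->
  (forall x, D x -> 0 <= h x <= a * f x + b * g x)%R ->
  \int[mu]_(x in D) (f x)%:E <= A%:E -> \int[mu]_(x in D) (g x)%:E <= B%:E ->
  \int[mu]_(x in D) (h x)%:E <= (a * A + b * B)%:E.
Proof.
move=> mD mf mg mh a0 b0 f0 g0 hfg fA gB.
apply: (@le_trans _ _ (\int[mu]_(x in D) (a%:E * (f x)%:E + b%:E * (g x)%:E))).
  apply: ge0_le_integral => //.
  - by move=> x /hfg/andP[].
  - exact/measurable_EFinP.
  - apply: emeasurable_funD; apply: measurable_funeM; exact/measurable_EFinP.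
  - by move=> x /hfg/andP[_]; rewrite -!EFinM -EFinD lee_fin.
rewrite ge0_integralD//; last first.
- by apply: measurable_funeM; exact/measurable_EFinP.
- by move=> x Dx; rewrite -EFinM lee_fin mulr_ge0 // g0.
- by apply: measurable_funeM; exact/measurable_EFinP.
- by move=> x Dx; rewrite -EFinM lee_fin mulr_ge0 // f0.
rewrite !ge0_integralZl//; try exact/measurable_EFinP; try by [rewrite lee_fin|move=> x Dx; rewrite lee_fin; auto].
by rewrite EFinD !EFinM leeD// lee_wpmul2l.
Qed.

(** The start value 0 makes the increments of powers of [cmax] telescope to the whole power. *)
Fixpoint cmax (a : nat -> R) n : R :=
  if n is m.+1 then Num.max (cmax a m) (a m) else 0%R.

(* the maximal function of the finite family [B 0, ..., B (n - 1)] when [a k]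
   is the mean over [B k] *)
Definition stepmax (B : nat -> set T) (a : nat -> R) n (x : T) : R :=
  cmax (fun k => a k * \1_(B k) x)%R n.

Lemma cmax_ge0 (a : nat -> R) n : (0 <= cmax a n)%R.
Proof. by elim: n => //= n IH; rewrite le_max IH. Qed.

Lemma le_cmaxS (a : nat -> R) n : (cmax a n <= cmax a n.+1)%R.
Proof. by rewrite /= le_max lexx. Qed.

Lemma cmax_ub (a : nat -> R) n k : (k < n)%N -> (a k <= cmax a n)%R.
Proof.
elim: n => // n IH; rewrite ltnS leq_eqVlt => /predU1P[->|/IH kn] /=.
  by rewrite le_max lexx orbT.
by rewrite le_max kn.
Qed.

Lemma cmax_cases (a : nat -> R) n : cmax a n = 0%R \/ exists2 k, (k < n)%N & cmax a n = a k.
Proof.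
elim: n => [|n [IH|[k kn IH]]]; first by left.
- rewrite /= /Order.max; case: ifP => _; last by left.
  by right; exists n.
- rewrite /= /Order.max; case: ifP => _; first by right; exists n.
  by right; exists k => //; rewrite ltnS ltnW.
Qed.

Lemma eq_cmax (a b : nat -> R) n : (forall k, (k < n)%N -> a k = b k) -> cmax a n = cmax b n.
Proof.
elim: n => //= n IH ab; rewrite IH ?ab// => k kn; apply: ab.
by rewrite ltnS ltnW.
Qed.

Lemma stepmax_ub B (a : nat -> R) n k x : (k < n)%N -> B k x ->
  (a k <= stepmax B a n x)%R.
Proof.
move=> kn Bx; apply: le_trans (cmax_ub _ kn).
by rewrite indicE mem_set// mulr1.
Qed.

Lemma stepmax_cases B (a : nat -> R) n x :
  stepmax B a n x = 0%R \/ exists k, [/\ (k < n)%N, B k x & stepmax B a n x = a k].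
Proof.
rewrite /stepmax; case: (cmax_cases (fun k => a k * \1_(B k) x)%R n) => [->|[k kn ->]].
  by left.
rewrite indicE; case: (boolP (x \in B k)) => [/set_mem Bx|_].
  by right; exists k; rewrite mulr1.
by left; rewrite mulr0.
Qed.

Lemma measurable_stepmax D B (a : nat -> R) n : (forall k, measurable (B k)) ->
  measurable_fun D (stepmax B a n).
Proof.
move=> mB; elim: n => [|n IH]; rewrite /stepmax/=; first exact: measurable_cst.
by apply: measurable_maxr => //; apply: measurable_funM.
Qed.

(** The sets decrease, so the ones that contain [x] form an initial segment, along which [stepmax]
    is the running maximum [cmax]; the sum over that segment telescopes. *)
Lemma stepmax_powR B (a : nat -> R) n x t : {homo B : k l / (k <= l)%N >-> l `<=` k} ->
  (0 < t)%R ->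
  (stepmax B a n x `^ t =
   \sum_(k < n) (cmax a k.+1 `^ t - cmax a k `^ t) * \1_(B k) x)%R.
Proof.
move=> dB t0; elim: n => [|n IH]; first by rewrite big_ord0 powR0 ?gt_eqF.
rewrite big_ord_recr/= -IH.
rewrite indicE; case: (boolP (x \in B n)) => [/set_mem Bx|nBx]; last first.
  rewrite mulr0 addr0 {1}/stepmax/= indicE (negbTE nBx) mulr0.
  by rewrite max_l//; exact: cmax_ge0.
have e m : (m <= n.+1)%N -> stepmax B a m x = cmax a m.
  move=> mn; apply: eq_cmax => k km; rewrite indicE mem_set ?mulr1//.
  apply: (dB _ n) => //; rewrite -ltnS.
  exact: leq_trans mn.
by rewrite mulr1 !e//= addrC subrK.
Qed.

Lemma integral_stepmax_powR D B (a : nat -> R) n h t : measurable D ->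
  (forall k, measurable (B k)) -> (forall k, B k `<=` D) ->
  {homo B : k l / (k <= l)%N >-> l `<=` k} -> (0 < t)%R ->
  measurable_fun D h -> (forall x, D x -> 0 <= h x)%R ->
  \int[mu]_(x in D) (stepmax B a n x `^ t * h x)%:E =
  \sum_(k < n) (cmax a k.+1 `^ t - cmax a k `^ t)%:E * \int[mu]_(x in B k) (h x)%:E.
Proof.
move=> mD mB BD dB t0 mh h0.
have c0 k : (0 <= cmax a k.+1 `^ t - cmax a k `^ t)%R.
  by rewrite subr_ge0; apply: powR_le2l; rewrite ?(ltW t0) ?cmax_ge0 ?le_cmaxS.
under eq_integral do rewrite stepmax_powR// mulr_suml -sumEFin.
rewrite -(big_mkord xpredT (fun k => (cmax a k.+1 `^ t - cmax a k `^ t)%:E * \int[mu]_(x in B k) (h x)%:E)).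
under eq_integral do rewrite -(big_mkord xpredT (fun k => ((cmax a k.+1 `^ t - cmax a k `^ t) * \1_(B k) _ * h _)%:E)).
rewrite ge0_integral_sum//.
- apply: eq_bigr => k _.
  under eq_integral do rewrite -mulrA EFinM.
  rewrite ge0_integralZl ?lee_fin//.
  + by rewrite integral_indicM.
  + by apply/measurable_EFinP; apply: measurable_funM => //; exact: measurable_indic.
  + by move=> x Dx; rewrite lee_fin mulr_ge0 ?h0.
- move=> k; apply/measurable_EFinP; apply: measurable_funM => //.
  by apply: measurable_funM => //; exact: measurable_indic.
- by move=> k x Dx; rewrite lee_fin !mulr_ge0 ?h0.
Qed.

Definition wmean (V : T -> R) g E : R :=
  (fine (\int[mu]_(x in E) (g x * V x)%:E) / fine (\int[mu]_(x in E) (V x)%:E))%R.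

(* Doob's inequality.  [stepmax_powR] is a layer-cake formula, and
   [powR_sub_le] passes from exponent [s] to [s - 1] in each layer. *)
Lemma integral_stepmax_wmean D B (V u : T -> R) n (s A : R) : measurable D ->
  (forall k, measurable (B k)) -> (forall k, B k `<=` D) ->
  {homo B : k l / (k <= l)%N >-> l `<=` k} -> (1 < s)%R ->
  measurable_fun D V -> (forall x, D x -> 0 <= V x)%R ->
  (forall k, 0 < \int[mu]_(x in B k) (V x)%:E < +oo) ->
  measurable_fun D u -> (forall x, D x -> 0 <= u x)%R ->
  \int[mu]_(x in D) (u x `^ s * V x)%:E <= A%:E ->
  \int[mu]_(x in D) (stepmax B (fun k => wmean V u (B k)) n x `^ s * V x)%:E
    <= ((2 * (s / (s - 1))) `^ s * A)%:E.
Proof.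
move=> mD mB BD dB s1 mV V0 VB mu_ u0 uA.
set a := fun k => wmean V u (B k).
have s0 : (0 < s)%R by lra.
have sm0 : (0 < s - 1)%R by lra.
have q0 : (0 < s / (s - 1))%R by rewrite divr_gt0.
have muV : measurable_fun D (fun x => u x * V x)%R by exact: measurable_funM.
have uV0 x : D x -> (0 <= u x * V x)%R by move=> Dx; rewrite mulr_ge0 ?u0 ?V0.
have musV : measurable_fun D (fun x => u x `^ s * V x)%R.
  by apply: measurable_funM => //; apply: measurable_fun_powR.
have Vf k : \int[mu]_(x in B k) (V x)%:E = (fine (\int[mu]_(x in B k) (V x)%:E))%:E.
  by rewrite fineK// ge0_fin_numE ?(ltW (andP (VB k)).1)// (andP (VB k)).2.
have Vk0 k : (0 < fine (\int[mu]_(x in B k) (V x)%:E))%R.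
  by rewrite -lte_fin -Vf (andP (VB k)).1.
(* The means are finite because u <= 1 + u^s. *)
have Fa k : \int[mu]_(x in B k) (u x * V x)%:E =
            (a k * fine (\int[mu]_(x in B k) (V x)%:E))%:E.
  rewrite /a /wmean divfK ?gt_eqF// fineK// ge0_fin_numE; last first.
    by apply: integral_ge0 => x /BD Dx; rewrite lee_fin uV0.
  apply: (@le_lt_trans _ _ (1 * fine (\int[mu]_(x in B k) (V x)%:E) + 1 * A)%:E); last exact: ltry.
  apply: (@integral_le_lincomb _ V (fun x => u x `^ s * V x)%R) => //.
  - exact: measurable_funS (BD k) _.
  - exact: measurable_funS (BD k) _.
  - exact: measurable_funS (BD k) _.
  - by move=> x /BD /V0.
  - by move=> x /BD Dx; rewrite mulr_ge0 ?powR_ge0 ?V0.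
  - move=> x /BD Dx; rewrite uV0//= !mul1r -{2}(mul1r (V x)) -mulrDl.
    rewrite ler_wpM2r ?V0//.
    have [u1|/ltW u1] := leP (u x) 1%R; first by rewrite ler_wpDr ?powR_ge0.
    by rewrite ler_wpDl// le1r_powR// ltW.
  - by rewrite -Vf.
  - apply: le_trans uA; apply: ge0_subset_integral => //.
      exact/measurable_EFinP.
    by move=> x Dx; rewrite lee_fin mulr_ge0 ?powR_ge0 ?V0.
have a0 k : (0 <= a k)%R.
  rewrite /a /wmean divr_ge0 ?(ltW (Vk0 k))// fine_ge0// integral_ge0// => x /BD Dx.
  by rewrite lee_fin uV0.
set v := stepmax B a n.
have v0 x : (0 <= v x)%R by exact: cmax_ge0.
have mv : measurable_fun D v by exact: measurable_stepmax.
have mvs : measurable_fun D (fun x => v x `^ s * V x)%R.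
  by apply: measurable_funM => //; apply: measurable_fun_powR.
have mvs1 : measurable_fun D (fun x => v x `^ (s - 1) * (u x * V x))%R.
  by apply: measurable_funM => //; apply: measurable_fun_powR.
have step1 : \int[mu]_(x in D) (v x `^ s * V x)%:E <=
    (s / (s - 1))%:E * \int[mu]_(x in D) (v x `^ (s - 1) * (u x * V x))%:E.
  rewrite !integral_stepmax_powR//.
  under [in leRHS]eq_bigr do rewrite Fa.
  rewrite ge0_sume_distrr; last first.
    move=> k _; rewrite -EFinM lee_fin mulr_ge0//.
      by rewrite subr_ge0; apply: powR_le2l; rewrite ?(ltW sm0) ?cmax_ge0 ?le_cmaxS.
    exact: mulr_ge0 (a0 _) (ltW (Vk0 _)).
  apply: lee_sum => k _; rewrite Vf -!EFinM lee_fin 2!mulrA ler_wpM2r ?(ltW (Vk0 _))//.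
  (* A layer where the running maximum does not grow vanishes on both sides; in the others its new
     value is the mean [a k], the factor in [powR_sub_le]. *)
  rewrite /= /Order.max; case: ifP => ca; last by rewrite !subrr !mulr0 !mul0r.
  by apply: powR_sub_le => //; exact: cmax_ge0.
(* The family is finite, hence so is this integral, and a fraction of it can be absorbed below. *)
have Xfin : \int[mu]_(x in D) (v x `^ s * V x)%:E =
    (fine (\int[mu]_(x in D) (v x `^ s * V x)%:E))%:E.
  rewrite fineK// integral_stepmax_powR//.
  apply: (big_ind (fun y : \bar R => y \is a fin_num)) => //.
    by move=> y z yf zf; rewrite fin_numD yf.
  by move=> k _; rewrite Vf -EFinM.
set X := fine _ in Xfin.
(* Chosen so that e s / (s-1) = 1/2: half of [X] moves to the left. *)
pose e := (2 * (s / (s - 1)))^-1%R.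
have e0 : (0 < e)%R by rewrite invr_gt0 mulr_gt0.
have step2 : \int[mu]_(x in D) (v x `^ (s - 1) * (u x * V x))%:E <=
    (e * X + e `^ (1 - s) * A)%:E.
  apply: (@integral_le_lincomb _ (fun x => v x `^ s * V x) (fun x => u x `^ s * V x))%R => //.
  - exact: ltW.
  - exact: powR_ge0.
  - by move=> x Dx; rewrite mulr_ge0 ?powR_ge0 ?V0.
  - by move=> x Dx; rewrite mulr_ge0 ?powR_ge0 ?V0.
  - move=> x Dx; rewrite mulr_ge0 ?powR_ge0 ?uV0//= !mulrA -mulrDl.
    by rewrite ler_wpM2r ?V0//; apply: powR_young => //; exact: u0.
  - by rewrite Xfin.
have : X%:E <= (s / (s - 1))%:E * (e * X + e `^ (1 - s) * A)%:E.
  by rewrite -Xfin (le_trans step1)// lee_wpmul2l// lee_fin ltW.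
rewrite Xfin -EFinM !lee_fin mulrDr.
have -> : (s / (s - 1) * (e * X) = 2^-1 * X)%R.
  by rewrite mulrA; congr (_ * _)%R; rewrite /e; field; lra.
have -> : (s / (s - 1) * (e `^ (1 - s) * A) = 2^-1 * ((2 * (s / (s - 1))) `^ s * A))%R.
  have -> : (e `^ (1 - s) = (2 * (s / (s - 1))) `^ (s - 1))%R.
    rewrite /e -powR_inv1; last by rewrite mulr_ge0 // ltW.
    by rewrite -powRrM; congr powR; ring.
  rewrite -(@mulr_powRB1 _ (2 * (s / (s - 1))) s)//; first by field; lra.
  by rewrite mulr_ge0 // ltW.
lra.
Qed.

End weighted_integrals.

(** * Variable exponents *)

Section variable_maximal.
Local Open Scope ereal_scope.
Context d (T : measurableType d) (R : realType).
Variable mu : {measure set T -> \bar R}.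
Implicit Types (D E : set T) (f g h p V Phi : T -> R).

(* [Phi] measures how far the exponent [p x] may be exchanged with the constant
   [q] on functions bounded by [Phi]: the factor [Phi `^ `|p - q|] is bounded
   by [K], and the additive error [Phi^-1] is integrable for [V]. *)
Record nested_base D (B : nat -> set T) V p (q : R) Phi (s M A K : R) : Prop := {
  nb_mD : measurable D;
  nb_mB : forall k, measurable (B k);
  nb_BD : forall k, B k `<=` D;
  nb_dB : {homo B : k l / (k <= l)%N >-> l `<=` k};
  nb_mV : measurable_fun D V;
  nb_V0 : forall x, D x -> (0 <= V x)%R;
  nb_V : forall k, 0 < \int[mu]_(x in B k) (V x)%:E < +oo;
  nb_mp : measurable_fun D p;
  nb_p : forall x, D x -> (s <= p x <= M)%R;
  nb_q : (s <= q <= M)%R;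
  nb_mPhi : measurable_fun D Phi;
  nb_Phi1 : forall x, D x -> (1 <= Phi x)%R;
  nb_log : forall x, D x -> (Phi x `^ `|p x - q| <= K)%R;
  nb_Vlow : forall k x, B k x -> ((fine (\int[mu]_(x in B k) (V x)%:E))^-1 <= Phi x)%R;
  nb_VPhi : \int[mu]_(x in D) ((Phi x)^-1 * V x)%:E <= A%:E
}.

Lemma measurable_funVr D f : measurable D -> measurable_fun D f ->
  (forall x, D x -> 0 < f x)%R -> measurable_fun D (fun x => (f x)^-1)%R.
Proof.
move=> mD mf f0.
apply: (eq_measurable_fun (fun x => f x `^ (-1))%R).
  by move=> x /set_mem Dx; rewrite powR_inv1// ltW// f0.
by apply: measurable_fun_powR.
Qed.

Section base.
Variables (D : set T) (B : nat -> set T) (V p : T -> R) (q : R) (Phi : T -> R).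
Variables (s M A K : R).
Hypotheses (s1 : (1 < s)%R) (A1 : (1 <= A)%R) (K1 : (1 <= K)%R).
Hypothesis base : nested_base D B V p q Phi s M A K.

Let mD := nb_mD base.
Let mB := nb_mB base.
Let BD := nb_BD base.
Let mV := nb_mV base.
Let V0 := nb_V0 base.
Let mp := nb_mp base.
Let mPhi := nb_mPhi base.
Let Phi1 := nb_Phi1 base.

Let Vm k := fine (\int[mu]_(x in B k) (V x)%:E).

Lemma nested_base_fin k : \int[mu]_(x in B k) (V x)%:E = (Vm k)%:E.
Proof.
have /andP[a b] := nb_V base k.
by rewrite /Vm fineK// ge0_fin_numE ?(ltW a).
Qed.
Let VmE := nested_base_fin.

Lemma nested_base_gt0 k : (0 < Vm k)%R.
Proof. by have /andP[a b] := nb_V base k; rewrite -lte_fin -VmE. Qed.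
Let Vm0 := nested_base_gt0.

Let Phi0 x : D x -> (0 < Phi x)%R.
Proof. by move=> Dx; apply: lt_le_trans (Phi1 Dx). Qed.

Let Pi0 x : D x -> (0 <= (Phi x)^-1)%R.
Proof. by move=> Dx; rewrite invr_ge0 ltW// Phi0. Qed.

Let mPhiV : measurable_fun D (fun x => (Phi x)^-1 * V x)%R.
Proof. by apply: measurable_funM => //; apply: measurable_funVr. Qed.

Lemma nested_base_sub k h (C : R) : measurable_fun D h -> (forall x, D x -> 0 <= h x)%R ->
  \int[mu]_(x in D) (h x)%:E <= C%:E -> \int[mu]_(x in B k) (h x)%:E <= C%:E.
Proof.
move=> mh h0; apply: le_trans; apply: ge0_subset_integral => //.
exact/measurable_EFinP.
Qed.

(** From g <= 1 + g^p the mean is at most 1 + A / V(B k), and 1 / V(B k) <= Phi on [B k]. The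
    pointwise bound is what allows exponent changes on the mean. *)
Lemma wmean_le g k : measurable_fun D g -> (forall x, D x -> 0 <= g x)%R ->
  \int[mu]_(x in D) (g x `^ p x * V x)%:E <= A%:E ->
  \int[mu]_(x in B k) (g x * V x)%:E = (wmean mu V g (B k) * Vm k)%:E /\
  (forall x, B k x -> 0 <= wmean mu V g (B k) <= (1 + A) * Phi x)%R.
Proof.
move=> mg g0 gA.
have mgp : measurable_fun D (fun x => g x `^ p x * V x)%R.
  by apply: measurable_funM => //; apply: measurable_fun_powR.
have gV0 : 0 <= \int[mu]_(x in B k) (g x * V x)%:E.
  by apply: integral_ge0 => x /BD Dx; rewrite lee_fin mulr_ge0 ?g0 ?V0.
have gle : \int[mu]_(x in B k) (g x * V x)%:E <= (1 * Vm k + 1 * A)%:E.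
  apply: (@integral_le_lincomb _ _ _ _ _ V (fun x => g x `^ p x * V x)%R) => //.
  - exact: measurable_funS (@BD k) _.
  - exact: measurable_funS (@BD k) _.
  - by apply: measurable_funS (@BD k) _ => //; exact: measurable_funM.
  - by move=> x /BD /V0.
  - by move=> x /BD Dx; rewrite mulr_ge0 ?powR_ge0 ?V0.
  - move=> x /BD Dx; rewrite mulr_ge0 ?g0 ?V0//= !mul1r -{2}(mul1r (V x)) -mulrDl.
    rewrite ler_wpM2r ?V0//.
    have [u1|/ltW u1] := leP (g x) 1%R; first by rewrite ler_wpDr ?powR_ge0.
    have /andP[sp _] := nb_p base Dx.
    by rewrite ler_wpDl// le1r_powR// (le_trans (ltW s1)).
  - by rewrite VmE.
  - apply: nested_base_sub => // x Dx.
    by rewrite mulr_ge0 ?powR_ge0 ?V0.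
have fing : \int[mu]_(x in B k) (g x * V x)%:E \is a fin_num.
  by rewrite ge0_fin_numE// (le_lt_trans gle)// ltry.
split.
  by rewrite /wmean -/(Vm k) divfK ?gt_eqF// fineK.
move=> x Bx; rewrite /wmean -/(Vm k) (divr_ge0 (fine_ge0 gV0) (ltW (Vm0 k)))/=.
have F1 : (fine (\int[mu]_(x in B k) (g x * V x)%:E) <= Vm k + A)%R.
  by rewrite -lee_fin fineK// (le_trans gle)// !mul1r.
have P1 := Phi1 (BD Bx).
have VP : ((Vm k)^-1 <= Phi x)%R by exact: (nb_Vlow base).
apply: (@le_trans _ _ ((Vm k + A) / Vm k)%R).
  by rewrite ler_wpM2r// invr_ge0 ltW.
rewrite mulrDl divff ?gt_eqF// mulrDl mul1r lerD// ler_wpM2l//.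
exact: le_trans A1.
Qed.

Let E1 : (1 <= 1 + A)%R. Proof. by rewrite lerDl; exact: le_trans A1. Qed.

(** [powR_jensen] for the exponents p/s and q/s, integrated over [B k]; the term with factor 1/2 is
    absorbed. Division by [s] keeps both exponents at least 1 and does not increase their
    distance. *)
Lemma wmean_jensen g k : measurable_fun D g -> (forall x, D x -> 0 <= g x)%R ->
  \int[mu]_(x in D) (g x `^ p x * V x)%:E <= A%:E ->
  (wmean mu V g (B k) `^ (q / s) <= 2 * wmean mu V (fun x =>
     (1 + A) `^ M * K * 2 `^ M * g x `^ (p x / s) + (Phi x)^-1) (B k))%R.
Proof.
move=> mg g0 gA; set C1 := ((1 + A) `^ M * K * 2 `^ M)%R.
pose u := (fun x => C1 * g x `^ (p x / s) + (Phi x)^-1)%R; rewrite -/u.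
have [gE gle] := wmean_le k mg g0 gA.
have s0 : (0 < s)%R by exact: lt_trans ltr01 s1.
have s1' := s1.
have /andP[sq qM] := nb_q base.
have qs1 : (1 <= q / s)%R by rewrite ler_pdivlMr ?mul1r.
have M1 : (1 <= M)%R by lra.
have C10 : (0 <= C1)%R by rewrite !mulr_ge0 ?powR_ge0//; exact: le_trans K1.
have u0 x : D x -> (0 <= u x)%R.
  by move=> Dx; apply: addr_ge0 (Pi0 Dx); rewrite mulr_ge0 ?powR_ge0.
have mgps : measurable_fun D (fun x => g x `^ (p x / s))%R.
  by apply: measurable_fun_powR => //; apply: measurable_funM.
have mu_ : measurable_fun D u.
  apply: measurable_funD; first exact: measurable_funM.
  exact: measurable_funVr.
have muV : measurable_fun D (fun x => u x * V x)%R by exact: measurable_funM.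
have mgp : measurable_fun D (fun x => g x `^ p x * V x)%R.
  by apply: measurable_funM => //; apply: measurable_fun_powR.
have uV0 x : D x -> (0 <= u x * V x)%R by move=> Dx; rewrite mulr_ge0 ?u0 ?V0.
set m := wmean mu V g (B k).
set mu_k := wmean mu V u (B k).
have mPV : measurable_fun D (fun x => g x `^ p x * V x + (Phi x)^-1 * V x)%R.
  exact: measurable_funD.
have uI : \int[mu]_(x in B k) (u x * V x)%:E = (mu_k * Vm k)%:E.
  rewrite /mu_k /wmean -/(Vm k) divfK ?gt_eqF// fineK// ge0_fin_numE; last first.
    by apply: integral_ge0 => x /BD Dx; rewrite lee_fin uV0.
  apply: (@le_lt_trans _ _ (C1 * Vm k + (C1 + 1) * (1 * A + 1 * A))%:E); last exact: ltry.
  apply: (@integral_le_lincomb _ _ _ _ _ V (fun x => g x `^ p x * V x + (Phi x)^-1 * V x)%R) => //.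
  - exact: measurable_funS (@BD k) _.
  - exact: measurable_funS (@BD k) _.
  - exact: measurable_funS (@BD k) _.
  - by rewrite addr_ge0.
  - by move=> x /BD /V0.
  - move=> x /BD Dx; rewrite -mulrDl mulr_ge0 ?V0// addr_ge0 ?powR_ge0 ?Pi0//.
  - move=> x /BD Dx; rewrite uV0//= -mulrDl mulrA -mulrDl ler_wpM2r ?V0//.
    have /andP[sp _] := nb_p base Dx.
    have h : (g x `^ (p x / s) <= 1 + g x `^ p x)%R.
      have [g1|/ltW g1] := leP (g x) 1%R.
        rewrite ler_wpDr ?powR_ge0// powR_le1 ?g0//.
        by apply: divr_ge0; lra.
      rewrite ler_wpDl// ler_powR// ler_pdivrMr// ler_peMr//; lra.
    have h2 := ler_wpM2l C10 h.
    have h3 : (0 <= C1 * (Phi x)^-1)%R by rewrite mulr_ge0 ?Pi0//.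
    have h4 : (0 <= g x `^ p x)%R by exact: powR_ge0.
    rewrite /u; lra.
  - by rewrite VmE.
  - apply: nested_base_sub => //.
      move=> x Dx; rewrite -mulrDl mulr_ge0 ?V0// addr_ge0 ?powR_ge0 ?Pi0//.
    apply: (@integral_le_lincomb _ _ _ _ _ (fun x => g x `^ p x * V x)%R (fun x => (Phi x)^-1 * V x)%R) => //.
    + by move=> x Dx; rewrite mulr_ge0 ?powR_ge0 ?V0.
    + by move=> x Dx; rewrite mulr_ge0 ?V0 ?Pi0//.
    + move=> x Dx; rewrite !mul1r lexx -mulrDl mulr_ge0 ?V0// addr_ge0 ?powR_ge0 ?Pi0//.
    + exact: (nb_VPhi base).
have m0 : (0 <= m)%R.
  rewrite /m /wmean divr_ge0 ?(ltW (Vm0 k))// fine_ge0// integral_ge0// => x /BD Dx.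
  by rewrite lee_fin mulr_ge0 ?g0 ?V0.
have mu_k0 : (0 <= mu_k)%R.
  rewrite /mu_k /wmean divr_ge0 ?(ltW (Vm0 k))// fine_ge0// integral_ge0// => x /BD Dx.
  by rewrite lee_fin uV0.
have [->|mn0] := eqVneq m 0%R.
  rewrite powR0; first exact: mulr_ge0.
  by rewrite gt_eqF// (lt_le_trans ltr01 qs1).
have mp0 : (0 < m)%R by rewrite lt_def mn0.
have key : \int[mu]_(x in B k) (m `^ (q / s - 1) * (g x * V x))%:E <=
    (2^-1 * m `^ (q / s) * Vm k + 1 * (mu_k * Vm k))%:E.
  apply: (@integral_le_lincomb _ _ _ _ _ V (fun x => u x * V x)%R) => //.
  - exact: measurable_funS (@BD k) _.
  - exact: measurable_funS (@BD k) _.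
  - apply: measurable_funS (@BD k) _ => //; apply: measurable_funM => //.
    exact: measurable_funM.
  - by rewrite mulr_ge0 ?powR_ge0// invr_ge0.
  - by move=> x /BD /V0.
  - by move=> x /BD /uV0.
  - move=> x Bx; have Dx := BD Bx.
    rewrite mulr_ge0 ?powR_ge0 ?mulr_ge0 ?g0 ?V0//= mul1r mulrA -mulrDl.
    rewrite ler_wpM2r ?V0// mulrC /u addrA.
    have /andP[sp pM] := nb_p base Dx.
    have dq : (`|q / s - p x / s| <= `|p x - q|)%R.
      rewrite -mulrBl normrM distrC ler_piMr//.
      by rewrite gtr0_norm ?invr_gt0// invf_le1//; lra.
    have dM : (`|p x - q| <= M)%R by rewrite ler_norml; lra.
    apply: powR_jensen => //.
    + exact: Phi1.
    + exact: g0.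
    + by rewrite mp0; have /andP[] := gle _ Bx.
    + rewrite ler_pdivlMr// mul1r sp/= (le_trans _ pM)// ler_pdivrMr// ler_peMr//; lra.
    + exact: le_trans dM.
    + by apply: le_trans (nb_log base Dx); apply: ler_powR => //; exact: Phi1.
  - by rewrite VmE.
  - by rewrite uI.
move: key.
under eq_integral do rewrite EFinM.
rewrite ge0_integralZl//; last 3 first.
- apply/measurable_EFinP/(measurable_funS _ (@BD k)) => //; exact: measurable_funM.
- by move=> x /BD Dx; rewrite lee_fin mulr_ge0 ?g0 ?V0.
- by rewrite lee_fin powR_ge0.
have mE : (m `^ (q / s - 1) * m = m `^ (q / s))%R.
  by rewrite mulrC mulr_powRB1 ?(ltW mp0)// (lt_le_trans ltr01 qs1).
rewrite gE -EFinM lee_fin => key.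
have {key} : (m `^ (q / s) * Vm k <= (2^-1 * m `^ (q / s) + mu_k) * Vm k)%R.
  by rewrite -{1}mE -mulrA mulrDl -[(mu_k * Vm k)%R]mul1r.
rewrite ler_pM2r//; lra.
Qed.

(** m^p is exchanged for m^q = (m^(q/s))^s, Jensen bounds m^(q/s) by twice the maximal function [v]
    of [u], and Doob with exponent s applies to [v], since u^s is controlled by g^p and 1 / Phi. The
    pointwise bound on [m] is returned too, for later exponent changes. *)
Lemma variable_maximal g n :
  measurable_fun D g -> (forall x, D x -> 0 <= g x)%R ->
  \int[mu]_(x in D) (g x `^ p x * V x)%:E <= A%:E ->
  let m := stepmax B (fun k => wmean mu V g (B k)) n in
  let C4 := ((1 + A) `^ M * K)%R in
  let C1 := (C4 * 2 `^ M)%R in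
  let A2 := (2 `^ s * C1 `^ s * A + 2 `^ s * A)%R in
  let A3 := ((2 * (s / (s - 1))) `^ s * A2)%R in
  (forall x, D x -> 0 <= m x <= (1 + A) * Phi x)%R /\
  \int[mu]_(x in D) (m x `^ p x * V x)%:E <= (C4 * 2 `^ s * A3 + C4 * A)%:E.
Proof.
move=> mg g0 gA m C4 C1 A2 A3.
have s0 : (0 < s)%R by exact: lt_trans ltr01 s1.
have s1' := s1.
have /andP[sq qM] := nb_q base.
have M1 : (1 <= M)%R by lra.
have C40 : (0 <= C4)%R by rewrite mulr_ge0 ?powR_ge0//; exact: le_trans K1.
have C10 : (0 <= C1)%R by rewrite mulr_ge0 ?powR_ge0.
have mle x : D x -> (0 <= m x <= (1 + A) * Phi x)%R.
  move=> Dx; rewrite cmax_ge0/=.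
  have [mx0|[k [kn Bx mxk]]] := stepmax_cases B (fun k => wmean mu V g (B k)) n x.
    by rewrite /m mx0 mulr_ge0 ?(ltW (Phi0 Dx))// (le_trans ler01).
  rewrite /m mxk; have [_ h] := wmean_le k mg g0 gA.
  by have /andP[] := h _ Bx.
split => //.
pose u := (fun x => C1 * g x `^ (p x / s) + (Phi x)^-1)%R.
have u0 x : D x -> (0 <= u x)%R.
  by move=> Dx; apply: addr_ge0 (Pi0 Dx); rewrite mulr_ge0 ?powR_ge0.
have mgps : measurable_fun D (fun x => g x `^ (p x / s))%R.
  by apply: measurable_fun_powR => //; apply: measurable_funM.
have mu_ : measurable_fun D u.
  apply: measurable_funD; first exact: measurable_funM.
  exact: measurable_funVr.
have mgp : measurable_fun D (fun x => g x `^ p x * V x)%R.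
  by apply: measurable_funM => //; apply: measurable_fun_powR.
have musV : measurable_fun D (fun x => u x `^ s * V x)%R.
  by apply: measurable_funM => //; apply: measurable_fun_powR.
have usA : \int[mu]_(x in D) (u x `^ s * V x)%:E <= A2%:E.
  apply: (@integral_le_lincomb _ _ _ _ _ (fun x => g x `^ p x * V x)%R (fun x => (Phi x)^-1 * V x)%R) => //.
  - by rewrite mulr_ge0 ?powR_ge0.
  - by move=> x Dx; rewrite mulr_ge0 ?powR_ge0 ?V0.
  - by move=> x Dx; rewrite mulr_ge0 ?V0 ?Pi0//.
  - move=> x Dx; rewrite mulr_ge0 ?powR_ge0 ?V0//= !mulrA -mulrDl ler_wpM2r ?V0//.
    rewrite /u; apply: (le_trans (powR_addr_le (ltW s0) (mulr_ge0 C10 (powR_ge0 _ _)) (Pi0 Dx))).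
    rewrite -[in leRHS]mulrA -mulrDr ler_wpM2l ?powR_ge0//.
    rewrite powRM ?powR_ge0// -powRrM divfK ?gt_eqF// lerD//.
    apply: ge1r_powR; last by lra.
    by rewrite invr_gt0 (Phi0 Dx)/= invf_le1 ?Phi1 ?Phi0.
  - exact: (nb_VPhi base).
pose v := stepmax B (fun k => wmean mu V u (B k)) n.
have vsA : \int[mu]_(x in D) (v x `^ s * V x)%:E <= A3%:E.
  apply: integral_stepmax_wmean => //; first exact: (nb_dB base).
  exact: (nb_V base).
have v0 x : (0 <= v x)%R by exact: cmax_ge0.
have mv x : (m x `^ (q / s) <= 2 * v x)%R.
  have [mx0|[k [kn Bx mxk]]] := stepmax_cases B (fun k => wmean mu V g (B k)) n x.
    rewrite /m mx0 powR0 ?mulr_ge0// gt_eqF// divr_gt0//; lra.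
  rewrite /m mxk; apply: (le_trans (wmean_jensen k mg g0 gA)).
  rewrite ler_wpM2l// /v.
  by apply: (@stepmax_ub _ _ _ B (fun k => wmean mu V u (B k))).
have mm : measurable_fun D m by exact: measurable_stepmax.
have mv_ : measurable_fun D v by exact: measurable_stepmax.
apply: (@integral_le_lincomb _ _ _ _ _ (fun x => v x `^ s * V x)%R (fun x => (Phi x)^-1 * V x)%R) => //.
- by apply: measurable_funM => //; apply: measurable_fun_powR.
- by apply: measurable_funM => //; apply: measurable_fun_powR.
- by rewrite mulr_ge0 ?powR_ge0.
- by move=> x Dx; rewrite mulr_ge0 ?powR_ge0 ?V0.
- by move=> x Dx; rewrite mulr_ge0 ?V0 ?Pi0//.
- move=> x Dx; rewrite mulr_ge0 ?powR_ge0 ?V0//= !mulrA -mulrDl ler_wpM2r ?V0//.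
  have /andP[sp pM] := nb_p base Dx.
  apply: (@le_trans _ _ (C4 * (m x `^ q + (Phi x)^-1))%R).
    apply: powR_switch => //; rewrite ?Phi1 ?mle//; try lra.
      by rewrite ler_norml; lra.
    exact: (nb_log base).
  rewrite mulrDr lerD2r -mulrA ler_wpM2l// -powRM//.
  have -> : (m x `^ q = (m x `^ (q / s)) `^ s)%R by rewrite -powRrM divfK// gt_eqF.
  by apply: powR_le2l => //; rewrite ?powR_ge0 ?(ltW s0).
- exact: (nb_VPhi base).
Qed.

End base.
End variable_maximal.

(** * Conjugate exponents *)

Section conjugate_exponents.
Context {R : realType}.
Implicit Types a c s M t u K Phi : R.

Definition hconj a : R := (1 - a^-1)^-1.

Lemma hconjE a : 1 < a -> hconj a = a / (a - 1).
Proof. by move=> a1; rewrite /hconj; field; lra. Qed.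

Lemma hconj_sub1 a : 1 < a -> hconj a - 1 = (a - 1)^-1.
Proof. by move=> a1; rewrite hconjE//; field; lra. Qed.

Lemma hconj_gt1 a : 1 < a -> 1 < hconj a.
Proof. by move=> a1; rewrite -subr_gt0 hconj_sub1// invr_gt0 subr_gt0. Qed.

Lemma hconj_mulB1 a : 1 < a -> hconj a * (a - 1) = a.
Proof. by move=> a1; rewrite hconjE//; field; lra. Qed.

Lemma hconjK a : 1 < a -> hconj (hconj a) = a.
Proof. by move=> a1; rewrite hconjE ?hconj_gt1// hconj_sub1// hconjE//; field; lra. Qed.

Lemma hconj_le a c : 1 < a -> a <= c -> hconj c <= hconj a.
Proof.
move=> a1 ac; rewrite -(lerD2r (- 1)) !hconj_sub1//; last by lra.
by rewrite lef_pV2 ?posrE; lra.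
Qed.

Lemma hconj_dist s a c : 1 < s -> s <= a -> s <= c ->
  `|hconj a - hconj c| <= (s - 1)^-1 * (s - 1)^-1 * `|a - c|.
Proof.
move=> s1 sa sc.
have -> : hconj a - hconj c = (a - 1)^-1 * (c - 1)^-1 * (c - a).
  by rewrite !hconjE; [field; lra|lra|lra].
rewrite normrM [`|c - a|]distrC ler_wpM2r// normrM.
by rewrite !gtr0_norm ?ler_pM// ?invr_ge0 ?invr_gt0 ?lef_pV2 ?posrE; lra.
Qed.

(** Read a = p(x) and c = q. For constant p the exponent (q - 1) p' equals p; in general it differs
    from p by a multiple of |p - q|, as p' (p - 1) = p. *)
Lemma hconj_switch s a c : 1 < s -> s <= a -> s <= c ->
  `|(c - 1) * hconj a - a| <= hconj s * `|a - c|.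
Proof.
move=> s1 sa sc; have a1 : 1 < a by lra.
have := hconj_le s1 sa; have := hconj_gt1 a1 => h1 h2.
rewrite -[X in _ - X](hconj_mulB1 a1).
have -> : (c - 1) * hconj a - hconj a * (a - 1) = hconj a * (c - a) by ring.
by rewrite normrM [`|c - a|]distrC ler_wpM2r// ger0_norm//; lra.
Qed.

(** The exchange in the other direction: p / (q - 1) would be p' if p were the constant q. *)
Lemma div_hconj_switch s a c : 1 < s -> s <= a -> s <= c ->
  `|a / (c - 1) - hconj a| <= hconj s / (s - 1) * `|a - c|.
Proof.
move=> s1 sa sc; have a1 : 1 < a by lra.
have := hconj_le s1 sa; have := hconj_gt1 a1 => h1 h2.
have -> : a / (c - 1) - hconj a = hconj a / (c - 1) * (a - c).
  by rewrite hconjE//; field; lra.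
have c0 : 0 < c - 1 by lra.
have s0 : 0 < s - 1 by lra.
have ca0 : 0 <= hconj a by lra.
rewrite normrM ler_wpM2r// ger0_norm; last exact: divr_ge0 ca0 (ltW c0).
by rewrite ler_pM// ?invr_ge0 ?(ltW c0)// lef_pV2 ?posrE//; lra.
Qed.

Lemma div_subr1_le s M a c : 1 < s -> s <= a <= M -> s <= c ->
  0 <= a / (c - 1) <= M / (s - 1).
Proof.
move=> s1 /andP[sa aM] sc.
have c0 : 0 < c - 1 by lra.
have s0 : 0 < s - 1 by lra.
have a0 : 0 <= a by lra.
rewrite divr_ge0 ?(ltW c0)//= ler_pM ?invr_ge0 ?(ltW c0)// lef_pV2 ?posrE//; lra.
Qed.

(** Carries the bound on Phi^|p - q| over to any two exponents whose distance is at most c |p -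
    q|. *)
Lemma powR_log_le Phi K t u c : 1 <= Phi -> 0 <= c -> `|t| <= c * `|u| ->
  Phi `^ `|u| <= K -> Phi `^ `|t| <= K `^ c.
Proof.
move=> P1 c0 tu PK.
apply: (@le_trans _ _ (Phi `^ (`|u| * c))); first by apply: ler_powR => //; rewrite mulrC.
by rewrite powRrM; apply: powR_le2l => //; exact: powR_ge0.
Qed.

End conjugate_exponents.

(** * Lerner's argument *)

Section lerner.
Local Open Scope ereal_scope.
Context d (T : measurableType d) (R : realType).
Variable mu : {measure set T -> \bar R}.
Implicit Types (D E : set T) (f g h p w Phi : T -> R).

(** For constant p this says that the mass is at most the q-th power of [lam], which dominates the
    norm of w on [B k]. In general (1 / lam)^q is exchanged for (1 / lam)^p, which requires 1 / lam
    <= Phi on [B k]. *)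
Lemma nested_base_powR_le D B w p (q : R) Phi (s M A K lam : R) k :
  (1 < s)%R -> (1 <= A)%R -> (1 <= K)%R ->
  nested_base mu D B (fun x => w x `^ p x)%R p q Phi s M A K ->
  measurable_fun D w -> (forall x, D x -> 0 < w x)%R -> (0 < lam)%R ->
  \int[mu]_(x in B k) ((w x / lam) `^ p x)%:E <= 1 ->
  (fine (\int[mu]_(x in B k) (w x `^ p x)%:E) <= K * (1 + A) * lam `^ q)%R.
Proof.
move=> s1 A1 K1 base mw w0 lam0 hlam.
have BD := @nb_BD _ _ _ _ _ _ _ _ _ _ _ _ _ _ base k.
have mV := nb_mV base; have mPhi := nb_mPhi base.
have VmE := nested_base_fin base k; have Vm0 := nested_base_gt0 base k.
set Vm := fine _ in VmE Vm0 *.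
have /andP[sq qM] := nb_q base.
have mD := nb_mD base; have mB := nb_mB base k; have mp := nb_mp base.
have mlam : measurable_fun D (fun x => lam^-1 `^ p x * w x `^ p x)%R.
  by apply: measurable_funM => //; apply: measurable_fun_powR.
have mPw : measurable_fun D (fun x => (Phi x)^-1 * w x `^ p x)%R.
  apply: measurable_funM => //; apply: measurable_funVr => // x Dx.
  by apply: lt_le_trans (nb_Phi1 base Dx).
have lamE : \int[mu]_(x in B k) (lam^-1 `^ p x * w x `^ p x)%:E <= 1%:E.
  apply: le_trans hlam; rewrite le_eqVlt; apply/orP; left; apply/eqP.
  apply: eq_integral => x /set_mem /BD Dx.
  by rewrite mulrC -powRM ?invr_ge0 ?ltW// w0.
(* For lam < 1 the modular is at least V(B k) / lam, since p >= 1; being at most 1, it gives 1 / lam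
   <= 1 / V(B k) <= Phi. *)
have lamP x : B k x -> (lam^-1 <= Phi x)%R.
  move=> Bx; have [l1|l1] := leP 1%R lam.
    by apply: le_trans (nb_Phi1 base (BD x Bx)); rewrite invf_le1.
  apply: le_trans (nb_Vlow base Bx); rewrite -/Vm.
  have : (lam^-1 * Vm <= 1)%R.
    rewrite -lee_fin EFinM -VmE; apply: le_trans lamE.
    rewrite -ge0_integralZl//; last 3 first.
    - by apply/measurable_EFinP; apply: measurable_funS mV.
    - by move=> y _; rewrite lee_fin powR_ge0.
    - by rewrite lee_fin invr_ge0 ltW.
    apply: ge0_le_integral => //.
    - by move=> y _; rewrite -EFinM lee_fin mulr_ge0 ?powR_ge0// invr_ge0 ltW.
    - by apply: measurable_funeM; apply/measurable_EFinP; apply: measurable_funS mV.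
    - by apply/measurable_EFinP; apply: measurable_funS mlam.
    - move=> y /BD Dy; rewrite -EFinM lee_fin ler_wpM2r ?powR_ge0//.
      have /andP[sp _] := nb_p base Dy.
      by rewrite le1r_powR ?invf_ge1// ?(ltW l1)//; lra.
  by rewrite -ler_pdivlMr// div1r.
have key : \int[mu]_(x in B k) (lam^-1 `^ q * w x `^ p x)%:E <= (K * 1 + K * A)%:E.
  have mS : measurable_fun D (fun x => lam^-1 `^ q * w x `^ p x)%R.
    exact: measurable_funM.
  apply: (@integral_le_lincomb _ _ _ _ _ (fun x => lam^-1 `^ p x * w x `^ p x)%R (fun x => (Phi x)^-1 * w x `^ p x)%R) => //.
  - exact: measurable_funS mlam.
  - exact: measurable_funS mPw.
  - exact: measurable_funS mS.
  - exact: le_trans K1.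
  - exact: le_trans K1.
  - by move=> x _; rewrite mulr_ge0 ?powR_ge0.
  - move=> x /BD Dx; rewrite mulr_ge0 ?powR_ge0// invr_ge0.
    exact: le_trans (nb_Phi1 base Dx).
  - move=> x Bx; rewrite mulr_ge0 ?powR_ge0//= !mulrA -mulrDl ler_wpM2r ?powR_ge0//.
    rewrite -mulrDr.
    have -> : K = (1 `^ M * K)%R by rewrite powR1 mul1r.
    have Dx := BD _ Bx; have /andP[sp pM] := nb_p base Dx.
    apply: powR_switch => //.
    + exact: (nb_Phi1 base).
    + by rewrite mul1r invr_ge0 ltW//= lamP.
    + lra.
    + lra.
    + by rewrite ler_norml; lra.
    + by rewrite distrC; exact: (nb_log base).
  - apply: (nested_base_sub base) => //.
    + move=> x Dx; rewrite mulr_ge0 ?powR_ge0// invr_ge0.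
      exact: le_trans (nb_Phi1 base Dx).
    + exact: (nb_VPhi base).
move: key; under eq_integral do rewrite EFinM.
rewrite ge0_integralZl//; last 3 first.
- by apply/measurable_EFinP; apply: measurable_funS mV.
- by move=> y _; rewrite lee_fin powR_ge0.
- by rewrite lee_fin powR_ge0.
rewrite VmE -EFinM lee_fin mulr1 -{1}(mulr1 K) -mulrDr.
rewrite -powR_inv1 ?(ltW lam0)// -powRrM mulN1r powRN mulrC.
by rewrite ler_pdivrMr ?powR_gt0.
Qed.

(** Conjugation is Lipschitz on [s, oo) with constant (s-1)^(-2), so the same [Phi] serves p' once
    [K] is raised to that power. *)
Lemma nested_base_hconj D B V p (q : R) Phi (s M A K : R) : (1 < s)%R ->
  nested_base mu D B V p q Phi s M A K ->
  nested_base mu D B V (fun x => hconj (p x)) (hconj q) Phi (hconj M) (hconj s) A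
    (K `^ ((s - 1)^-1 * (s - 1)^-1)).
Proof.
move=> s1 [mD mB BD dB mV V0 V_ mp hp hq mPhi Phi1 hlog Vlow VPhi].
have /andP[sq qM] := hq.
split => //.
- apply: measurable_funVr => //.
    apply: measurable_funB => //; apply: measurable_funVr => // x Dx.
    by have /andP[sp _] := hp _ Dx; lra.
  move=> x Dx; have /andP[sp _] := hp _ Dx.
  by rewrite subr_gt0 invf_lt1; lra.
- move=> x Dx; have /andP[sp pM] := hp _ Dx.
  by rewrite !hconj_le//; lra.
- by rewrite !hconj_le//; lra.
- move=> x Dx; have /andP[sp pM] := hp _ Dx.
  apply: powR_log_le (hlog _ Dx); first exact: Phi1.
    by rewrite mulr_ge0// invr_ge0; lra.
  exact: hconj_dist.
Qed.

(** [lam k] and [nu k] stand for the norms of w and 1 / w on [B k] and enter through modulars. Both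
    weights come with the exponent [p]; for w^p it is conjugated later. *)
Record ap_base D (B : nat -> set T) w p (q : R) Phi (s M A K C0 : R)
    (b lam nu : nat -> R) : Prop := {
  ab_w : nested_base mu D B (fun x => w x `^ p x)%R p q Phi s M A K;
  ab_s : nested_base mu D B (fun x => (w x)^-1 `^ hconj (p x))%R p q Phi s M A K;
  ab_mw : measurable_fun D w;
  ab_w0 : forall x, D x -> (0 < w x)%R;
  ab_lam0 : forall k, (0 < lam k)%R;
  ab_nu0 : forall k, (0 < nu k)%R;
  ab_b0 : forall k, (0 < b k)%R;
  ab_mu : forall k, mu (B k) = (b k)%:E;
  ab_lam : forall k, \int[mu]_(x in B k) ((w x / lam k) `^ p x)%:E <= 1;
  ab_nu : forall k, \int[mu]_(x in B k) (((w x)^-1 / nu k) `^ hconj (p x))%:E <= 1;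
  ab_lamnu : forall k, (lam k * nu k <= C0 * b k)%R
}.

(** Muckenhoupt's condition with the constant exponent q, for the masses W of w^p and S of w^(-p').
    From W <= C lam^q and S <= C nu^q' follows W S^(q-1) <= C (lam nu)^q, because q' (q - 1) = q,
    and lam nu <= C0 b. *)
Lemma ap_base_means D B w p (q : R) Phi (s M A K C0 : R) (b lam nu : nat -> R) k :
  (1 < s)%R -> (1 <= A)%R -> (1 <= K)%R -> (1 <= C0)%R ->
  ap_base D B w p q Phi s M A K C0 b lam nu ->
  ((fine (\int[mu]_(x in B k) ((w x)^-1 `^ hconj (p x))%:E) / b k) `^ (q - 1) <=
   K * (1 + A) * (K `^ ((s - 1)^-1 * (s - 1)^-1) * (1 + A)) `^ (M - 1) * C0 `^ M *
   (b k / fine (\int[mu]_(x in B k) (w x `^ p x)%:E)))%R.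
Proof.
move=> s1 A1 K1 C01 ab.
set Wk := fine (\int[mu]_(x in B k) (w x `^ p x)%:E).
set Sk := fine (\int[mu]_(x in B k) ((w x)^-1 `^ hconj (p x))%:E).
set C1 := (K * (1 + A))%R.
set C2 := (K `^ ((s - 1)^-1 * (s - 1)^-1) * (1 + A))%R.
have bw := ab_w ab; have bs := ab_s ab.
have /andP[sq qM] := nb_q bw.
have W0 : (0 < Wk)%R := nested_base_gt0 bw k.
have S0 : (0 < Sk)%R := nested_base_gt0 bs k.
have b0 := ab_b0 ab k; have l0 := ab_lam0 ab k; have n0 := ab_nu0 ab k.
have w0 := ab_w0 ab; have mw := ab_mw ab.
have K21 : (1 <= K `^ ((s - 1)^-1 * (s - 1)^-1))%R.
  by apply: powR_ge1 => //; rewrite mulr_ge0// invr_ge0; lra.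
have C11 : (1 <= C1)%R by rewrite mulr_ege1//; lra.
have C21 : (1 <= C2)%R by rewrite mulr_ege1//; lra.
have q1 : (1 < q)%R by lra.
have q10 : (0 <= q - 1)%R by lra.
have q0 : (0 < q)%R by lra.
have C10 : (0 <= C1)%R := le_trans ler01 C11.
have C20 : (0 <= C2)%R := le_trans ler01 C21.
have C00 : (0 <= C0)%R := le_trans ler01 C01.
have hW : (Wk <= C1 * lam k `^ q)%R.
  by apply: (nested_base_powR_le s1 A1 K1 bw) => //; exact: (ab_lam ab).
have hS : (Sk <= C2 * nu k `^ hconj q)%R.
  apply: (nested_base_powR_le (hconj_gt1 _) A1 K21 (nested_base_hconj s1 bs)) => //.
  - lra.
  - by apply: measurable_funVr => //; exact: (nb_mD bw).
  - by move=> x Dx; rewrite invr_gt0 w0.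
  - exact: (ab_nu ab).
clearbody Wk Sk C1 C2.
have h1 : (Wk * Sk `^ (q - 1) <= C1 * C2 `^ (M - 1) * (lam k * nu k) `^ q)%R.
  apply: (@le_trans _ _ ((C1 * lam k `^ q) * (C2 * nu k `^ hconj q) `^ (q - 1)))%R.
    by apply: ler_pM (ltW W0) (powR_ge0 _ _) hW (powR_le2l q10 (ltW S0) hS).
  rewrite powRM ?powR_ge0// -powRrM hconj_mulB1// powRM ?(ltW l0) ?(ltW n0)//.
  rewrite (_ : C1 * lam k `^ q * (C2 `^ (q - 1) * nu k `^ q) =
    C1 * C2 `^ (q - 1) * (lam k `^ q * nu k `^ q))%R; last by ring.
  rewrite ler_wpM2r ?mulr_ge0 ?powR_ge0// ler_wpM2l//.
  by rewrite ler_powR// lerD2r.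
have h2 : ((lam k * nu k) `^ q <= C0 `^ M * b k `^ q)%R.
  apply: (@le_trans _ _ ((C0 * b k) `^ q)%R).
    exact: powR_le2l (ltW q0) (mulr_ge0 (ltW l0) (ltW n0)) (ab_lamnu ab k).
  rewrite powRM ?(ltW b0)//.
  by rewrite ler_wpM2r ?powR_ge0// ler_powR.
have h3 : (Wk * Sk `^ (q - 1) <= C1 * C2 `^ (M - 1) * C0 `^ M * b k `^ q)%R.
  by apply: (le_trans h1); rewrite -[leRHS]mulrA ler_wpM2l// mulr_ge0 ?powR_ge0.
rewrite powRM ?(ltW S0) ?invr_ge0 ?(ltW b0)//.
rewrite -powR_inv1 ?(ltW b0)// -powRrM mulN1r powRN ler_pdivrMr ?powR_gt0//.
set Z := (C1 * _ * _)%R in h3 *.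
have -> : (Z * (b k / Wk) * b k `^ (q - 1) = Z * b k `^ q / Wk)%R.
  by rewrite -[in RHS](@mulr_powRB1 _ (b k) q) ?(ltW b0)//; ring.
by rewrite ler_pdivlMr// mulrC.
Qed.

(* Bounds for the maximal operator of the weight [S] (giving [A1]) and then of
   [W] with the conjugate exponent (giving [A3]), linked by the [A_p] constant
   [C3] and two exponent changes [L1], [L2]. *)
Definition ap_const (s M A K C0 : R) : R :=
  let K2 := (K `^ ((s - 1)^-1 * (s - 1)^-1))%R in
  let s2 := hconj M in let M2 := hconj s in
  let maxconst s M A K :=
    ((1 + A) `^ M * K * 2 `^ s *
      ((2 * (s / (s - 1))) `^ s *
        (2 `^ s * ((1 + A) `^ M * K * 2 `^ M) `^ s * A + 2 `^ s * A)) +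
     (1 + A) `^ M * K * A)%R in
  let A1 := maxconst s M A K in
  let L1 := ((1 + A) `^ (M2 * M) * K `^ M2)%R in
  let A2 := (L1 * A1 + L1 * A + A)%R in
  let A3 := maxconst s2 M2 A2 K2 in
  let C3 := (K * (1 + A) * (K2 * (1 + A)) `^ (M - 1) * C0 `^ M)%R in
  let N := (M / (s - 1))%R in
  let L2 := (C3 `^ N * ((1 + A2) `^ (M2 / (s - 1) * M) * K `^ (M2 / (s - 1))))%R in
  (L2 * A3 + L2 * A2)%R.

(* Lerner's argument: on [B k] the mean of [f = g S] is controlled through
   the [A_q] condition by the [W]-mean of [(M_S g) `^ (q - 1) / W]. *)
Lemma ap_maximal D B w p (q : R) Phi (s M A K C0 : R) (b lam nu : nat -> R) f n :
  (1 < s)%R -> (1 <= A)%R -> (1 <= K)%R -> (1 <= C0)%R ->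
  ap_base D B w p q Phi s M A K C0 b lam nu ->
  measurable_fun D f -> (forall x, D x -> 0 <= f x)%R ->
  \int[mu]_(x in D) ((f x * w x) `^ p x)%:E <= 1 ->
  \int[mu]_(x in D) ((stepmax B (fun k =>
     fine (\int[mu]_(x in B k) (f x)%:E) / b k) n x)%R `^ p x * w x `^ p x)%:E
  <= (ap_const s M A K C0)%:E.
Proof.
move=> s1 A1 K1 C01 ab mf f0 f1.
rewrite /ap_const.
set K2 := (K `^ _)%R; set A' := (_ + (1 + A) `^ M * K * A)%R.
set L1 := ((1 + A) `^ _ * K `^ _)%R; set A2 := (L1 * A' + L1 * A + A)%R.
set A3 := (_ + (1 + A2) `^ hconj s * K2 * A2)%R.
set C3 := (_ * C0 `^ M)%R; set N := (M / (s - 1))%R; set L2 := (C3 `^ N * _)%R.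
have bw := ab_w ab; have bs := ab_s ab.
have mD := nb_mD bw; have mB := nb_mB bw; have BD := nb_BD bw.
have /andP[sq qM] := nb_q bw.
have w0 := ab_w0 ab; have mw := ab_mw ab; have mp := nb_mp bw.
have mPhi := nb_mPhi bw; have Phi1 := nb_Phi1 bw.
have M1 : (1 < M)%R by lra.
have cs1 : (1 < hconj s)%R by exact: hconj_gt1.
have cM1 : (1 < hconj M)%R by exact: hconj_gt1.
have K21 : (1 <= K2)%R.
  by apply: powR_ge1 => //; rewrite mulr_ge0// invr_ge0; lra.
have Pi0 x : D x -> (0 <= (Phi x)^-1)%R.
  by move=> Dx; rewrite invr_ge0; exact: le_trans (Phi1 _ Dx).
have E1 : (1 <= 1 + A)%R by lra.
have L11 : (1 <= L1)%R.
  by apply: mulr_ege1; apply: powR_ge1 => //; [rewrite mulr_ge0|]; lra.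
have mW := nb_mV bw; have mS := nb_mV bs.
pose S x := ((w x)^-1 `^ hconj (p x))%R.
pose W x := (w x `^ p x)%R.
have S0 x : D x -> (0 < S x)%R by move=> Dx; rewrite powR_gt0// invr_gt0 w0.
have W0 x : D x -> (0 < W x)%R by move=> Dx; rewrite powR_gt0// w0.
have p1 x : D x -> (1 < p x)%R by move=> /(nb_p bw)/andP[sp _]; lra.
(* The weights are dual: W^(1-p') = S and S^(1-p) = W. This converts modulars for one weight into
   modulars for the other. *)
have WS x : D x -> (W x * (W x)^-1 `^ hconj (p x) = S x)%R.
  move=> Dx; have wx := w0 _ Dx; rewrite /W /S.
  have px := p1 _ Dx.
  rewrite -!powR_inv1 ?powR_ge0 ?(ltW wx)// -!powRrM -powR_D//; congr powR.
  have h := hconj_mulB1 px; lra.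
have SW x : D x -> (S x * (S x)^-1 `^ p x = W x)%R.
  move=> Dx; have wx := w0 _ Dx; rewrite /W /S.
  have px := p1 _ Dx.
  rewrite -!powR_inv1 ?powR_ge0 ?(ltW wx)// -!powRrM -powR_D//; congr powR.
  have h := hconj_mulB1 px; lra.
pose g x := (f x / S x)%R.
have mg : measurable_fun D g.
  by apply: measurable_funM => //; apply: measurable_funVr.
have g0 x : D x -> (0 <= g x)%R.
  by move=> Dx; rewrite divr_ge0 ?f0// ltW// S0.
have gA : \int[mu]_(x in D) (g x `^ p x * S x)%:E <= A%:E.
  apply: (@le_trans _ _ 1); last by rewrite lee_fin.
  apply: le_trans f1; rewrite le_eqVlt; apply/orP; left; apply/eqP.
  apply: eq_integral => x /set_mem Dx; congr EFin.
  rewrite /g !powRM ?invr_ge0 ?f0 ?(ltW (S0 _ Dx)) ?(ltW (w0 _ Dx))//.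
  by rewrite -mulrA [X in (_ * X)%R]mulrC SW.
have [mle mA] := variable_maximal s1 A1 K1 bs n mg g0 gA.
rewrite -/S -/A' in mle mA.
set m := stepmax _ _ _ in mle mA.
have hk k := ap_base_means k s1 A1 K1 C01 ab.
rewrite -/K2 -/C3 in hk.
have C31 : (1 <= C3)%R.
  apply: mulr_ege1; last by apply: powR_ge1 => //; lra.
  apply: mulr_ege1; first by apply: mulr_ege1; lra.
  by apply: powR_ge1; [apply: mulr_ege1; lra|lra].
have C30 : (0 <= C3)%R := le_trans ler01 C31.
clearbody A' C3.
have q1 : (1 < q)%R by lra.
have q10 : (0 < q - 1)%R by rewrite subr_gt0.
have s10 : (0 < s - 1)%R by rewrite subr_gt0.
have A0 : (0 <= A)%R := le_trans ler01 A1.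
have cs0 : (0 <= hconj s)%R by lra.
have L10 : (0 <= L1)%R := le_trans ler01 L11.
have mm : measurable_fun D m by exact: measurable_stepmax.
have A'0 : (0 <= A')%R.
  rewrite -lee_fin; apply: le_trans mA; apply: integral_ge0 => x Dx.
  by rewrite lee_fin mulr_ge0 ?powR_ge0.
have A21 : (1 <= A2)%R.
  by apply: ler_wpDl A1; rewrite addr_ge0// mulr_ge0.
have AA2 : (A <= A2)%R by rewrite ler_wpDl// addr_ge0// mulr_ge0.
(* The W-integral of [g'] over [B k] is the plain integral of m^(q-1), hence at least b times the
   power q - 1 of the S-mean of [g]. The modular of [g'] for W and p' is that of [m] for S, with (q
   - 1) p' in place of p. *)
pose g' x := (m x `^ (q - 1) / W x)%R.
have mg' : measurable_fun D g'.
  by apply: measurable_funM; [apply: measurable_fun_powR|apply: measurable_funVr].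
have g'0 x : D x -> (0 <= g' x)%R.
  by move=> Dx; rewrite divr_ge0 ?powR_ge0.
have mSp : measurable_fun D (fun x => m x `^ p x * S x)%R.
  by apply: measurable_funM => //; apply: measurable_fun_powR.
have mPS : measurable_fun D (fun x => (Phi x)^-1 * S x)%R.
  apply: measurable_funM => //; apply: measurable_funVr => // x Dx.
  exact: lt_le_trans (Phi1 _ Dx).
have mPW : measurable_fun D (fun x => (Phi x)^-1 * W x)%R.
  apply: measurable_funM => //; apply: measurable_funVr => // x Dx.
  exact: lt_le_trans (Phi1 _ Dx).
have bwc := nested_base_hconj s1 bw.
have mc := nb_mp bwc.
have cb x : D x -> (hconj M <= hconj (p x) <= hconj s)%R by exact: (nb_p bwc).
have dpq x : D x -> (`|p x - q| <= M)%R.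
  by move=> /(nb_p bw)/andP[sp pM]; rewrite ler_norml; lra.
have g'A : \int[mu]_(x in D) (g' x `^ hconj (p x) * W x)%:E <= A2%:E.
  apply: (@le_trans _ _ (L1 * A' + L1 * A)%:E); last first.
    by rewrite lee_fin lerDl.
  apply: (@integral_le_lincomb _ _ _ _ _ (fun x => m x `^ p x * S x)%R (fun x => (Phi x)^-1 * S x)%R) => //.
  - by apply: measurable_funM => //; apply: measurable_fun_powR.
  - by move=> x Dx; rewrite mulr_ge0 ?powR_ge0.
  - by move=> x Dx; rewrite mulr_ge0 ?powR_ge0 ?Pi0.
  - move=> x Dx; rewrite mulr_ge0 ?powR_ge0//= !mulrA -mulrDl -mulrDr.
    rewrite /g' powRM ?powR_ge0 ?invr_ge0 ?(ltW (W0 _ Dx))//.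
    rewrite -mulrA [X in (_ * X <= _)%R]mulrC WS//.
    rewrite ler_wpM2r ?(ltW (S0 _ Dx))// -powRrM.
    have /andP[sp pM] := nb_p bw Dx; have /andP[cl cu] := cb _ Dx.
    have e := hconj_switch s1 sp sq.
    apply: powR_switch (Phi1 _ Dx) (mle _ Dx) (ltW (p1 _ Dx)) _ _ _ => //.
    + by rewrite mulr_ge0 ?(ltW q10)//; apply: le_trans cl; exact: ltW (lt_trans ltr01 cM1).
    + by apply: (le_trans e); rewrite ler_wpM2l ?dpq.
    + exact: powR_log_le (Phi1 _ Dx) cs0 e (nb_log bw Dx).
  - exact: (nb_VPhi bs).
(* The modular of [g'] is only known to be at most [A2], so the base is restated with this larger
   constant. *)
have bw2 : nested_base mu D B W (fun x => hconj (p x)) (hconj q) Phi (hconj M) (hconj s) A2 K2.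
  case: bwc => *; split => //.
  by apply: le_trans (nb_VPhi bw) _; rewrite lee_fin.
have [m'le m'A] := variable_maximal cM1 A21 K21 bw2 n mg' g'0 g'A.
rewrite -/A3 in m'A.
set m' := stepmax _ _ _ in m'le m'A.
have m'0 x : (0 <= m' x)%R by exact: cmax_ge0.
have E2 : (1 <= 1 + A2)%R by rewrite lerDl (le_trans ler01).
clearbody A3.
set a := fun k => (fine (\int[mu]_(x in B k) (f x)%:E) / b k)%R.
have fI k : \int[mu]_(x in B k) (f x)%:E =
    (wmean mu S g (B k) * fine (\int[mu]_(x in B k) (S x)%:E))%:E.
  have [<- _] := wmean_le s1 A1 bs k mg g0 gA.
  by apply: eq_integral => x /set_mem /BD Dx; rewrite /g divfK// gt_eqF// S0.
have ak k x : (k < n)%N -> B k x -> (0 <= a k /\ a k `^ (q - 1) <= C3 * m' x)%R.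
  move=> kn Bx.
  have [_ /(_ _ Bx)/andP[mk0 _]] := wmean_le s1 A1 bs k mg g0 gA.
  have b0 := ab_b0 ab k.
  move: (hk k) => {}hk.
  have Sk0 := nested_base_gt0 bs k; rewrite -/S in Sk0 hk.
  have Wk0 := nested_base_gt0 bw k; rewrite -/W in Wk0 hk.
  have Wk := nested_base_fin bw k; rewrite -/W in Wk.
  rewrite /a fI/=; set Sk := fine _ in Sk0 hk *; set Wm := fine _ in Wk Wk0 hk.
  set mk := wmean mu S g (B k) in mk0 *.
  split; first exact: divr_ge0 (mulr_ge0 mk0 (ltW Sk0)) (ltW b0).
  have [g'E _] := wmean_le cM1 A21 bw2 k mg' g'0 g'A.
  rewrite -/W -/Wm in g'E; set mk' := wmean _ _ _ _ in g'E.
  have mk'm : (mk' <= m' x)%R.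
    by apply: (@stepmax_ub _ _ _ B (fun k => wmean mu W g' (B k))).
  have hm : (mk `^ (q - 1) * b k <= mk' * Wm)%R.
    rewrite -lee_fin -g'E EFinM -(ab_mu ab k) -integral_cst//.
    apply: ge0_le_integral => //.
    - by move=> y _; rewrite lee_fin powR_ge0.
    - apply/measurable_EFinP; apply: measurable_funS (BD k) _ => //.
      exact: measurable_funM.
    - move=> y By; rewrite lee_fin /g' divfK ?gt_eqF ?W0//; last exact: BD By.
      apply: powR_le2l (ltW q10) mk0 _.
      exact: (@stepmax_ub _ _ _ B (fun k => wmean mu S g (B k))).
  (* The plain mean [a k] is [mk] times S / b. [hk] trades (S / b)^(q-1) for C3 b / W, and [hm]
     bounds the remaining mk^(q-1) b / W by the W-mean of [g']. *)
  rewrite -mulrA (powRM _ mk0 (divr_ge0 (ltW Sk0) (ltW b0))).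
  apply: (le_trans (ler_wpM2l (powR_ge0 _ _) hk)).
  rewrite mulrCA; apply: (ler_wpM2l C30).
  by rewrite mulrA ler_pdivrMr//; apply: (le_trans hm); exact: ler_wpM2r (ltW Wk0) _ _ mk'm.
pose Na := stepmax B a n.
have Na0 x : (0 <= Na x)%R by exact: cmax_ge0.
have Nq x : (Na x `^ (q - 1) <= C3 * m' x)%R.
  have [e|[k [kn Bx e]]] := stepmax_cases B a n x; rewrite /Na e.
    by rewrite powR0 ?gt_eqF//; exact: mulr_ge0 C30 (m'0 x).
  exact: (ak k x kn Bx).2.
have mN : measurable_fun D Na by exact: measurable_stepmax.
have mm' : measurable_fun D m' by exact: measurable_stepmax.
have L20 : (0 <= L2)%R by rewrite mulr_ge0 ?powR_ge0// mulr_ge0 ?powR_ge0.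
apply: (@integral_le_lincomb _ _ _ _ _ (fun x => m' x `^ hconj (p x) * W x)%R (fun x => (Phi x)^-1 * W x)%R) => //.
- by apply: measurable_funM => //; apply: measurable_fun_powR.
- by apply: measurable_funM => //; apply: measurable_fun_powR.
- by move=> x Dx; rewrite mulr_ge0 ?powR_ge0.
- by move=> x Dx; rewrite mulr_ge0 ?powR_ge0 ?Pi0.
- move=> x Dx; rewrite mulr_ge0 ?powR_ge0//= !mulrA -mulrDl -mulrDr.
  rewrite -/W ler_wpM2r ?(ltW (W0 _ Dx))//.
  have /andP[sp pM] := nb_p bw Dx; have /andP[cl cu] := cb _ Dx.
  (* p is written as (q - 1) e with e close to p': the bound [Nq] is raised to the power e, then e
     is exchanged for p'. *)
  have := div_hconj_switch s1 sp sq.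
  have /andP[] : (0 <= p x / (q - 1) <= N)%R by apply: div_subr1_le s1 _ sq; rewrite sp.
  have : (p x = (q - 1) * (p x / (q - 1)))%R by rewrite mulrCA divff ?mulr1// gt_eqF.
  set e := (p x / (q - 1))%R => pE e0 eN ee.
  have -> : (stepmax B a n x `^ p x = (Na x `^ (q - 1)) `^ e)%R.
    by rewrite -powRrM -pE.
  apply: (le_trans (powR_le2l e0 (powR_ge0 _ _) (Nq x))).
  rewrite powRM//.
  rewrite /L2 -[leRHS]mulrA.
  apply: (ler_pM (powR_ge0 _ _) (powR_ge0 _ _) (ler_powR C31 eN)).
  have cs'0 : (0 <= hconj s / (s - 1))%R := divr_ge0 cs0 (ltW s10).
  apply: powR_switch (Phi1 _ Dx) (m'le _ Dx) _ e0 _ _ => //.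
  + exact: le_trans (ltW cM1) cl.
  + by apply: (le_trans ee); rewrite ler_wpM2l ?dpq.
  + exact: powR_log_le (Phi1 _ Dx) cs'0 ee (nb_log bw Dx).
- exact: (nb_VPhi bw2).
Qed.

End lerner.

(** * Modulars and lower bounds for masses *)

Section modulars.
Local Open Scope ereal_scope.
Context d (T : measurableType d) (R : realType).
Variable mu : {measure set T -> \bar R}.
Implicit Types (E D : set T) (w r f g : T -> R).

Lemma ge0_integral_gt0 E f : measurable E -> measurable_fun E f ->
  (forall x, E x -> 0 < f x)%R -> 0 < mu E -> 0 < \int[mu]_(x in E) (f x)%:E.
Proof.
move=> mE mf f0 muE.
have ge : 0 <= \int[mu]_(x in E) (f x)%:E.
  by apply: integral_ge0 => x Ex; rewrite lee_fin ltW// f0.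
rewrite lt_def ge andbT; apply/eqP => /eqP h.
have : \int[mu]_(x in E) `|(f x)%:E| = 0.
  rewrite -(eqP h); apply: eq_integral => x /set_mem Ex.
  by rewrite gee0_abs// lee_fin ltW// f0.
have mf' : measurable_fun E (EFin \o f) by exact/measurable_EFinP.
move=> /(ae_eq_integral_abs mu mE mf')[N [mN N0 sub]].
have : mu E <= mu N.
  apply: le_measure; rewrite ?inE// => x Ex; apply: sub => /= /(_ Ex) [] /eqP.
  by rewrite gt_eqF// f0.
by rewrite N0 leNgt muE.
Qed.

Lemma integral_powR_scale E w r (lam c : R) : measurable E ->
  measurable_fun E w -> measurable_fun E r -> (forall x, E x -> 0 < w x)%R ->
  (0 < lam)%R -> (forall x, E x -> lam `^ r x <= c)%R -> (0 <= c)%R ->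
  \int[mu]_(x in E) ((w x / lam) `^ r x)%:E <= 1 ->
  \int[mu]_(x in E) (w x `^ r x)%:E <= c%:E.
Proof.
move=> mE mw mr w0 l0 lc c0 h.
have -> : c%:E = (c * 1 + 0 * 1)%:E by rewrite mulr1 mul0r addr0.
have mwl : measurable_fun E (fun x => (w x / lam) `^ r x)%R.
  by apply: measurable_fun_powR => //; exact: measurable_funM.
apply: (@integral_le_lincomb _ _ _ _ _ (fun x => (w x / lam) `^ r x)%R (fun x => (w x / lam) `^ r x)%R) => //.
- exact: measurable_fun_powR.
- by move=> x _; exact: powR_ge0.
- by move=> x _; exact: powR_ge0.
- move=> x Ex; rewrite powR_ge0/= mul0r addr0.
  have wx := w0 _ Ex.
  have {1}-> : (w x = lam * (w x / lam))%R by rewrite mulrCA divff ?mulr1// gt_eqF.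
  rewrite powRM ?ler_wpM2r ?powR_ge0 ?lc ?divr_ge0//; exact: ltW.
Qed.

(** A substitute for Hoelder's inequality between w and 1 / w: pointwise, the first term is at least
    1 where w >= e and the second where w < e. *)
Lemma measure_le_modulars E w r r' (N b W S e : R) : measurable E ->
  measurable_fun E w -> measurable_fun E r -> measurable_fun E r' ->
  (forall x, E x -> 0 < w x)%R ->
  (forall x, E x -> 1 <= r x <= N)%R -> (forall x, E x -> 1 <= r' x)%R ->
  mu E = b%:E -> (0 < e <= 1)%R ->
  \int[mu]_(x in E) (w x `^ r x)%:E <= W%:E ->
  \int[mu]_(x in E) ((w x)^-1 `^ r' x)%:E <= S%:E ->
  (b <= e^-1 `^ N * W + e * S)%R.
Proof.
move=> mE mw mr mr' w0 rN r'1 muE /andP[e0 e1] hW hS.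
rewrite -lee_fin -muE -[leLHS]mul1e -integral_cst//.
apply: (@integral_le_lincomb _ _ _ _ _ (fun x => w x `^ r x)%R (fun x => (w x)^-1 `^ r' x)%R (fun=> 1%R)) => //.
- exact: measurable_fun_powR.
- by apply: measurable_fun_powR => //; exact: measurable_funVr.
- exact: powR_ge0.
- exact: ltW.
- by move=> x _; exact: powR_ge0.
- by move=> x _; exact: powR_ge0.
- move=> x Ex; rewrite ler01/=.
  have wx := w0 _ Ex; have /andP[r1 rxN] := rN _ Ex; have r'x := r'1 _ Ex.
  have [ew|we] := leP e (w x).
    apply: ler_wpDr; first by rewrite mulr_ge0 ?powR_ge0 ?(ltW e0).
    apply: (@le_trans _ _ (e^-1 `^ r x * w x `^ r x)%R).
      rewrite -powRM ?invr_ge0 ?(ltW e0) ?(ltW wx)//.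
      apply: powR_ge1; last exact: le_trans r1.
      by rewrite mulrC ler_pdivlMr ?mul1r.
    by rewrite ler_wpM2r ?powR_ge0// ler_powR// invf_ge1.
  apply: ler_wpDl; first by rewrite mulr_ge0 ?powR_ge0.
  apply: (@le_trans _ _ (e `^ r' x * (w x)^-1 `^ r' x)%R).
    rewrite -powRM ?invr_ge0 ?(ltW e0) ?(ltW wx)//.
    apply: powR_ge1; last exact: le_trans r'x.
    by rewrite ler_pdivlMr ?mul1r// ltW.
  by rewrite ler_wpM2r ?powR_ge0// ge1r_powR// e0.
Qed.

(** With e = b / (2 S) the second term of [measure_le_modulars] equals b / 2 and is absorbed; the
    assumption b <= 2 S says that e <= 1. *)
Lemma modular_lower E w r r' (N b W S : R) : measurable E ->
  measurable_fun E w -> measurable_fun E r -> measurable_fun E r' ->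
  (forall x, E x -> 0 < w x)%R ->
  (forall x, E x -> 1 <= r x <= N)%R -> (forall x, E x -> 1 <= r' x)%R ->
  mu E = b%:E -> (0 < b <= 2 * S)%R -> (0 < W)%R ->
  \int[mu]_(x in E) (w x `^ r x)%:E <= W%:E ->
  \int[mu]_(x in E) ((w x)^-1 `^ r' x)%:E <= S%:E ->
  (W^-1 <= 2 * (2 * S) `^ N * (b^-1 * b^-1 `^ N))%R.
Proof.
move=> mE mw mr mr' w0 rN r'1 muE /andP[b0 bS] W0 hW hS.
have S0 : (0 < 2 * S)%R by exact: lt_le_trans bS.
have e01 : (0 < b / (2 * S) <= 1)%R by rewrite divr_gt0//= ler_pdivrMr// mul1r.
have := measure_le_modulars mE mw mr mr' w0 rN r'1 muE e01 hW hS.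
rewrite invf_div (@powRM _ (2 * S) b^-1)%R ?invr_ge0 ?(ltW S0) ?(ltW b0)//.
have -> : (b / (2 * S) * S = b / 2)%R.
  by field; rewrite gt_eqF//; move: S0; rewrite pmulr_rgt0.
set X := ((2 * S) `^ N * b^-1 `^ N)%R => h.
have h2 : (b / 2 <= X * W)%R by lra.
have -> : (2 * (2 * S) `^ N * (b^-1 * b^-1 `^ N) = X / (b / 2))%R.
  by rewrite /X; field; rewrite gt_eqF.
by rewrite ler_pdivlMr ?divr_gt0// mulrC ler_pdivrMr.
Qed.

End modulars.

Lemma dist_le (R : realDomainType) (a c s M : R) :
  0 <= s -> s <= a <= M -> s <= c <= M -> `|a - c| <= M.
Proof. by move=> s0 /andP[? ?] /andP[? ?]; rewrite ler_norml; lra. Qed.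

(** * Intervals near the origin *)

Section half_line.
Local Open Scope ereal_scope.
Context d (T : measurableType d) (R : realType).
Variable mu : {measure set T -> \bar R}.
Variable X : T -> R.
Hypothesis mX : measurable_fun setT X.

(** The interval (0, b), pulled back by a coordinate on an abstract measure space. The analysis is
    thus independent of the two measurable structures, Borel and Lebesgue, that the real line
    carries. *)
Definition below (b : R) : set T := [set t | (0 < X t < b)%R].
Definition positive : set T := [set t | (0 < X t)%R].

Hypothesis mu_below : forall b : R, (0 < b)%R -> mu (below b) = b%:E.
Implicit Types (f V : T -> R) (b : R).

Lemma measurable_below b : measurable (below b).
Proof.
rewrite (_ : below b = setT `&` X @^-1` `]0%R, b[%classic); first exact: mX.
by rewrite setTI; apply/seteqP; split => t /=; rewrite in_itv.
Qed.

Lemma measurable_positive : measurable positive.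
Proof.
rewrite (_ : positive = setT `&` X @^-1` `]0%R, +oo[%classic); first exact: mX.
by rewrite setTI; apply/seteqP; split => t /=; rewrite in_itv/= andbT.
Qed.

Let mD := measurable_below.
Let mDy := measurable_positive.

Lemma below_positive b : below b `<=` positive.
Proof. by move=> t /= /andP[]. Qed.

Lemma below_mono b c : (b <= c)%R -> below b `<=` below c.
Proof. by move=> bc t /= /andP[t0 tb]; apply/andP; split => //; exact: lt_le_trans bc. Qed.

Record ap_weight (p w : T -> R) (s M C0 : R) (lam nu : R -> R) : Prop := {
  aw_s : (1 < s)%R;
  aw_sM : (s <= M)%R;
  aw_C0 : (1 <= C0)%R;
  aw_mp : measurable_fun positive p;
  aw_mw : measurable_fun positive w;
  aw_p : forall x, positive x -> (s <= p x <= M)%R;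
  aw_w : forall x, positive x -> (0 < w x)%R;
  aw_lam0 : forall b, (0 < b)%R -> (0 < lam b)%R;
  aw_nu0 : forall b, (0 < b)%R -> (0 < nu b)%R;
  aw_lam : forall b, (0 < b)%R -> \int[mu]_(x in below b) ((w x / lam b) `^ p x)%:E <= 1;
  aw_nu : forall b, (0 < b)%R -> \int[mu]_(x in below b) (((w x)^-1 / nu b) `^ hconj (p x))%:E <= 1;
  aw_lamnu : forall b, (0 < b)%R -> (lam b * nu b <= C0 * b)%R
}.

(** Duality: exchanging p with p', w with 1 / w and [lam] with [nu] turns each estimate for w^p into
    one for w^(-p'). *)
Lemma ap_weight_hconj p w s M C0 lam nu : ap_weight p w s M C0 lam nu ->
  ap_weight (fun x => hconj (p x)) (fun x => (w x)^-1)%R (hconj M) (hconj s) C0 nu lam.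
Proof.
case=> s1 sM C01 mp mw hp w0 l0 n0 hl hn ln; split.
- by apply: hconj_gt1; lra.
- by apply: hconj_le.
- exact: C01.
- apply: measurable_funVr mDy _ _.
    apply: measurable_funB => //; apply: measurable_funVr mDy mp _ => x /hp/andP[sp _].
    lra.
  move=> x /hp/andP[sp _].
  by rewrite subr_gt0 invf_lt1; lra.
- exact: measurable_funVr mDy mw w0.
- by move=> x /hp/andP[sp pM]; rewrite !hconj_le//; lra.
- by move=> x x0; rewrite invr_gt0 w0.
- exact: n0.
- exact: l0.
- exact: hn.
- move=> b b0; apply: le_trans (hl b b0); rewrite le_eqVlt; apply/orP; left; apply/eqP.
  apply: eq_integral => x /set_mem /below_positive /hp/andP[sp _].
  by rewrite invrK hconjK//; lra.
- by move=> b b0; rewrite mulrC ln.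
Qed.

Section weight.
Variables (p w : T -> R) (s M C0 : R) (lam nu : R -> R).
Hypothesis aw : ap_weight p w s M C0 lam nu.

Lemma ap_weight_measurable : measurable_fun positive (fun x => w x `^ p x)%R.
Proof. exact: measurable_fun_powR mDy (aw_mw aw) (aw_mp aw). Qed.
Let mwp := ap_weight_measurable.

Let sub_mfun b f : measurable_fun positive f -> measurable_fun (below b) f.
Proof. by move=> mf; exact: measurable_funS mDy (@below_positive b) mf. Qed.

Lemma ap_weight_int_le b : (0 < b)%R ->
  \int[mu]_(x in below b) (w x `^ p x)%:E <= (Num.max 1 (lam b) `^ M)%:E.
Proof.
move=> b0; apply: (@integral_powR_scale _ _ _ _ _ _ _ (lam b)).
- exact: mD.
- exact: sub_mfun (aw_mw aw).
- exact: sub_mfun (aw_mp aw).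
- by move=> x /below_positive; exact: (aw_w aw).
- exact: (aw_lam0 aw).
- move=> x /below_positive x0; have /andP[sp pM] := aw_p aw x0.
  have p0 : (0 <= p x)%R by apply: le_trans sp; exact: ltW (lt_trans ltr01 (aw_s aw)).
  apply: (@le_trans _ _ (Num.max 1 (lam b) `^ p x)%R).
    apply: powR_le2l p0 (ltW (aw_lam0 aw b0)) _.
    by rewrite le_max lexx orbT.
  by apply: ler_powR => //; rewrite le_max lexx.
- exact: powR_ge0.
- exact: (aw_lam aw).
Qed.

Lemma ap_weight_int_le1 b : (0 < b)%R -> (lam b <= 1)%R ->
  \int[mu]_(x in below b) (w x `^ p x)%:E <= (lam b)%:E.
Proof.
move=> b0 l1; have l0 := aw_lam0 aw b0.
apply: (@integral_powR_scale _ _ _ _ _ _ _ (lam b)).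
- exact: mD.
- exact: sub_mfun (aw_mw aw).
- exact: sub_mfun (aw_mp aw).
- by move=> x /below_positive; exact: (aw_w aw).
- exact: l0.
- move=> x /below_positive x0; have /andP[sp pM] := aw_p aw x0; have s1 := aw_s aw.
  by rewrite ge1r_powR ?l0//; lra.
- exact: ltW.
- exact: (aw_lam aw).
Qed.

Lemma ap_weight_int_gt0 b : (0 < b)%R -> 0 < \int[mu]_(x in below b) (w x `^ p x)%:E.
Proof.
move=> b0; apply: (ge0_integral_gt0 (@mD b) (sub_mfun mwp)).
- by move=> x /below_positive x0; rewrite powR_gt0// (aw_w aw x0).
- by rewrite mu_below// lte_fin.
Qed.

Lemma ap_weight_int_lty b : (0 < b)%R -> \int[mu]_(x in below b) (w x `^ p x)%:E < +oo.
Proof. by move=> b0; apply: le_lt_trans (ap_weight_int_le b0) _; exact: ltry. Qed.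

Lemma ap_weight_int_mono b c : (b <= c)%R ->
  \int[mu]_(x in below b) (w x `^ p x)%:E <= \int[mu]_(x in below c) (w x `^ p x)%:E.
Proof.
move=> bc; apply: ge0_subset_integral; [exact: mD|exact: mD| | |exact: below_mono].
- by apply/measurable_EFinP; exact: sub_mfun.
- by move=> x _; rewrite lee_fin powR_ge0.
Qed.

Definition aw_mass b := fine (\int[mu]_(x in below b) (w x `^ p x)%:E).

Lemma aw_massE b : (0 < b)%R ->
  \int[mu]_(x in below b) (w x `^ p x)%:E = (aw_mass b)%:E.
Proof.
move=> b0; rewrite /aw_mass fineK// ge0_fin_numE; first exact: ap_weight_int_lty.
exact: ltW (ap_weight_int_gt0 b0).
Qed.

Lemma aw_mass_gt0 b : (0 < b)%R -> (0 < aw_mass b)%R.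
Proof. by move=> b0; rewrite -lte_fin -aw_massE// ap_weight_int_gt0. Qed.

Lemma aw_mass_mono b c : (0 < b)%R -> (b <= c)%R -> (aw_mass b <= aw_mass c)%R.
Proof.
move=> b0 bc; rewrite -lee_fin -!aw_massE//; first exact: ap_weight_int_mono.
exact: lt_le_trans bc.
Qed.

(** If lam b <= 1, the mass of (0, b), and with it that of (0, 1), is at most lam b. *)
Lemma aw_lam_lower b : (1 <= b)%R -> (Num.min 1 (aw_mass 1) <= lam b)%R.
Proof.
move=> b1; have b0 : (0 < b)%R by exact: lt_le_trans b1.
have [l1|l1] := leP (lam b) 1%R; last by rewrite ge_min ltW.
rewrite ge_min; apply/orP; right.
apply: (le_trans (aw_mass_mono ltr01 b1)).
by rewrite -lee_fin -aw_massE// ap_weight_int_le1.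
Qed.

End weight.

Lemma aw_mass_hconjK p w s M C0 lam nu b : ap_weight p w s M C0 lam nu ->
  aw_mass (fun x => hconj (hconj (p x))) (fun x => (w x)^-1^-1)%R b = aw_mass p w b.
Proof.
move=> aw; congr fine; apply: eq_integral => x /set_mem /below_positive x0.
by rewrite invrK hconjK//; apply: lt_le_trans (aw_s aw) _; have /andP[] := aw_p aw x0.
Qed.

Lemma ap_weight_base D B Phi (b : nat -> R) p w s M C0 lam nu (q A K : R) :
  ap_weight p w s M C0 lam nu -> D `<=` positive ->
  (forall k, 0 < b k)%R -> (forall k, B k = below (b k)) ->
  nested_base mu D B (fun x => w x `^ p x)%R p q Phi s M A K ->
  nested_base mu D B (fun x => (w x)^-1 `^ hconj (p x))%R p q Phi s M A K ->
  ap_base mu D B w p q Phi s M A K C0 b (lam \o b) (nu \o b).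
Proof.
move=> aw Dp b0 Bb bw bs; split.
- exact: bw.
- exact: bs.
- exact: measurable_funS mDy Dp (aw_mw aw).
- by move=> x /Dp; exact: (aw_w aw).
- by move=> k; exact: (aw_lam0 aw).
- by move=> k; exact: (aw_nu0 aw).
- exact: b0.
- by move=> k; rewrite Bb; exact: mu_below.
- by move=> k; rewrite Bb; exact: (aw_lam aw).
- by move=> k; rewrite Bb; exact: (aw_nu aw).
- by move=> k; exact: (aw_lamnu aw).
Qed.

Section near_zero.

Let b0 (k : nat) : R := (2^-1 ^+ k)%R.

Definition B0 (k : nat) : set T := below (b0 k).

Let b0_gt0 k : (0 < b0 k)%R. Proof. by rewrite exprn_gt0// invr_gt0. Qed.

Let b0_le1 k : (b0 k <= 1)%R.
Proof. by rewrite exprn_ile1//; rewrite ?invr_ge0// invf_le1// ler1n. Qed.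

(** K0 / x^(N+1), in the factored form that [modular_lower] produces. *)
Definition Phi0 (K0 N : R) (x : T) : R := (K0 * ((X x)^-1 * (X x)^-1 `^ N))%R.

Lemma B0_sub k : B0 k `<=` below 1.
Proof. exact/below_mono/b0_le1. Qed.

(** The dual mass of (0, 2^-k) is at most [A], so [modular_lower] keeps the mass of w^p above a
    multiple of b^(N+1) with b = 2^-k; then x < b replaces b by x. *)
Lemma aw_mass_lower0 p w s M C0 lam nu (A N : R) k x :
  ap_weight p w s M C0 lam nu -> (1 <= A)%R -> (M <= N)%R ->
  (aw_mass (fun x => hconj (p x)) (fun x => (w x)^-1)%R 1 <= A)%R ->
  B0 k x ->
  ((fine (\int[mu]_(x in B0 k) (w x `^ p x)%:E))^-1 <= Phi0 (2 * (2 * A) `^ N)%R N x)%R.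
Proof.
move=> aw A1 MN mA /andP[x0 xb].
have aw' := ap_weight_hconj aw.
have sub := @below_positive (b0 k).
have m0 := aw_mass_gt0 aw (b0_gt0 k).
have s1 := aw_s aw; have sM := aw_sM aw.
apply: (@le_trans _ _ (2 * (2 * A) `^ N * ((b0 k)^-1 * (b0 k)^-1 `^ N))%R).
  apply: (@modular_lower _ _ _ mu (B0 k) w p (fun x => hconj (p x)) N (b0 k) _ A).
  - exact: mD.
  - exact: measurable_funS mDy sub (aw_mw aw).
  - exact: measurable_funS mDy sub (aw_mp aw).
  - exact: measurable_funS mDy sub (aw_mp aw').
  - by move=> y /sub; exact: (aw_w aw).
  - move=> y /sub y0; have /andP[sp pM] := aw_p aw y0.
    by rewrite (le_trans (ltW s1) sp) (le_trans pM).
  - move=> y /sub y0; have /andP[sp pM] := aw_p aw y0.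
    by rewrite ltW// hconj_gt1//; exact: lt_le_trans sp.
  - exact: mu_below.
  - by rewrite b0_gt0/= (le_trans (b0_le1 k))// mulr_ege1// ler1n.
  - exact: m0.
  - by rewrite -(aw_massE aw (b0_gt0 k)).
  - apply: (@le_trans _ _ (aw_mass (fun x => hconj (p x)) (fun x => (w x)^-1)%R 1)%:E).
      rewrite -(aw_massE aw' ltr01); apply: (ap_weight_int_mono aw').
      exact: b0_le1.
    by rewrite lee_fin.
have i1 : ((b0 k)^-1 <= (X x)^-1)%R by rewrite lef_pV2 ?posrE// ltW.
have N0 : (0 <= N)%R := le_trans (ltW (lt_trans ltr01 (lt_le_trans s1 sM))) MN.
rewrite /Phi0 ler_wpM2l ?mulr_ge0 ?powR_ge0//.
apply: ler_pM => //; rewrite ?invr_ge0 ?powR_ge0 ?(ltW (b0_gt0 k))//.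
by apply: powR_le2l; rewrite ?invr_ge0 ?(ltW (b0_gt0 k)).
Qed.

Lemma ap_maximal_near_zero p w s M C0 lam nu (CL p0 : R) :
  ap_weight p w s M C0 lam nu -> (0 < CL)%R -> (s <= p0 <= M)%R ->
  (forall x, 0 < X x < 2^-1 -> `|p x - p0| <= CL / - ln (X x))%R ->
  exists C : R, forall f n, measurable_fun (below 1) f ->
    (forall x, positive x -> (0 <= f x)%R) ->
    \int[mu]_(x in below 1) ((f x * w x) `^ p x)%:E <= 1 ->
    \int[mu]_(x in below 1) ((stepmax B0 (fun k =>
       fine (\int[mu]_(x in B0 k) (f x)%:E) / 2^-1 ^+ k) n x)%R `^ p x * w x `^ p x)%:E
    <= C%:E.
Proof.
move=> aw CL0 /andP[sp0 p0M] hL.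
have aw' := ap_weight_hconj aw.
have s1 := aw_s aw; have sM := aw_sM aw.
have pb := aw_p aw.
(* [S] bounds the masses of (0, 1) for both weights and also serves as the constant [A], because 1 /
   Phi <= 1. Likewise [N] below bounds both p and p', so that one [Phi] fits both weights. *)
pose S := Num.max 1%R (Num.max (aw_mass p w 1) (aw_mass (fun x => hconj (p x)) (fun x => (w x)^-1)%R 1)).
have S1 : (1 <= S)%R by rewrite le_max lexx.
have SW : (aw_mass p w 1 <= S)%R.
  by rewrite le_max; apply/orP; right; rewrite le_max lexx.
have SS : (aw_mass (fun x => hconj (p x)) (fun x => (w x)^-1)%R 1 <= S)%R.
  by rewrite le_max; apply/orP; right; rewrite le_max; apply/orP; right.
pose N := Num.max M (hconj s).
have MN : (M <= N)%R by rewrite le_max lexx.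
have cN : (hconj s <= N)%R by rewrite le_max lexx orbT.
clearbody S N.
have M1 : (1 < M)%R := lt_le_trans s1 sM.
have M0 : (0 < M)%R := lt_trans ltr01 M1.
have N0 : (0 <= N)%R := le_trans (ltW M0) MN.
have N10 : (0 <= N + 1)%R := addr_ge0 N0 ler01.
pose K0 := (2 * (2 * S) `^ N)%R.
have K01 : (1 <= K0)%R.
  by apply: mulr_ege1; rewrite ?ler1n//; apply: powR_ge1 => //; apply: mulr_ege1; rewrite ?ler1n.
(* Log-Hoelder continuity at 0 bounds x^(-(N+1)|p - p0|) by exp((N+1) CL) for x < 1/2; the second
   entry covers 1/2 <= x < 1. *)
pose K := (K0 `^ M * Num.max (expR ((N + 1) * CL)) (2 `^ ((N + 1) * M)))%R.
have K1 : (1 <= K)%R.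
  apply: mulr_ege1; first by apply: powR_ge1 => //; exact: ltW.
  rewrite le_max; apply/orP; left.
  by rewrite -[leLHS]expR0 ler_expR mulr_ge0 ?(ltW CL0).
exists (ap_const s M S K C0) => f n mf f0 hf.
have sub := @below_positive 1.
have Phi01 x : below 1 x -> (1 <= Phi0 K0 N x)%R.
  move=> /andP[x0 x1].
  have x11 : (1 <= (X x)^-1)%R by rewrite invf_ge1// ltW.
  rewrite /Phi0; apply: mulr_ege1 => //; apply: mulr_ege1 => //.
  exact: powR_ge1.
have Phi00 x : below 1 x -> (0 < Phi0 K0 N x)%R.
  by move=> /Phi01; exact: lt_le_trans.
have mx : measurable_fun (below 1) (fun x => (X x)^-1)%R.
  apply: measurable_funVr (mD _) _ _; first exact: measurable_funS mX.
  by move=> x /andP[].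
have mPhi : measurable_fun (below 1) (Phi0 K0 N).
  apply: measurable_funM => //; apply: measurable_funM => //.
  exact: measurable_fun_powR.
(* The weight is w^p or w^(-p'), but the exponent of the base is [p] in both cases. *)
have base pp ww ss MM ll nn : ap_weight pp ww ss MM C0 ll nn -> (MM <= N)%R ->
    (aw_mass (fun x => hconj (pp x)) (fun x => (ww x)^-1)%R 1 <= S)%R ->
    (aw_mass pp ww 1 <= S)%R ->
    nested_base mu (below 1) B0 (fun x => ww x `^ pp x)%R p p0 (Phi0 K0 N) s M S K.
  move=> aaw MMN lS lW.
  have mV : measurable_fun (below 1) (fun x => ww x `^ pp x)%R.
    exact: measurable_funS mDy sub (ap_weight_measurable aaw).
  split.
  - exact: mD.
  - by move=> k; exact: mD.
  - exact: B0_sub.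
  - move=> k l kl; apply: below_mono.
    by apply: ler_wiXn2l => //; rewrite ?invr_ge0 ?invf_le1 ?ler1n.
  - exact: mV.
  - by move=> x _; exact: powR_ge0.
  - by move=> k; apply/andP; split; [exact: (ap_weight_int_gt0 aaw (b0_gt0 k))|exact: (ap_weight_int_lty aaw (b0_gt0 k))].
  - exact: measurable_funS mDy sub (aw_mp aw).
  - by move=> x /sub; exact: pb.
  - by rewrite sp0.
  - exact: mPhi.
  - exact: Phi01.
  - move=> x Bx; have /andP[x0 x1] := Bx.
    have tM : (`|p x - p0| <= M)%R.
      by apply: dist_le (pb _ (sub _ Bx)) _; rewrite ?sp0// ltW// (lt_trans ltr01).
    have x10 : (0 <= (X x)^-1)%R by rewrite invr_ge0 ltW.
    have xE : ((X x)^-1 * (X x)^-1 `^ N = (X x)^-1 `^ (N + 1))%R.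
      by rewrite addrC powR_D ?invr_gt0// powRr1.
    rewrite /Phi0 xE powRM ?powR_ge0//; last exact: le_trans K01.
    apply: ler_pM; rewrite ?powR_ge0 ?ler_powR//.
    rewrite -powRrM le_max.
    have [xh|xh] := ltP (X x) 2^-1%R.
      apply/orP; left.
      rewrite /powR gt_eqF ?invr_gt0// ler_expR lnV ?posrE// -mulrA ler_wpM2l//.
      have := hL x; rewrite x0 xh => /(_ isT).
      by rewrite ler_pdivlMr// oppr_gt0 ln_lt0// x0.
    apply/orP; right.
    apply: (@le_trans _ _ (2 `^ ((N + 1) * `|p x - p0|))%R).
      apply: powR_le2l => //; first by rewrite mulr_ge0.
      by rewrite -[leRHS]invrK lef_pV2 ?posrE ?invr_gt0.
    by apply: ler_powR; [rewrite ler1n|rewrite ler_wpM2l].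
  - by move=> k x Bx; exact: (aw_mass_lower0 aaw S1 MMN lS Bx).
  - apply: (@le_trans _ _ (aw_mass pp ww 1)%:E); last by rewrite lee_fin.
    rewrite -(aw_massE aaw ltr01); apply: ge0_le_integral.
    + exact: mD.
    + move=> x Bx; rewrite lee_fin mulr_ge0 ?powR_ge0// invr_ge0.
      exact: ltW (Phi00 _ Bx).
    + apply/measurable_EFinP/measurable_funM => //.
      exact: measurable_funVr (mD _) mPhi Phi00.
    + exact/measurable_EFinP.
    + move=> x Bx; rewrite lee_fin ler_piMl ?powR_ge0//.
      by rewrite invf_le1 ?Phi01// Phi00.
have bw := base _ _ _ _ _ _ aw MN SS SW.
have bs := base _ _ _ _ _ _ aw' cN.
rewrite (aw_mass_hconjK _ aw) in bs.
have ab := ap_weight_base aw sub b0_gt0 (fun=> erefl) bw (bs SW SS).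
apply: (ap_maximal n s1 S1 K1 (aw_C0 aw) ab mf) => // x /sub.
exact: f0.
Qed.

End near_zero.

End half_line.

(** * Intervals near infinity *)

Section near_infinity.
Local Open Scope ereal_scope.
Context d (T : measurableType d) (R : realType).
Variable mu : {measure set T -> \bar R}.
Variable X : T -> R.
Hypothesis mX : measurable_fun setT X.
Hypothesis mu_below : forall b : R, (0 < b)%R -> mu (below X b) = b%:E.
Implicit Types (f V : T -> R) (b : R).

Let mD := measurable_below mX.
Let mDy := measurable_positive mX.

Lemma below_cover : \bigcup_j below X (2 ^+ j)%R = positive X.
Proof.
apply/seteqP; split => [t [j _]|t t0]; first exact: below_positive.
exists (Num.truncn (X t)).+1 => //; rewrite /below/= t0/=.
apply: (lt_le_trans (truncnS_gt _)).
by rewrite -natrX ler_nat; apply: ltnW; exact: ltn_expl.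
Qed.

Definition Phioo (K0 N : R) (x : T) : R := (K0 * (expR 1 + X x) `^ (N + 1))%R.

Let e1 (x : T) : positive X x -> (1 <= expR 1 + X x)%R.
Proof.
move=> x0; apply: ler_wpDr; first exact: ltW.
by rewrite -[leLHS]expR0 ler_expR.
Qed.

Lemma measurable_Phioo K0 N : measurable_fun (positive X) (Phioo K0 N).
Proof.
apply: measurable_funM => //; apply: measurable_fun_powR => //.
by apply: measurable_funD => //; exact: measurable_funS mX.
Qed.

(** Dyadic annuli: on 2^n <= x < 2^(n+1) the kernel is at most 2^(-n(N+1)) and the mass of [V] at
    most c 2^((n+1)N), so the annuli form a geometric series of ratio 1/2. *)
Lemma growth_integral V (c N : R) : measurable_fun (positive X) V ->
  (forall x, positive X x -> (0 <= V x)%R) -> (0 <= c)%R -> (0 <= N)%R ->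
  (forall j : nat, \int[mu]_(x in below X (2 ^+ j)%R) (V x)%:E <= (c * (2 ^+ j) `^ N)%:E) ->
  \int[mu]_(x in positive X) (((expR 1 + X x) `^ (N + 1))^-1 * V x)%:E
    <= (c + c * 2 `^ N * 2)%:E.
Proof.
move=> mV V0 c0 N0 hV.
pose h x := (((expR 1 + X x) `^ (N + 1))^-1 * V x)%R.
have e0 x : positive X x -> (0 < expR 1 + X x)%R by move=> /e1; exact: lt_le_trans.
have mh : measurable_fun (positive X) h.
  apply: measurable_funM => //; apply: measurable_funVr mDy _ _.
    apply: measurable_fun_powR => //.
    by apply: measurable_funD => //; exact: measurable_funS mX.
  by move=> x x0; rewrite powR_gt0// e0.
have h0 x : positive X x -> (0 <= h x)%R.
  by move=> x0; rewrite mulr_ge0 ?V0// invr_ge0 powR_ge0.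
have sub j : below X (2 ^+ j)%R `<=` positive X := @below_positive _ _ _ X _.
have j1 (j : nat) : (1 <= 2 ^+ j :> R)%R by rewrite exprn_ege1// ler1n.
have jS j : ((2 : R) ^+ j <= 2 ^+ j.+1)%R by rewrite ler_weXn2l// ler1n.
(* The factor 2 - 2 / 2^n is the sum of 2^-i over i < n. *)
have step n : \int[mu]_(x in below X (2 ^+ n)%R) (h x)%:E <=
    (c + c * 2 `^ N * (2 - 2 / 2 ^+ n))%:E.
  elim: n => [|n IH].
    rewrite expr0 divr1 subrr mulr0 addr0.
    apply: le_trans (_ : \int[mu]_(x in below X (2 ^+ 0)%R) (V x)%:E <= _); last first.
      by apply: le_trans (hV 0%N) _; rewrite expr0 powR1 mulr1.
    rewrite expr0; apply: ge0_le_integral; first exact: mD.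
    + by move=> x /below_positive /h0; rewrite lee_fin.
    + by apply/measurable_EFinP; apply: measurable_funS mDy (@below_positive _ _ _ X 1) mh.
    + by apply/measurable_EFinP; apply: measurable_funS mDy (@below_positive _ _ _ X 1) mV.
    + move=> x /below_positive x0; rewrite lee_fin ler_piMl ?V0//.
      rewrite invf_le1 ?powR_gt0 ?e0//; apply: powR_ge1; first exact: e1.
      exact: addr_ge0.
  pose E := below X (2 ^+ n.+1)%R `\` below X (2 ^+ n)%R.
  have mE : measurable E by apply: measurableD; exact: mD.
  have sE : below X (2 ^+ n)%R `|` E = below X (2 ^+ n.+1)%R.
    by rewrite setDUK//; exact: below_mono.
  rewrite -sE ge0_integral_setU//; last first.
  - by rewrite disj_set2E; apply/eqP; exact: setDIK.
  - by move=> x; rewrite sE => /sub /h0; rewrite lee_fin.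
  - by rewrite sE; apply/measurable_EFinP; exact: measurable_funS mDy (@sub _) mh.
  have sEp : E `<=` positive X by move=> x [/sub].
  have hE : \int[mu]_(x in E) (h x)%:E <= (c * 2 `^ N * (2 ^+ n)^-1)%:E.
    have VE : \int[mu]_(x in E) (V x)%:E <= (c * (2 ^+ n.+1) `^ N)%:E.
      apply: le_trans (hV n.+1); apply: ge0_subset_integral => //.
      + by apply/measurable_EFinP; exact: measurable_funS mDy (@sub _) mV.
      + by move=> x /sub /V0; rewrite lee_fin.
      + by move=> x [].
    have -> : (c * 2 `^ N * (2 ^+ n)^-1 =
        ((2 ^+ n) `^ (N + 1))^-1 * (c * (2 ^+ n.+1) `^ N) + 0 * (c * (2 ^+ n.+1) `^ N))%R.
      rewrite mul0r addr0 exprS powRM ?exprn_ge0// powR_D ?exprn_gt0// powRr1 ?exprn_ge0//.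
      field; rewrite !gt_eqF ?powR_gt0 ?exprn_gt0//.
    apply: (@integral_le_lincomb _ _ _ _ _ V V h) => //.
    + exact: measurable_funS mDy sEp mV.
    + exact: measurable_funS mDy sEp mV.
    + exact: measurable_funS mDy sEp mh.
    + by move=> x /sEp /V0.
    + by move=> x /sEp /V0.
    + move=> x Ex; have x0 := sEp _ Ex; rewrite h0//= mul0r addr0.
      rewrite ler_wpM2r ?V0// lef_pV2 ?posrE ?powR_gt0 ?e0 ?exprn_gt0//.
      apply: powR_le2l; rewrite ?addr_ge0 ?exprn_ge0//.
      case: Ex => _ /=; rewrite /below/= => /negP; rewrite x0/= -leNgt => nx.
      by apply: ler_wpDl => //; exact: expR_ge0.
  apply: (le_trans (leeD IH hE)).
  rewrite -EFinD lee_fin exprS.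
  rewrite le_eqVlt; apply/orP; left; apply/eqP.
  by field; rewrite gt_eqF// exprn_gt0.
have cv : \int[mu]_(x in below X (2 ^+ n)%R) (h x)%:E @[n --> \oo] -->
    \int[mu]_(x in \bigcup_n below X (2 ^+ n)%R) (h x)%:E.
  apply: ge0_nondecreasing_set_cvg_integral.
  - apply/nondecreasing_seqP => n; rewrite subsetEset; exact: below_mono.
  - by move=> n; exact: mD.
  - by move=> n; apply/measurable_EFinP; exact: measurable_funS mDy (@sub _) mh.
  - by move=> n x /sub /h0; rewrite lee_fin.
rewrite -/(h _) -below_cover -(cvg_lim _ cv)//.
apply: lime_le; first by apply/cvg_ex; eexists; exact: cv.
apply: nearW => n; apply: (le_trans (step n)).
rewrite lee_fin lerD2l ler_wpM2l ?mulr_ge0 ?powR_ge0// gerBl.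
by rewrite divr_ge0 ?exprn_ge0.
Qed.

(** The weight condition gives lam b <= C0 b / nu b, and for b >= 1 [aw_lam_lower], applied to the
    dual weight, keeps nu b away from 0. *)
Lemma aw_growth p w s M C0 lam nu (N : R) (j : nat) :
  ap_weight mu X p w s M C0 lam nu -> (M <= N)%R ->
  \int[mu]_(x in below X (2 ^+ j)%R) (w x `^ p x)%:E
    <= ((Num.max 1 (C0 / Num.min 1 (aw_mass mu X (fun x => hconj (p x)) (fun x => (w x)^-1)%R 1)) `^ N) *
       (2 ^+ j) `^ N)%:E.
Proof.
move=> aw MN; set m1 := aw_mass _ _ _ _ _.
have aw' := ap_weight_hconj mX aw.
have j1 : (1 <= 2 ^+ j :> R)%R by rewrite exprn_ege1// ler1n.
have j0 : (0 < 2 ^+ j :> R)%R by rewrite exprn_gt0.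
have n0 : (0 < Num.min 1 m1)%R by rewrite lt_min ltr01 (aw_mass_gt0 mX mu_below aw').
have nl : (Num.min 1 m1 <= nu (2 ^+ j))%R := aw_lam_lower mX mu_below aw' j1.
have l0 := aw_lam0 aw j0.
set c1 := Num.max 1%R (C0 / Num.min 1 m1)%R.
have c11 : (1 <= c1)%R by rewrite le_max lexx.
have c10 : (0 <= c1)%R := le_trans ler01 c11.
have M0 : (0 <= M)%R := ltW (lt_trans ltr01 (lt_le_trans (aw_s aw) (aw_sM aw))).
have ll : (lam (2 ^+ j) <= c1 * 2 ^+ j)%R.
  apply: (@le_trans _ _ (C0 / Num.min 1 m1 * 2 ^+ j)%R); last first.
    by rewrite ler_wpM2r ?(ltW j0)// le_max lexx orbT.
  rewrite mulrAC ler_pdivlMr//.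
  by apply: le_trans (aw_lamnu aw j0); rewrite ler_wpM2l// ltW.
have lm : (Num.max 1 (lam (2 ^+ j)) <= c1 * 2 ^+ j)%R by rewrite ge_max ll mulr_ege1.
apply: (le_trans (ap_weight_int_le mX aw j0)).
rewrite lee_fin -powRM ?(ltW j0)//.
apply: (@le_trans _ _ ((c1 * 2 ^+ j) `^ M)%R).
  by apply: powR_le2l => //; rewrite le_max ler01.
by apply: ler_powR => //; exact: mulr_ege1.
Qed.

(** The index runs down from the largest interval (0, 2^n), as nested families decrease; truncated
    subtraction makes (0, 1) the constant tail. *)
Definition Boo (n k : nat) : set T := below X (2 ^+ (n - k))%R.

(** All the intervals contain (0, 1), so their masses stay above that of (0, 1), and [Phioo] is
    admissible on the whole half-line. The constant is uniform in [n], although the family depends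
    on it. *)
Lemma ap_maximal_near_infinity p w s M C0 lam nu (CL poo : R) :
  ap_weight mu X p w s M C0 lam nu -> (0 < CL)%R -> (s <= poo <= M)%R ->
  (forall x, positive X x -> `|p x - poo| <= CL / ln (expR 1 + X x))%R ->
  exists C : R, forall f n, measurable_fun (positive X) f ->
    (forall x, positive X x -> (0 <= f x)%R) ->
    \int[mu]_(x in positive X) ((f x * w x) `^ p x)%:E <= 1 ->
    \int[mu]_(x in positive X) ((stepmax (Boo n) (fun k =>
       fine (\int[mu]_(x in Boo n k) (f x)%:E) / 2 ^+ (n - k)) n x)%R `^ p x * w x `^ p x)%:E
    <= C%:E.
Proof.
move=> aw CL0 /andP[sp0 p0M] hL.
have aw' := ap_weight_hconj mX aw.
have s1 := aw_s aw; have sM := aw_sM aw.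
have pb := aw_p aw.
pose mW := aw_mass mu X p w 1.
pose mS := aw_mass mu X (fun x => hconj (p x)) (fun x => (w x)^-1)%R 1.
have mW0 : (0 < mW)%R := aw_mass_gt0 mX mu_below aw ltr01.
have mS0 : (0 < mS)%R := aw_mass_gt0 mX mu_below aw' ltr01.
pose K0 := Num.max 1%R (Num.max mW^-1 mS^-1)%R.
have K01 : (1 <= K0)%R by rewrite le_max lexx.
have KW : (mW^-1 <= K0)%R.
  by rewrite le_max; apply/orP; right; rewrite le_max lexx.
have KS : (mS^-1 <= K0)%R.
  by rewrite le_max; apply/orP; right; rewrite le_max; apply/orP; right.
pose N := Num.max M (hconj s).
have MN : (M <= N)%R by rewrite le_max lexx.
have cN : (hconj s <= N)%R by rewrite le_max lexx orbT.
pose cc (m : R) := (Num.max 1 (C0 / Num.min 1 m) `^ N)%R.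
have cc0 m : (0 <= cc m)%R by exact: powR_ge0.
pose AA m := (cc m + cc m * 2 `^ N * 2)%R.
have AA0 m : (0 <= AA m)%R by rewrite addr_ge0// !mulr_ge0// powR_ge0.
(* At least 1, and at least the bound of [growth_integral] for either weight. *)
pose A := (1 + AA mS + AA mW)%R.
have A1 : (1 <= A)%R by rewrite /A -addrA lerDl addr_ge0.
have AS : (AA mS <= A)%R by rewrite /A addrAC lerDr addr_ge0.
have AW : (AA mW <= A)%R by rewrite /A lerDr addr_ge0.
have growth pp ww ss MM ll nn : ap_weight mu X pp ww ss MM C0 ll nn -> (MM <= N)%R ->
  (AA (aw_mass mu X (fun x => hconj (pp x)) (fun x => (ww x)^-1)%R 1) <= A)%R ->
  \int[mu]_(x in positive X) (((expR 1 + X x) `^ (N + 1))^-1 * ww x `^ pp x)%:E <= A%:E.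
  move=> aaw MMN lA.
  apply: (@le_trans _ _ (AA (aw_mass mu X (fun x => hconj (pp x)) (fun x => (ww x)^-1)%R 1))%:E); last by rewrite lee_fin.
  apply: growth_integral => //.
  - exact: (ap_weight_measurable mX aaw).
  - by move=> x _; exact: powR_ge0.
  - apply: le_trans MN; exact: ltW (lt_trans ltr01 (lt_le_trans s1 sM)).
  - by move=> j; exact: aw_growth aaw MMN.
clearbody K0 N A.
have M1 : (1 < M)%R := lt_le_trans s1 sM.
have M0 : (0 < M)%R := lt_trans ltr01 M1.
have N0 : (0 <= N)%R := le_trans (ltW M0) MN.
have N10 : (0 <= N + 1)%R := addr_ge0 N0 ler01.
pose K := (K0 `^ M * expR ((N + 1) * CL))%R.
have K1 : (1 <= K)%R.
  apply: mulr_ege1; first by apply: powR_ge1 => //; exact: ltW.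
  by rewrite -[leLHS]expR0 ler_expR mulr_ge0 ?(ltW CL0).
exists (ap_const s M A K C0) => f n mf f0 hf.
have eN1 x : positive X x -> (1 <= (expR 1 + X x) `^ (N + 1))%R.
  by move=> x0; apply: powR_ge1 => //; exact: e1.
have Phi1 x : positive X x -> (1 <= Phioo K0 N x)%R.
  by move=> x0; apply: mulr_ege1 => //; exact: eN1.
have Phi0 x : positive X x -> (0 < Phioo K0 N x)%R.
  by move=> /Phi1; exact: lt_le_trans.
have mPhi := measurable_Phioo K0 N.
have j1 (j : nat) : (1 <= 2 ^+ j :> R)%R by rewrite exprn_ege1// ler1n.
have j0 (j : nat) : (0 < 2 ^+ j :> R)%R by rewrite exprn_gt0.
have base pp ww ss MM ll nn : ap_weight mu X pp ww ss MM C0 ll nn -> (MM <= N)%R ->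
    (AA (aw_mass mu X (fun x => hconj (pp x)) (fun x => (ww x)^-1)%R 1) <= A)%R ->
    ((aw_mass mu X pp ww 1)^-1 <= K0)%R ->
    nested_base mu (positive X) (Boo n) (fun x => ww x `^ pp x)%R p poo (Phioo K0 N) s M A K.
  move=> aaw MMN lA lK.
  have mV := ap_weight_measurable mX aaw.
  split.
  - exact: mDy.
  - by move=> k; exact: mD.
  - by move=> k; exact: below_positive.
  - move=> k l kl; apply: below_mono.
    by apply: ler_weXn2l; rewrite ?ler1n// leq_sub2l.
  - exact: mV.
  - by move=> x _; exact: powR_ge0.
  - by move=> k; apply/andP; split; [exact: (ap_weight_int_gt0 mX mu_below aaw (j0 _))|exact: (ap_weight_int_lty mX aaw (j0 _))].
  - exact: (aw_mp aw).
  - exact: pb.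
  - by rewrite sp0.
  - exact: mPhi.
  - exact: Phi1.
  - move=> x x0.
    have tM : (`|p x - poo| <= M)%R.
      by apply: dist_le (pb _ x0) _; rewrite ?sp0// ltW// (lt_trans ltr01).
    have e0 : (0 < expR 1 + X x)%R by apply: lt_le_trans (e1 x0).
    have l0 : (0 < ln (expR 1 + X x))%R.
      apply: ln_gt0; rewrite (@lt_le_trans _ _ (expR 1))//; last by rewrite lerDl ltW.
      by rewrite -[ltLHS]expR0 ltr_expR.
    rewrite /Phioo powRM ?powR_ge0//; last exact: le_trans K01.
    apply: ler_pM; rewrite ?powR_ge0 ?ler_powR//.
    rewrite -powRrM /powR gt_eqF// ler_expR -mulrA ler_wpM2l//.
    by have := hL _ x0; rewrite ler_pdivlMr.
  - move=> k x Bx; apply: (@le_trans _ _ K0); last first.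
      by rewrite /Phioo ler_peMr ?(le_trans ler01)// eN1//; exact: below_positive Bx.
    apply: le_trans lK; rewrite lef_pV2 ?posrE.
    + exact: (aw_mass_mono mX mu_below aaw).
    + exact: (aw_mass_gt0 mX mu_below aaw).
    + exact: (aw_mass_gt0 mX mu_below aaw).
  - apply: le_trans (growth _ _ _ _ _ _ aaw MMN lA); apply: ge0_le_integral.
    + exact: mDy.
    + by move=> x x0; rewrite lee_fin mulr_ge0 ?powR_ge0// invr_ge0 ltW// Phi0.
    + apply/measurable_EFinP/measurable_funM => //.
      exact: measurable_funVr mDy mPhi Phi0.
    + apply/measurable_EFinP/measurable_funM => //.
      apply: measurable_funVr mDy _ _.
        apply: measurable_fun_powR => //.
        by apply: measurable_funD => //; exact: measurable_funS mX.
      by move=> x /eN1; exact: lt_le_trans.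
    + move=> x x0; rewrite lee_fin ler_wpM2r ?powR_ge0//.
      rewrite lef_pV2 ?posrE ?Phi0//; last by apply: lt_le_trans (eN1 _ x0).
      by rewrite /Phioo ler_peMl// powR_ge0.
have bw := base _ _ _ _ _ _ aw MN AS KW.
have bs := base _ _ _ _ _ _ aw' cN.
rewrite (aw_mass_hconjK _ aw) in bs.
have ab := ap_weight_base mX mu_below aw (@subset_refl _ _) (fun k => j0 (n - k)%N) (fun=> erefl) bw (bs AW KS).
exact: (ap_maximal n s1 A1 K1 (aw_C0 aw) ab mf f0 hf).
Qed.

End near_infinity.

(** * The maximal operator on the half-line *)

Section dyadic.
Context {R : realType}.

Lemma exists_expr_gt (b : R) : exists n, b <= 2 ^+ n.
Proof.
exists (Num.truncn b).+1.
apply: (le_trans (ltW (truncnS_gt _))).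
by rewrite -natrX ler_nat; apply: ltnW; exact: ltn_expl.
Qed.

Lemma dyadic_ge (b : R) : 1 < b -> exists n, 2 ^+ n < b <= 2 ^+ n.+1.
Proof.
move=> b1; case: (ex_minnP (exists_expr_gt b)) => -[|n] bn minn.
  by move: bn; rewrite expr0 leNgt b1.
exists n; rewrite bn andbT ltNge; apply/negP => /minn.
by rewrite ltnn.
Qed.

Lemma dyadic_le (b : R) : 0 < b <= 1 -> exists n, 2^-1 ^+ n.+1 <= b <= 2^-1 ^+ n.
Proof.
move=> /andP[b0 b1].
have e : exists n, (2^-1 : R) ^+ n <= b.
  have [n bn] := exists_expr_gt b^-1; exists n.
  by rewrite exprVn -(invrK b) lef_pV2// posrE ?exprn_gt0// invr_gt0.
case: (ex_minnP e) => -[|n] bn minn.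
  move: bn; rewrite expr0 => bn; exists 0%N.
  by rewrite expr0 b1 andbT expr1 (le_trans _ bn)// invf_le1// ler1n.
exists n; rewrite bn /= leNgt; apply/negP => /ltW/minn.
by rewrite ltnn.
Qed.

End dyadic.

Section monotone_bound.
Local Open Scope ereal_scope.
Context d (T : measurableType d) (R : realType).
Variable mu : {measure set T -> \bar R}.

(** Monotone convergence in the form of a measurable majorant: a maximal function can be dominated
    by [H] whether or not it is known to be measurable. *)
Lemma monotone_bound (D : set T) (h : nat -> T -> R) (C : R) : measurable D ->
  (forall n, measurable_fun D (h n)) -> (forall n x, D x -> (0 <= h n x)%R) ->
  (forall n x, D x -> (h n x <= h n.+1 x)%R) ->
  (forall n, \int[mu]_(x in D) (h n x)%:E <= C%:E) ->
  exists H : T -> \bar R, [/\ measurable_fun D H, (forall x, D x -> 0 <= H x),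
    (forall n x, D x -> (h n x)%:E <= H x) & \int[mu]_(x in D) H x <= C%:E].
Proof.
move=> mD mh h0 hS hC.
have nd x : D x -> nondecreasing_seq (fun n => (h n x)%:E).
  by move=> Dx; apply/nondecreasing_seqP => n; rewrite lee_fin hS.
have mhE n : measurable_fun D (fun x => (h n x)%:E) by exact/measurable_EFinP.
have h0E n x : D x -> 0 <= (h n x)%:E by move=> Dx; rewrite lee_fin h0.
have cv x : D x -> cvgn (fun n => (h n x)%:E).
  by move=> Dx; exact: ereal_nondecreasing_is_cvgn (nd x Dx).
have hH n x : D x -> (h n x)%:E <= limn (fun n => (h n x)%:E).
  move=> Dx; rewrite (cvg_lim _ (ereal_nondecreasing_cvgn (nd x Dx)))//.
  by apply: ereal_sup_ubound; exists n.
exists (fun x => limn (fun n => (h n x)%:E)); split.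
- exact: (@emeasurable_fun_cvg _ _ _ _ (fun n x => (h n x)%:E)).
- by move=> x Dx; exact: le_trans (h0E 0%N x Dx) (hH 0%N x Dx).
- exact: hH.
- rewrite monotone_convergence//; apply: lime_le; last exact: nearW.
  apply: ereal_nondecreasing_is_cvgn; apply/nondecreasing_seqP => n.
  by apply: ge0_le_integral => // x Dx; [exact: h0E|rewrite lee_fin hS].
Qed.

End monotone_bound.

Section half_line_maximal.
Local Open Scope ereal_scope.
Context d (T : measurableType d) (R : realType).
Variable mu : {measure set T -> \bar R}.
Variable X : T -> R.
Hypothesis mX : measurable_fun setT X.
Hypothesis mu_below : forall b : R, (0 < b)%R -> mu (below X b) = b%:E.
Implicit Types (f V : T -> R) (b : R).

Let mD := measurable_below mX.
Let mDy := measurable_positive mX.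

(** Young's inequality for f = (f w) (1 / w) gives f <= (f w)^p + w^(-p'). *)
Lemma ap_weight_integral_lty p w s M C0 lam nu f b :
  ap_weight mu X p w s M C0 lam nu -> measurable_fun (positive X) f ->
  (forall x, positive X x -> (0 <= f x)%R) ->
  \int[mu]_(x in positive X) ((f x * w x) `^ p x)%:E <= 1 -> (0 < b)%R ->
  \int[mu]_(x in below X b) (f x)%:E < +oo.
Proof.
move=> aw mf f0 hf b0.
have aw' := ap_weight_hconj mX aw.
have sub := @below_positive _ _ _ X b.
have mfw : measurable_fun (positive X) (fun x => (f x * w x) `^ p x)%R.
  apply: measurable_fun_powR mDy _ (aw_mp aw).
  by apply: measurable_funM => //; exact: (aw_mw aw).
have mS := ap_weight_measurable mX aw'.
apply: (@le_lt_trans _ _ (1 * 1 + 1 * aw_mass mu X (fun x => hconj (p x)) (fun x => (w x)^-1)%R b)%:E); last exact: ltry.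
apply: (@integral_le_lincomb _ _ _ _ _ (fun x => (f x * w x) `^ p x)%R (fun x => (w x)^-1 `^ hconj (p x))%R f) => //.
- exact: measurable_funS mDy sub mfw.
- exact: measurable_funS mDy sub mS.
- exact: measurable_funS mDy sub mf.
- by move=> x _; exact: powR_ge0.
- by move=> x _; exact: powR_ge0.
- move=> x /sub x0; rewrite f0//= !mul1r.
  have w0 := aw_w aw x0; have /andP[sp _] := aw_p aw x0.
  have p1 : (1 < p x)%R := lt_le_trans (aw_s aw) sp.
  have p0 : (0 < p x)%R := lt_trans ltr01 p1.
  have c1 := hconj_gt1 p1; have c0 := lt_trans ltr01 c1.
  have fwE : (f x = (f x * w x) * (w x)^-1)%R by rewrite mulfK// gt_eqF.
  rewrite {1}fwE.
  have := @conjugate_powR R (f x * w x)%R (w x)^-1%R (p x) (hconj (p x)).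
  rewrite mulr_ge0 ?f0 ?(ltW w0)// invr_ge0 (ltW w0) p0 c0 => /(_ isT isT isT isT).
  rewrite /hconj invrK addrC subrK => /(_ erefl) h; apply: (le_trans h).
  rewrite -/(hconj (p x)) lerD//.
    by rewrite ler_pdivrMr// ler_peMr ?powR_ge0// ltW.
  by rewrite ler_piMr ?powR_ge0// gerBl invr_ge0 ltW.
- apply: le_trans hf; apply: ge0_subset_integral => //.
  + exact/measurable_EFinP.
  + by move=> x _; rewrite lee_fin powR_ge0.
- by rewrite -(aw_massE mX mu_below aw').
Qed.

(** The price of rounding [b] up to a dyadic length. *)
Lemma mean_below_le f b c : measurable_fun (positive X) f ->
  (forall x, positive X x -> (0 <= f x)%R) ->
  (forall b, (0 < b)%R -> \int[mu]_(x in below X b) (f x)%:E < +oo) ->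
  (0 < b)%R -> (b <= c)%R -> (c <= 2 * b)%R ->
  (0 <= fine (\int[mu]_(x in below X b) (f x)%:E) / b <=
   2 * (fine (\int[mu]_(x in below X c) (f x)%:E) / c))%R.
Proof.
move=> mf f0 ffin b0 bc cb.
have c0 : (0 < c)%R := lt_le_trans b0 bc.
have f0E e x : below X e x -> 0 <= (f x)%:E.
  by move=> /below_positive /f0; rewrite lee_fin.
have F0 e : 0 <= \int[mu]_(x in below X e) (f x)%:E by apply: integral_ge0 => x; exact: f0E.
have Ff e : (0 < e)%R -> \int[mu]_(x in below X e) (f x)%:E \is a fin_num.
  by move=> e0; rewrite ge0_fin_numE ?ffin.
rewrite divr_ge0 ?fine_ge0 ?(ltW b0)//=.
rewrite ler_pdivrMr//.
have h : (fine (\int[mu]_(x in below X b) (f x)%:E) <= fine (\int[mu]_(x in below X c) (f x)%:E))%R.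
  rewrite fine_le ?Ff//; apply: ge0_subset_integral => //.
  - by apply/measurable_EFinP; exact: measurable_funS mDy (@below_positive _ _ _ X c) mf.
  - by move=> x; exact: f0E.
  - exact: below_mono.
apply: (le_trans h); rewrite mulrAC.
by rewrite mulrCA ler_peMr ?fine_ge0// ler_pdivlMr// mul1r.
Qed.

(** Lengths b <= 1 are rounded up to some 2^-k and the others to some 2^(k+1), which costs a factor
    2, hence 2^M after taking powers. [H] adds up the limits obtained from the two families. *)
Lemma ap_maximal_half_line p w s M C0 lam nu (CL0 p0 CLoo poo : R) :
  ap_weight mu X p w s M C0 lam nu -> (0 < CL0)%R -> (s <= p0 <= M)%R ->
  (forall x, 0 < X x < 2^-1 -> `|p x - p0| <= CL0 / - ln (X x))%R ->
  (0 < CLoo)%R -> (s <= poo <= M)%R ->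
  (forall x, positive X x -> `|p x - poo| <= CLoo / ln (expR 1 + X x))%R ->
  exists C : R, forall f, measurable_fun (positive X) f ->
    (forall x, positive X x -> (0 <= f x)%R) ->
    \int[mu]_(x in positive X) ((f x * w x) `^ p x)%:E <= 1 ->
    (forall b, (0 < b)%R -> \int[mu]_(x in below X b) (f x)%:E < +oo) /\
    exists H : T -> \bar R, [/\ measurable_fun (positive X) H,
      (forall x, positive X x -> 0 <= H x),
      \int[mu]_(x in positive X) H x <= C%:E &
      forall x b, positive X x -> (X x < b)%R ->
        ((fine (\int[mu]_(y in below X b) (f y)%:E) / b * w x) `^ p x)%:E <= H x].
Proof.
move=> aw CL00 p0b hL0 CLoo0 poob hLoo.
have [C1 hC1] := ap_maximal_near_zero mX mu_below aw CL00 p0b hL0.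
have [C2 hC2] := ap_maximal_near_infinity mX mu_below aw CLoo0 poob hLoo.
exists (2 `^ M * (C1 + C2))%R => f mf f0 hf.
have ffin b := @ap_weight_integral_lty _ _ _ _ _ _ _ f b aw mf f0 hf.
split => //.
have s1 := aw_s aw; have pb := aw_p aw.
have p_gt0 x : positive X x -> (0 < p x)%R.
  move=> x0; have /andP[sp _] := pb _ x0.
  exact: lt_le_trans (lt_trans ltr01 s1) sp.
have mwp := ap_weight_measurable mX aw.
have sub1 := @below_positive _ _ _ X 1.
have mfw : measurable_fun (positive X) (fun x => (f x * w x) `^ p x)%R.
  apply: measurable_fun_powR mDy _ (aw_mp aw).
  by apply: measurable_funM => //; exact: (aw_mw aw).
pose a0 k := (fine (\int[mu]_(x in B0 X k) (f x)%:E) / 2^-1 ^+ k)%R.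
pose h0 n x := (stepmax (B0 X) a0 n x `^ p x * w x `^ p x)%R.
have mh0 n : measurable_fun (positive X) (h0 n).
  apply: measurable_funM => //; apply: measurable_fun_powR mDy _ (aw_mp aw).
  by apply: measurable_stepmax => k; exact: mD.
have h00 n x : positive X x -> (0 <= h0 n x)%R by rewrite mulr_ge0 ?powR_ge0.
have h0S n x : positive X x -> (h0 n x <= h0 n.+1 x)%R.
  move=> x0; rewrite ler_wpM2r ?powR_ge0//.
  apply: powR_le2l (ltW (p_gt0 _ x0)) (cmax_ge0 _ _) _.
  exact: le_cmaxS.
have h0C n : \int[mu]_(x in positive X) (h0 n x)%:E <= C1%:E.
  have hf1 : \int[mu]_(x in below X 1) ((f x * w x) `^ p x)%:E <= 1.
    apply: le_trans hf; apply: ge0_subset_integral => //.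
    + exact/measurable_EFinP.
    + by move=> x _; rewrite lee_fin powR_ge0.
  have := hC1 f n (measurable_funS mDy sub1 mf) f0 hf1.
  apply: le_trans; rewrite -(integral_indicM _ _ (mD 1) sub1).
  rewrite le_eqVlt; apply/orP; left; apply/eqP.
  apply: eq_integral => x /set_mem x0; rewrite indicE.
  case: (boolP (x \in below X 1)) => [_|nx]; first by rewrite mul1r.
  rewrite mul0r /h0.
  have [->|[k [_ Bx _]]] := stepmax_cases (B0 X) a0 n x.
    by rewrite powR0 ?mul0r// gt_eqF// p_gt0.
  by move: nx; rewrite mem_set//; exact: B0_sub Bx.
have [H0 [mH0 H00 H0h H0C]] := monotone_bound mDy mh0 h00 h0S h0C.
pose aoo n k := (fine (\int[mu]_(x in Boo X n k) (f x)%:E) / 2 ^+ (n - k))%R.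
pose h1 n x := (stepmax (Boo X n) (aoo n) n x `^ p x * w x `^ p x)%R.
have mh1 n : measurable_fun (positive X) (h1 n).
  apply: measurable_funM => //; apply: measurable_fun_powR mDy _ (aw_mp aw).
  by apply: measurable_stepmax => k; exact: mD.
have h10 n x : positive X x -> (0 <= h1 n x)%R by rewrite mulr_ge0 ?powR_ge0.
have h1S n x : positive X x -> (h1 n x <= h1 n.+1 x)%R.
  move=> x0; rewrite ler_wpM2r ?powR_ge0//.
  suff le : (stepmax (Boo X n) (aoo n) n x <= stepmax (Boo X n.+1) (aoo n.+1) n.+1 x)%R.
    exact: powR_le2l (ltW (p_gt0 _ x0)) (cmax_ge0 _ _) le.
  have [->|[k [kn Bx ->]]] := stepmax_cases (Boo X n) (aoo n) n x; first exact: cmax_ge0.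
  (* Passing from n to n + 1 shifts the reversed index by one, so the new family contains the old
     one. *)
  have -> : aoo n k = aoo n.+1 k.+1 by rewrite /aoo /Boo subSS.
  by apply: stepmax_ub => //; rewrite /Boo subSS.
have h1C n : \int[mu]_(x in positive X) (h1 n x)%:E <= C2%:E by exact: hC2.
have [H1 [mH1 H10 H1h H1C]] := monotone_bound mDy mh1 h10 h1S h1C.
exists (fun x => (2 `^ M)%:E * (H0 x + H1 x)); split.
- by apply: measurable_funeM; exact: emeasurable_funD.
- by move=> x x0; rewrite mule_ge0 ?lee_fin ?powR_ge0 ?adde_ge0 ?H00 ?H10.
- rewrite ge0_integralZl//; last 2 first.
  + exact: emeasurable_funD.
  + by move=> x x0; rewrite adde_ge0 ?H00 ?H10.
  by rewrite EFinM lee_wpmul2l ?lee_fin ?powR_ge0// ge0_integralD// EFinD leeD.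
move=> x b x0 xb.
have xpos : (0 < X x)%R := x0.
have b0 : (0 < b)%R := lt_trans xpos xb.
have w0 := ltW (aw_w aw x0).
have /andP[sp pM] := pb _ x0.
have pp := ltW (p_gt0 _ x0).
suff [v [v0 av vH]] : exists v : R, [/\ (0 <= v)%R,
    (0 <= fine (\int[mu]_(y in below X b) (f y)%:E) / b <= 2 * v)%R &
    (v `^ p x * w x `^ p x)%:E <= H0 x + H1 x].
  apply: (@le_trans _ _ ((2 `^ M)%:E * (v `^ p x * w x `^ p x)%:E)); last first.
    by rewrite lee_wpmul2l// lee_fin powR_ge0.
  have /andP[av0 av1] := av.
  rewrite -EFinM lee_fin powRM// mulrA ler_wpM2r ?powR_ge0//.
  apply: (le_trans (powR_le2l pp av0 av1)).
  by rewrite powRM// ler_wpM2r ?powR_ge0// ler_powR// ler1n.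
have [b1|b1] := leP b 1%R.
  have [|k /andP[kb bk]] := @dyadic_le _ b; first by rewrite b0.
  have Bx : B0 X k x by rewrite /B0 /below/= xpos (lt_le_trans xb).
  exists (stepmax (B0 X) a0 k.+1 x); split; first exact: cmax_ge0.
  - have := mean_below_le mf f0 ffin b0 bk.
    have kb2 : (2^-1 ^+ k <= 2 * b)%R.
      by move: kb; rewrite exprS mulrC ler_pdivrMr// mulrC.
    move=> /(_ kb2)/andP[-> h]; apply: (le_trans h).
    by rewrite ler_wpM2l//; exact: (stepmax_ub a0 (ltnSn k) Bx).
  - by apply: (le_trans (H0h k.+1 x x0)); rewrite leeDl// H10.
have [k /andP[kb bk]] := dyadic_ge b1.
(* Index 0 of the family [k.+1] is the rounded interval (0, 2^(k+1)). *)
have Bx : Boo X k.+1 0 x by rewrite /Boo subn0 /below/= xpos (lt_le_trans xb).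
exists (stepmax (Boo X k.+1) (aoo k.+1) k.+1 x); split; first exact: cmax_ge0.
- have := mean_below_le mf f0 ffin b0 bk.
  have kb2 : (2 ^+ k.+1 <= 2 * b)%R by rewrite exprS ler_wpM2l// ltW.
  move=> /(_ kb2)/andP[-> h]; apply: (le_trans h).
  rewrite ler_wpM2l//.
  have := stepmax_ub (aoo k.+1) (ltn0Sn k) Bx.
  by rewrite {1}/aoo subn0 /Boo subn0.
- by apply: (le_trans (H1h k.+1 x x0)); rewrite leeDr// H00.
Qed.

End half_line_maximal.

(** * Luxemburg norms *)

Section ereal_facts.
Local Open Scope ereal_scope.
Context d (T : measurableType d) (R : realType).
Variable mu : {measure set T -> \bar R}.
Implicit Types (f g : T -> \bar R) (r : T -> R).

(** The integral of a nonnegative function is a supremum over the simple functions below it, so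
    monotonicity holds without measurability. This is used for maximal functions. *)
Lemma le_ge0_integral (D : set T) f g : (forall x, D x -> 0 <= f x) ->
  (forall x, D x -> f x <= g x) ->
  \int[mu]_(x in D) f x <= \int[mu]_(x in D) g x.
Proof.
move=> f0 fg; have g0 x : D x -> 0 <= g x.
  by move=> Dx; exact: le_trans (f0 _ Dx) (fg _ Dx).
rewrite !ge0_integralE//; apply: ge_ereal_sup => _ [h hf <-].
apply: ereal_sup_ubound; exists h => // x; apply: (le_trans (hf x)).
by rewrite /patch; case: ifPn => // /set_mem; exact: fg.
Qed.

Lemma measurable_fun_poweR (D : set T) f r : measurable D ->
  measurable_fun D f -> measurable_fun D r ->
  measurable_fun D (fun x => f x `^ r x).
Proof.
move=> mD mf mr.
have mff : measurable_fun D (fun x => fine (f x)) by exact: measurableT_comp.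
have mp : measurable_fun D (fun x => (fine (f x) `^ r x)%:E).
  by apply/measurable_EFinP; exact: measurable_fun_powR.
have mfin : measurable_fun D (fun x => f x \is a fin_num).
  by apply: (measurable_fun_bool true); exact: emeasurable_fin_num.
have meq y : measurable_fun D (fun x => f x == y).
  apply: (measurable_fun_bool false).
  rewrite [X in measurable X](_ : _ = D `&` [set x | f x != y]); last first.
    by apply/seteqP; split => x [Dx /= /negP/negP h]; split => //=; apply/negbTE.
  exact: emeasurable_neq.
under eq_fun do rewrite poweRE.
apply: measurable_fun_if => //.
- exact: measurable_fun_eqr.
- apply: (@measurable_funS _ _ _ _ D) => //; apply/measurable_EFinP.
  apply: measurable_fun_if => //; apply: (@measurable_funS _ _ _ _ D) => //.
  exact: measurable_fun_powR.
apply: (@measurable_funS _ _ _ _ D) => //.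
apply: measurable_fun_if => //.
apply: (@measurable_funS _ _ _ _ D) => //.
apply: measurable_fun_if => //.
exact: (@measurable_funS _ _ _ _ D).
Qed.

(** Bounds a product of two norms, each possibly infinite, by testing real numbers strictly below
    one of them. *)
Lemma mule_le_real (N L : \bar R) (A : R) : 0 <= N -> 0 <= L -> (0 <= A)%R ->
  (forall t : R, (0 < t)%R -> t%:E < N -> t%:E * L <= A%:E) -> L * N <= A%:E.
Proof.
move=> N0 L0 A0 h.
have [->|Nn0] := eqVneq N 0; first by rewrite mule0 lee_fin.
have Np : 0 < N by rewrite lt_def Nn0.
have [t t0 tN] : exists2 t : R, (0 < t)%R & t%:E < N.
  case: N N0 h Nn0 Np => [n| |]//= N0 _ _.
    by rewrite lte_fin => n0; exists (n / 2)%R; [lra|rewrite lte_fin; lra].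
  by exists 1%R => //; exact: ltry.
have [Ly|Lfin] := eqVneq L +oo.
  by move: (h t t0 tN); rewrite Ly gt0_muley ?lte_fin// leNgt ltry.
case: L L0 h Lfin => [l| |]// L0 h _; rewrite lee_fin in L0.
have [l0|ln0] := eqVneq l 0%R; first by rewrite l0 mul0e lee_fin.
have lp : (0 < l)%R by rewrite lt_def ln0.
case: N N0 h Nn0 Np tN => [n| |]//= N0 h _ Np tN.
  rewrite -EFinM lee_fin mulrC -ler_pdivlMr//.
  rewrite lte_fin in Np.
  rewrite leNgt; apply/negP => An.
  have A0' : (0 <= A / l)%R by rewrite divr_ge0.
  have p1 : (0 < (A / l + n) / 2)%R by rewrite divr_gt0// ltr_wpDl.
  have := h _ p1; rewrite lte_fin -EFinM lee_fin -ler_pdivlMr//.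
  by rewrite leNgt => /(_ _)/negP; apply; rewrite ?ltr_pdivlMr ?ltr_pdivrMr// mulrDr !mulr1 ?ltrD2l ?ltrD2r.
have A0' : (0 <= A / l)%R by rewrite divr_ge0.
have p1 : (0 < A / l + 1)%R by rewrite ltr_wpDl.
have := h _ p1; rewrite ltry -EFinM lee_fin -ler_pdivlMr// => /(_ isT).
by rewrite gerDl ler10.
Qed.

End ereal_facts.

Section luxemburg_norm.
Local Open Scope ereal_scope.
Context d (T : measurableType d) (R : realType).
Variable mu : {measure set T -> \bar R}.
Variable D : set T.
Hypothesis mD : measurable D.
Implicit Types (f g : T -> \bar R) (r : T -> R).

Definition modular r f (m : R) := \int[mu]_(x in D) ((`|f x| / m%:E) `^ r x).

Definition lux r f : \bar R :=
  ereal_inf [set m%:E | m in [set m : R | (0 < m)%R /\ modular r f m <= 1]].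

Lemma lux_ge0 r f : 0 <= lux r f.
Proof. by apply: le_ereal_inf_tmp => _ [m [m0 _] <-]; rewrite lee_fin ltW. Qed.

Lemma lux_le r f (m : R) : (0 < m)%R -> modular r f m <= 1 -> lux r f <= m%:E.
Proof. by move=> m0 h; apply: ereal_inf_lbound; exists m. Qed.

Lemma modular_le r f g (m n : R) : (forall x, D x -> (0 <= r x)%R) ->
  (0 < m)%R -> (0 < n)%R ->
  (forall x, D x -> `|f x| / m%:E <= `|g x| / n%:E) ->
  modular r f m <= modular r g n.
Proof.
move=> r0 m0 n0 fg; apply: le_ge0_integral => x Dx; first exact: poweR_ge0.
apply: gt0_ler_poweR; rewrite ?r0 ?fg// ?in_itv/= ?leey ?andbT//.
- by rewrite mule_ge0// inve_ge0 lee_fin ltW.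
- by rewrite mule_ge0// inve_ge0 lee_fin ltW.
Qed.

Lemma lux_lt r f (m : R) : (forall x, D x -> (0 <= r x)%R) ->
  lux r f < m%:E -> modular r f m <= 1.
Proof.
move=> r0 /ereal_inf_lt[_ [n [n0 hn] <-]]; rewrite lte_fin => nm.
have m0 : (0 < m)%R := lt_trans n0 nm.
apply: le_trans hn; apply: modular_le => //.
move=> x _; apply: lee_wpmul2l => //.
by rewrite !inver !gt_eqF ?lee_fin ?lef_pV2 ?posrE ?(ltW nm).
Qed.

Lemma lux_scale_le r f g (c : R) : (forall x, D x -> (0 <= r x)%R) ->
  (0 < c)%R -> (forall x, D x -> c%:E * `|f x| <= `|g x|) ->
  c%:E * lux r f <= lux r g.
Proof.
move=> r0 c0 fg; apply: le_ereal_inf_tmp => _ [m [m0 hm] <-].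
have mc0 : (0 < m / c)%R by rewrite divr_gt0.
rewrite -(@lee_pdivlMl _ c)// -EFinM mulrC; apply: lux_le => //.
apply: le_trans hm; apply: modular_le => // x Dx.
have -> : `|f x| / (m / c)%:E = (c%:E * `|f x|) / m%:E.
  rewrite !inver !gt_eqF// invf_div EFinM muleA.
  by rewrite [`|f x| * _]muleC.
by rewrite lee_wpmul2r ?fg// inver gt_eqF// lee_fin invr_ge0 ltW.
Qed.

Lemma modularE r g (gr : T -> R) (m : R) : measurable_fun D r ->
  measurable_fun D g -> measurable_fun D gr -> (forall x, D x -> (0 <= gr x)%R) ->
  {ae mu, forall x, D x -> `|g x| = (gr x)%:E} -> (0 < m)%R ->
  modular r g m = \int[mu]_(x in D) ((gr x / m) `^ r x)%:E.
Proof.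
move=> mr mg mgr gr0 ggr m0; apply: ge0_ae_eq_integral => //.
- apply: measurable_fun_poweR => //.
  under eq_fun do rewrite inver gt_eqF// muleC.
  by apply: measurable_funeM; exact: measurableT_comp.
- by apply/measurable_EFinP; apply: measurable_fun_powR => //; exact: measurable_funM.
- by move=> x Dx; exact: poweR_ge0.
- by move=> x Dx; rewrite lee_fin powR_ge0.
apply: filterS ggr => x h Dx; rewrite h//.
by rewrite inver gt_eqF// -EFinM poweR_EFin.
Qed.

End luxemburg_norm.

(** * Weak type, strong type and the weight condition *)

Section weighted_half_line.
Local Open Scope ereal_scope.
Context d (T : measurableType d) (R : realType).
Variable mu : {measure set T -> \bar R}.
Variable X : T -> R.
Hypothesis mX : measurable_fun setT X.
Hypothesis mu_below : forall b : R, (0 < b)%R -> mu (below X b) = b%:E.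
Variables (p : T -> R) (w : T -> \bar R) (s M : R).
Hypotheses (s1 : (1 < s)%R) (sM : (s <= M)%R).
Hypothesis mp : measurable_fun (positive X) p.
Hypothesis pb : forall x, positive X x -> (s <= p x <= M)%R.
Hypothesis mw : measurable_fun (positive X) w.
Hypothesis w0 : forall x, positive X x -> 0 <= w x.
Hypothesis wae : {ae mu, forall x, positive X x -> 0 < w x < +oo}.
Implicit Types (f g : T -> \bar R) (r gr : T -> R) (b m : R).

Let mD := measurable_below mX.
Let mDy := measurable_positive mX.
Let below_pos b := @below_positive _ _ _ X b.

Local Notation nrm := (lux mu (positive X)).
Local Notation mdl := (modular mu (positive X)).

Definition maxX f (x : T) : \bar R :=
  ereal_sup [set (b^-1)%:E * \int[mu]_(y in below X b) `|f y|
            | b in [set b : R | (X x < b)%R]].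

Lemma maxX_ge f x b : (X x < b)%R ->
  (b^-1)%:E * \int[mu]_(y in below X b) `|f y| <= maxX f x.
Proof. by move=> xb; apply: ereal_sup_ubound; exists b. Qed.

Lemma maxX_ge0 f x : positive X x -> 0 <= maxX f x.
Proof.
move=> x0; have xb : (X x < X x + 1)%R by rewrite ltrDl.
apply: le_trans (maxX_ge f xb); apply: mule_ge0; last exact: integral_ge0.
by rewrite lee_fin invr_ge0 addr_ge0// ltW.
Qed.

Let p_gt0 x : positive X x -> (0 < p x)%R.
Proof.
by move=> /pb/andP[sp _]; exact: lt_le_trans (lt_trans ltr01 s1) sp.
Qed.

Let p_ge0 x : positive X x -> (0 <= p x)%R.
Proof. by move=> /p_gt0/ltW. Qed.

(** Chebyshev: c w is at most w times the maximal function on the level set. *)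
Lemma weak_of_strong (K : R) :
  (forall f, measurable_fun (positive X) f -> nrm p (fun x => f x * w x) < +oo ->
    nrm p (fun x => maxX f x * w x) <= K%:E * nrm p (fun x => f x * w x)) ->
  forall (c : R) f, (0 < c)%R -> measurable_fun (positive X) f ->
    nrm p (fun x => f x * w x) < +oo ->
    c%:E * nrm p (w \_ [set x | (0 < X x)%R /\ c%:E < maxX f x]) <=
      K%:E * nrm p (fun x => f x * w x).
Proof.
move=> hS c f c0 mf hf; apply: le_trans (hS f mf hf).
apply: lux_scale_le => // x x0.
have wx := w0 x0; have Nx := maxX_ge0 f x0.
rewrite patchE; case: ifPn => [/set_mem[_ cN]|_]; last by rewrite abse0 mule0.
by rewrite gee0_abs// gee0_abs ?mule_ge0// lee_wpmul2r// ltW.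
Qed.

(** A real, everywhere positive version of [w]: the value 1 is taken where [w] is 0 or infinite, on
    the half-line a null set. *)
Definition wreal (x : T) : R := if (0 < w x) && (w x < +oo) then fine (w x) else 1%R.

Lemma wreal_gt0 x : (0 < wreal x)%R.
Proof.
rewrite /wreal; case: ifPn => // /andP[w1 wy].
by apply: fine_gt0; rewrite w1.
Qed.

Lemma wrealE x : 0 < w x < +oo -> w x = (wreal x)%:E.
Proof.
move=> h; rewrite /wreal h; case/andP: h => h1 h2.
by rewrite fineK// ge0_fin_numE// ltW.
Qed.

Lemma measurable_wreal : measurable_fun (positive X) wreal.
Proof.
apply: measurable_fun_if => //.
- apply: measurable_and.
    by apply: (measurable_fun_bool true); exact: emeasurable_fun_o_infty.
  by apply: (measurable_fun_bool true); exact: emeasurable_fun_infty_o.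
- apply: (@measurable_funS _ _ _ _ (positive X)) => //.
  exact: measurableT_comp.
Qed.

Lemma wreal_ae : {ae mu, forall x, positive X x -> `|w x| = (wreal x)%:E}.
Proof.
apply: filterS wae => x h x0; have hw := h x0.
by rewrite gee0_abs ?w0//; exact: wrealE.
Qed.

Lemma wreal_inv_ae : {ae mu, forall x, positive X x -> `|(w x)^-1| = ((wreal x)^-1)%:E}.
Proof.
apply: filterS wae => x h x0; have hw := h x0.
rewrite (wrealE hw) inver gt_eqF ?wreal_gt0//.
by rewrite gee0_abs// lee_fin invr_ge0 ltW// wreal_gt0.
Qed.

Lemma measurable_inve_w : measurable_fun (positive X) (fun x => (w x)^-1).
Proof.
have mfw : measurable_fun (positive X) (fun x => fine (w x)) by exact: measurableT_comp.
have meq y : measurable_fun (positive X) (fun x => w x == y).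
  apply: (measurable_fun_bool false).
  rewrite [X in measurable X](_ : _ = positive X `&` [set x | w x != y]); last first.
    by apply/seteqP; split => x [Dx /= /negP/negP h]; split => //=; apply/negbTE.
  exact: emeasurable_neq.
apply: (eq_measurable_fun (fun x => if w x == 0 then +oo else
    if w x == +oo then 0 else (fine (w x) `^ (-1))%:E)).
  move=> x /set_mem x0; have := w0 x0.
  case: (w x) => [y| |]//= y0.
  - rewrite lee_fin in y0; rewrite inver /= eqe; case: ifPn => // _.
    by rewrite powR_inv1.
apply: measurable_fun_if => //.
apply: (@measurable_funS _ _ _ _ (positive X)) => //.
apply: measurable_fun_if => //.
apply: (@measurable_funS _ _ _ _ (positive X)) => //.
by apply/measurable_EFinP; exact: measurable_fun_powR.
Qed.

Lemma modular_below r g gr b m : measurable_fun (positive X) r ->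
  (forall x, positive X x -> (0 < r x)%R) ->
  measurable_fun (positive X) g -> measurable_fun (positive X) gr ->
  (forall x, positive X x -> (0 <= gr x)%R) ->
  {ae mu, forall x, positive X x -> `|g x| = (gr x)%:E} -> (0 < m)%R ->
  mdl r (g \_ (below X b)) m = \int[mu]_(x in below X b) ((gr x / m) `^ r x)%:E.
Proof.
move=> mr r0 mg mgr gr0 ggr m0.
rewrite (@modularE _ _ _ mu _ mDy r _ (fun x => \1_(below X b) x * gr x)%R); last 6 first.
- exact: mr.
- apply/(measurable_restrict _ (mD b) mDy).
  by apply: measurable_funS mDy _ mg; exact: subIsetl.
- by apply: measurable_funM => //; exact: measurable_indic.
- by move=> x x0; rewrite mulr_ge0 ?gr0.
- apply: filterS ggr => x h x0; rewrite patchE indicE; case: ifPn => _.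
    by rewrite h// mul1r.
  by rewrite abse0 mul0r.
- exact: m0.
rewrite -(integral_indicM _ _ (mD b) (@below_pos b)).
apply: eq_integral => x /set_mem x0; congr EFin.
rewrite indicE; case: (x \in below X b); rewrite ?mul1r// !mul0r.
by rewrite powR0// gt_eqF// r0.
Qed.

(** If the norm vanished, the modular at every m in (0, 1] would be at most 1, and since r >= 1 the
    integral of gr^r would be at most m for all these m; yet it is positive. *)
Lemma lux_below_gt0 r g gr b : measurable_fun (positive X) r ->
  (forall x, positive X x -> (1 <= r x)%R) ->
  measurable_fun (positive X) g -> measurable_fun (positive X) gr ->
  (forall x, positive X x -> (0 < gr x)%R) ->
  {ae mu, forall x, positive X x -> `|g x| = (gr x)%:E} -> (0 < b)%R ->
  0 < nrm r (g \_ (below X b)).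
Proof.
move=> mr r1 mg mgr gr0 ggr b0; rewrite ltNge; apply/negP => l0.
have r0 x : positive X x -> (0 < r x)%R by move=> /r1; exact: lt_le_trans.
have sub := @below_pos b.
have h m : (0 < m <= 1)%R -> \int[mu]_(x in below X b) (gr x `^ r x)%:E <= m%:E.
  move=> /andP[m0 m1]; apply: (@integral_powR_scale _ _ _ _ _ _ _ m) => //.
  - exact: measurable_funS mDy sub mgr.
  - exact: measurable_funS mDy sub mr.
  - by move=> x /sub; exact: gr0.
  - by move=> x /sub /r1 rx; rewrite ge1r_powR ?m0.
  - exact: ltW.
  rewrite -(modular_below b mr r0 mg mgr _ ggr m0); last by move=> x /gr0/ltW.
  apply: lux_lt => //; first by move=> x /r0/ltW.
  by apply: le_lt_trans l0 _; rewrite lte_fin.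
have : 0 < \int[mu]_(x in below X b) (gr x `^ r x)%:E.
  apply: ge0_integral_gt0 => //.
  - apply: measurable_funS mDy sub _.
    exact: measurable_fun_powR.
  - by move=> x /sub x0; rewrite powR_gt0 ?gr0.
  - by rewrite mu_below ?lte_fin.
set I := integral _ _ _ => I0.
have I1 : I <= 1%:E by apply: h; rewrite ltr01 lexx.
have If : I \is a fin_num by rewrite ge0_fin_numE ?(ltW I0)// (le_lt_trans I1) ?ltry.
move: h I0 I1; rewrite -/I -(fineK If) => h; rewrite lte_fin lee_fin => I0 I1.
have I2 : (0 < fine I / 2 <= 1)%R by apply/andP; split; lra.
by have := h _ I2; rewrite lee_fin; lra.
Qed.

Let q x := hconj (p x).

Let p_gt1 x : positive X x -> (1 < p x)%R.
Proof. by move=> /pb/andP[sp _]; exact: lt_le_trans s1 sp. Qed.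

Let mq : measurable_fun (positive X) q.
Proof.
apply: measurable_funVr mDy _ _.
  by apply: measurable_funB => //; apply: measurable_funVr mDy mp _ => x /p_gt0.
by move=> x /p_gt1 px; rewrite subr_gt0 invf_lt1// (lt_trans ltr01).
Qed.

Let q_gt1 x : positive X x -> (1 < q x)%R.
Proof. by move=> /p_gt1; exact: hconj_gt1. Qed.

Let q_le x : positive X x -> (q x <= hconj s)%R.
Proof. by move=> /pb/andP[sp _]; apply: hconj_le. Qed.

Let v x := ((wreal x)^-1)%R.

Let v_gt0 x : (0 < v x)%R. Proof. by rewrite invr_gt0 wreal_gt0. Qed.

Let mv : measurable_fun (positive X) v.
Proof.
apply: measurable_funVr mDy measurable_wreal _ => x _; exact: wreal_gt0.
Qed.

(** For a level t below the norm of 1 / w on (0, b), phi = (v / t)^p' has integral above 1. The test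
    function f = v (v / t)^(p'-1) satisfies f = t phi and (f w)^p = phi a.e. Cut down to a set where
    phi has a finite integral I > 1, it has mean t I / b over (0, b), while the norm of f w is at
    most I; weak type then gives t L <= K b. *)
Lemma ap_of_weak (K : R) : (0 < K)%R ->
  (forall (c : R) f, (0 < c)%R -> measurable_fun (positive X) f ->
    nrm p (fun x => f x * w x) < +oo ->
    c%:E * nrm p (w \_ [set x | (0 < X x)%R /\ c%:E < maxX f x]) <=
      K%:E * nrm p (fun x => f x * w x)) ->
  forall b, (0 < b)%R ->
    nrm p (w \_ (below X b)) * nrm q ((fun x => (w x)^-1) \_ (below X b))
      <= (K * b)%:E.
Proof.
move=> K0 hW b b0; set L := nrm p _.
have sub := @below_pos b.
have L0 : 0 <= L by exact: lux_ge0.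
have q0 x : positive X x -> (0 < q x)%R by move=> /q_gt1; exact: lt_trans.
apply: mule_le_real; [exact: lux_ge0|exact: L0|by rewrite mulr_ge0// ltW|move=> t t0 tN].
pose phi x := ((v x / t) `^ q x)%R.
have phi0 x : (0 <= phi x)%R by exact: powR_ge0.
have mvt : measurable_fun (positive X) (fun x => v x / t)%R by exact: measurable_funM.
have mphi : measurable_fun (positive X) phi by exact: measurable_fun_powR.
have hphi : 1 < \int[mu]_(x in below X b) (phi x)%:E.
  rewrite -(modular_below b mq q0 measurable_inve_w mv _ wreal_inv_ae t0); last first.
    by move=> x _; exact: ltW.
  rewrite ltNge; apply/negP => h.
  by move: tN; rewrite ltNge lux_le.
(* On [E n] the function phi is bounded, and these sets exhaust (0, b), so for some n the integral
   of phi is finite and still above 1. *)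
pose E (n : nat) := below X b `&` wreal @^-1` `[(n.+1%:R^-1)%R, +oo[%classic.
have mE n : measurable (E n).
  by apply: (measurable_funS mDy sub measurable_wreal) => //; exact: mD.
have Eb n : E n `<=` below X b by exact: subIsetl.
have Ep n : E n `<=` positive X by exact: subset_trans sub.
have UE : \bigcup_n E n = below X b.
  apply/seteqP; split => [x [n _]|x Bx]; first exact: Eb.
  exists (Num.truncn (v x)) => //; split => //=.
  rewrite in_itv/= andbT -[leRHS]invrK lef_pV2 ?posrE ?invr_gt0 ?wreal_gt0//.
  exact: ltW (truncnS_gt _).
have [n hn] : exists n, 1 < \int[mu]_(x in E n) (phi x)%:E.
  apply: contrapT => /forallNP h; move: hphi; rewrite -UE ltNge => /negP; apply.
  have cv : \int[mu]_(x in E n) (phi x)%:E @[n --> \oo] -->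
      \int[mu]_(x in \bigcup_n E n) (phi x)%:E.
    apply: ge0_nondecreasing_set_cvg_integral => //.
    - apply/nondecreasing_seqP => k; rewrite subsetEset => x [Bx].
      rewrite /= !in_itv/= !andbT => kx; split => //=; rewrite in_itv/= andbT.
      by apply: le_trans kx; rewrite lef_pV2 ?posrE// ler_nat.
    - by move=> k; apply/measurable_EFinP; exact: measurable_funS mDy (@Ep k) mphi.
    - by move=> k x _; rewrite lee_fin.
  rewrite -(cvg_lim _ cv)//.
  apply: lime_le; first by apply/cvg_ex; eexists; exact: cv.
  by apply: nearW => k; rewrite leNgt; apply/negP/h.
have mphiE : measurable_fun (E n) phi by exact: measurable_funS mDy (@Ep n) mphi.
pose c := Num.max 1%R (n.+1%:R / t)%R.
have c1 : (1 <= c)%R by rewrite le_max lexx.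
have fin : \int[mu]_(x in E n) (phi x)%:E \is a fin_num.
  rewrite ge0_fin_numE; last by rewrite (le_trans _ (ltW hn)).
  apply: (@le_lt_trans _ _ (c `^ hconj s * b + 0 * b)%:E); last exact: ltry.
  have h1 : \int[mu]_(x in E n) (1%R)%:E <= b%:E.
    by rewrite integral_cst// mul1e -mu_below//; apply: le_measure; rewrite ?inE.
  apply: (@integral_le_lincomb _ _ _ _ _ (fun=> 1%R) (fun=> 1%R)) => //.
    exact: powR_ge0.
  move=> x Ex; rewrite phi0/= mul0r addr0 mulr1.
  have x0 := Ep _ _ Ex.
  apply: (@le_trans _ _ (c `^ q x)%R); last by apply: ler_powR (q_le x0).
  apply: powR_le2l; [exact: ltW (q0 _ x0)|by rewrite divr_ge0 ?ltW|].
  rewrite le_max; apply/orP; right; rewrite ler_wpM2r ?invr_ge0 ?(ltW t0)//.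
  case: Ex => _; rewrite /= in_itv/= andbT => nw.
  by rewrite -[leRHS]invrK lef_pV2 ?posrE ?invr_gt0 ?wreal_gt0.
pose I := fine (\int[mu]_(x in E n) (phi x)%:E).
have IE : \int[mu]_(x in E n) (phi x)%:E = I%:E by rewrite fineK.
have I1 : (1 < I)%R by rewrite -lte_fin -IE.
have I0 : (0 < I)%R := lt_trans ltr01 I1.
pose u x := ((v x / t) `^ (q x - 1))%R.
have u0 x : (0 <= u x)%R by exact: powR_ge0.
have mu_ : measurable_fun (positive X) u.
  by apply: measurable_fun_powR => //; exact: measurable_funB.
have mI : measurable_fun (positive X) (\1_(E n) : T -> R) by exact: measurable_indic.
pose f x := (\1_(E n) x * (v x * u x))%:E.
have mf : measurable_fun (positive X) f.
  apply/measurable_EFinP; apply: measurable_funM => //.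
  exact: measurable_funM.
(* I > 1 gives (1 / I)^p <= 1 / I, and (p' - 1) p = p', so the modular of f w at level I is at most
   1. *)
have fwI : nrm p (fun x => f x * w x) <= I%:E.
  apply: lux_le => //.
  have gg : {ae mu, forall x, positive X x -> `|f x * w x| = (\1_(E n) x * u x)%:E}.
    apply: filterS wae => x h x0; have hw := h x0.
    have vw : (v x * wreal x = 1)%R by rewrite /v mulVf// gt_eqF// wreal_gt0.
    have -> : f x * w x = (\1_(E n) x * u x)%:E.
      rewrite (wrealE hw) -EFinM; congr EFin.
      by rewrite -[RHS]mulr1 -vw; ring.
    by rewrite gee0_abs// lee_fin mulr_ge0.
  rewrite (modularE mDy mp _ _ _ gg I0); last 3 first.
  - exact: emeasurable_funM.
  - exact: measurable_funM.
  - by move=> x _; rewrite mulr_ge0.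
  rewrite (_ : 1 = (I^-1 * I + 0 * I)%:E)%E; last by rewrite mul0r addr0 mulVf// gt_eqF.
  apply: (@le_trans _ _ (\int[mu]_(x in positive X) (\1_(E n) x * (u x / I) `^ p x)%:E)).
    rewrite le_eqVlt; apply/orP; left; apply/eqP.
    apply: eq_integral => x /set_mem x0; congr EFin.
    rewrite indicE; case: (x \in E n); rewrite ?mul1r// !mul0r.
    by rewrite powR0// gt_eqF// p_gt0.
  rewrite integral_indicM//.
  apply: (@integral_le_lincomb _ _ _ _ _ phi phi) => //.
  - apply: measurable_funS mDy (@Ep n) _; apply: measurable_fun_powR => //.
    exact: measurable_funM.
  - by rewrite invr_ge0 ltW.
  - move=> x /Ep x0; rewrite powR_ge0/= mul0r addr0.
    have px := p_gt1 x0.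
    rewrite powRM ?invr_ge0 ?(ltW I0)// mulrC; apply: ler_pM; rewrite ?powR_ge0//.
      rewrite ge1r_powR ?(ltW px)// invr_gt0 I0/= invf_le1//.
      exact: ltW.
    rewrite /u /phi -powRrM -[in leRHS](hconj_mulB1 (q_gt1 x0)) /q hconjK// ?p_gt1//.
    by rewrite [(p x * _)%R]mulrC.
  - by rewrite IE.
  - by rewrite IE.
have fI : \int[mu]_(x in below X b) `|f x| = (t * I)%:E.
  have -> : \int[mu]_(x in below X b) `|f x| =
      \int[mu]_(x in below X b) (\1_(E n) x * (v x * u x))%:E.
    apply: eq_integral => x _; rewrite gee0_abs// lee_fin.
    by rewrite mulr_ge0// mulr_ge0// ltW.
  rewrite (integral_indicM _ _ (mE n) (@Eb n)) EFinM -IE -ge0_integralZl; last 4 first.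
  - exact: mE.
  - exact/measurable_EFinP.
  - by move=> x _; rewrite lee_fin.
  - by rewrite lee_fin ltW.
  apply: eq_integral => x /set_mem /Ep x0; rewrite -EFinM; congr EFin.
  rewrite /phi /u -(@mulr_powRB1 _ (v x / t) (q x)) ?q0//; last first.
    by rewrite divr_ge0 ?ltW.
  by rewrite mulrA; congr (_ * _)%R; rewrite mulrCA divff ?mulr1// gt_eqF.
(* The level sets are defined by a strict inequality, so weak type is applied at every level r below
   the mean t I / b. *)
have key : L * (t * I / b)%:E <= (K * I)%:E.
  apply: mule_le_real => //.
  - by rewrite lee_fin divr_ge0 ?mulr_ge0 ?ltW.
  - by rewrite mulr_ge0 ?ltW.
  move=> r r0; rewrite lte_fin => rt.
  have nf : nrm p (fun x => f x * w x) < +oo by rewrite (le_lt_trans fwI) ?ltry.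
  apply: (@le_trans _ _ (K%:E * nrm p (fun x => f x * w x))); last first.
    by rewrite EFinM lee_wpmul2l// lee_fin ltW.
  apply: le_trans (hW r f r0 mf nf).
  apply: lee_wpmul2l; first by rewrite lee_fin ltW.
  apply: (@le_trans _ _ (1 * L)); first by rewrite mul1e.
  apply: lux_scale_le => // x x0; rewrite mul1e !patchE.
  case: ifPn => [/set_mem Bx|_]; last by rewrite abse0 abse_ge0.
  rewrite mem_set//=; split; first exact: x0.
  have xb : (X x < b)%R by case/andP: Bx.
  apply: lt_le_trans (maxX_ge f xb).
  by rewrite fI -EFinM lte_fin mulrC.
have -> : t%:E * L = (b / I)%:E * (L * (t * I / b)%:E).
  rewrite [L * _]muleC muleA -EFinM; congr (_%:E * _).
  by field; rewrite !gt_eqF.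
apply: (le_trans (lee_wpmul2l _ key)); first by rewrite lee_fin divr_ge0 ?ltW.
rewrite -EFinM lee_fin le_eqVlt; apply/orP; left; apply/eqP.
by field; rewrite gt_eqF.
Qed.

(** Both norms are positive, so a finite product makes each of them finite. *)
Lemma ap_weight_wreal (C : R) : (0 < C)%R ->
  (forall b, (0 < b)%R ->
    nrm p (w \_ (below X b)) * nrm q ((fun x => (w x)^-1) \_ (below X b))
      <= (C * b)%:E) ->
  exists C0 lam nu, ap_weight mu X p wreal s M C0 lam nu.
Proof.
move=> C0 hA.
have q0 x : positive X x -> (0 < q x)%R by move=> /q_gt1; exact: lt_trans.
pose Lb b := nrm p (w \_ (below X b)).
pose Nb b := nrm q ((fun x => (w x)^-1) \_ (below X b)).
have L0 b : (0 < b)%R -> 0 < Lb b.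
  apply: lux_below_gt0 mp _ mw measurable_wreal _ wreal_ae.
    by move=> x /p_gt1/ltW.
  by move=> x _; exact: wreal_gt0.
have N0 b : (0 < b)%R -> 0 < Nb b.
  apply: lux_below_gt0 mq _ measurable_inve_w mv _ wreal_inv_ae.
    by move=> x /q_gt1/ltW.
  by move=> x _; exact: v_gt0.
have fin b : (0 < b)%R -> Lb b \is a fin_num /\ Nb b \is a fin_num.
  move=> b0; have := hA b b0; rewrite -/(Lb b) -/(Nb b) => h.
  have Lp := L0 b b0; have Np := N0 b b0.
  rewrite !ge0_fin_numE ?ltW//; split; rewrite ltNge leye_eq; apply/negP => /eqP e.
    by move: h; rewrite e gt0_mulye// leNgt ltry.
  by move: h; rewrite e gt0_muley// leNgt ltry.
(* Doubling puts the norm strictly below [lam b], as [lux_lt] requires; the two factors 2 lead to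
   the constant 4 C. *)
pose lam b := (2 * fine (Lb b))%R.
pose nu b := (2 * fine (Nb b))%R.
have fL b : (0 < b)%R -> (0 < fine (Lb b))%R.
  by move=> b0; rewrite -lte_fin fineK ?L0// (fin b b0).1.
have fN b : (0 < b)%R -> (0 < fine (Nb b))%R.
  by move=> b0; rewrite -lte_fin fineK ?N0// (fin b b0).2.
have lam0 b : (0 < b)%R -> (0 < lam b)%R by move=> /fL; exact: mulr_gt0.
have nu0 b : (0 < b)%R -> (0 < nu b)%R by move=> /fN; exact: mulr_gt0.
exists (Num.max 1 (4 * C))%R, lam, nu; split.
- exact: s1.
- exact: sM.
- by rewrite le_max lexx.
- exact: mp.
- exact: measurable_wreal.
- exact: pb.
- by move=> x _; exact: wreal_gt0.
- exact: lam0.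
- exact: nu0.
- move=> b b0; rewrite -(modular_below b mp p_gt0 mw measurable_wreal _ wreal_ae (lam0 b b0)); last first.
    by move=> x _; exact: ltW (wreal_gt0 x).
  apply: lux_lt => //.
  rewrite -/(Lb b) -(fineK (fin b b0).1) lte_fin /lam; have := fL b b0; lra.
- move=> b b0; rewrite -(modular_below b mq q0 measurable_inve_w mv _ wreal_inv_ae (nu0 b b0)); last first.
    by move=> x _; exact: ltW (v_gt0 x).
  apply: lux_lt => //; first by move=> x /q0/ltW.
  rewrite -/(Nb b) -(fineK (fin b b0).2) lte_fin /nu; have := fN b b0; lra.
- move=> b b0; have := hA b b0; rewrite -/(Lb b) -/(Nb b).
  rewrite -(fineK (fin b b0).1) -(fineK (fin b b0).2) -EFinM lee_fin => h.
  apply: (@le_trans _ _ (4 * C * b)%R); first by rewrite /lam /nu; lra.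
  by rewrite ler_wpM2r ?(ltW b0)// le_max lexx orbT.
Qed.

(** Where [f] is infinite and 0 < w < +oo the integrand is +oo, so this set is null. *)
Lemma ae_lty_of_modular f m : measurable_fun (positive X) f -> (0 < m)%R ->
  mdl p (fun x => f x * w x) m <= 1 ->
  {ae mu, forall x, positive X x -> f x \is a fin_num}.
Proof.
move=> mf m0 hm.
pose P := (positive X `&` [set x | 0 < w x]) `&` (positive X `&` [set x | w x < +oo]).
have mP : measurable P.
  by apply: measurableI; [exact: emeasurable_fun_o_infty|exact: emeasurable_fun_infty_o].
pose Z := P `\` (positive X `&` [set x | f x \is a fin_num]).
have mZ : measurable Z by apply: measurableD => //; exact: emeasurable_fin_num.
have Zp x : Z x -> [/\ positive X x, 0 < w x < +oo & ~ f x \is a fin_num].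
  move=> [[[x0 w1] [_ w2]] nf]; split => //; first by apply/andP; split.
  by move=> ff; apply: nf.
have ZD : Z `<=` positive X by move=> x /Zp[].
have Z0 : mu Z = 0.
  apply/eqP; rewrite eq_le measure_ge0 andbT leNgt; apply/negP => Zgt.
  have : \int[mu]_(x in positive X) (+oo * (\1_Z x)%:E) <= 1.
    apply: le_trans hm; apply: le_ge0_integral => x x0.
      by rewrite mule_ge0// lee_fin.
    rewrite indicE; case: (boolP (x \in Z)) => [/set_mem/Zp[_ hw nf]|_]; last first.
      by rewrite mule0 poweR_ge0.
    rewrite mule1.
    have -> : `|f x * w x| / m%:E = +oo.
      rewrite (wrealE hw) inver gt_eqF// abseM.
      have -> : `|f x| = +oo.
        by case: (f x) nf => [y| |]//= nf; exfalso; apply: nf.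
      by rewrite gee0_abs ?lee_fin ?(ltW (wreal_gt0 _))// !gt0_mulye ?lte_fin ?invr_gt0 ?wreal_gt0.
    by rewrite poweRyr// gt_eqF// p_gt0.
  rewrite (ge0_integralZl mu mDy); last 3 first.
  - by apply/measurable_EFinP; exact: measurable_indic.
  - by move=> x _; rewrite lee_fin.
  - exact: leey.
  rewrite integral_indic// (setIidl ZD).
  by rewrite gt0_mulye// leNgt ltry.
have [N [mN N0 sub]] := wae.
exists (Z `|` N); split.
- exact: measurableU.
- by rewrite measureU0.
move=> x /= nx.
have x0 : positive X x by apply: contrapT => x0; apply: nx => /x0.
have nf : ~ f x \is a fin_num by move=> ff; apply: nx.
have [hw|hw] := boolP (0 < w x < +oo); last first.
  by right; apply: sub => /= h; move: hw; rewrite h.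
left; case/andP: hw => w1 w2; split; first by split; split.
by case=> _.
Qed.

Lemma strong_of_ap (C CL0 p0 CLoo poo : R) : (0 < C)%R ->
  (forall b, (0 < b)%R ->
    nrm p (w \_ (below X b)) * nrm q ((fun x => (w x)^-1) \_ (below X b))
      <= (C * b)%:E) ->
  (0 < CL0)%R -> (s <= p0 <= M)%R ->
  (forall x, 0 < X x < 2^-1 -> `|p x - p0| <= CL0 / - ln (X x))%R ->
  (0 < CLoo)%R -> (s <= poo <= M)%R ->
  (forall x, positive X x -> `|p x - poo| <= CLoo / ln (expR 1 + X x))%R ->
  exists2 K : R, (0 < K)%R & forall f, measurable_fun (positive X) f ->
    nrm p (fun x => f x * w x) < +oo ->
    nrm p (fun x => maxX f x * w x) <= K%:E * nrm p (fun x => f x * w x).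
Proof.
move=> C0 hA CL00 p0b hL0 CLoo0 poob hLoo.
have [C1 [lam [nu aw]]] := ap_weight_wreal C0 hA.
have [C' hC'] := ap_maximal_half_line mX mu_below aw CL00 p0b hL0 CLoo0 poob hLoo.
(* K >= 1 gives (1 / K)^p <= 1 / K, so enlarging the level by the factor K brings a modular bounded
   by [C'] down to 1. *)
pose K := Num.max 1%R C'.
have K1 : (1 <= K)%R by rewrite le_max lexx.
have KC : (C' <= K)%R by rewrite le_max lexx orbT.
have K0 : (0 < K)%R := lt_le_trans ltr01 K1.
exists K => // f mf hf; set F := nrm p (fun x => f x * w x) in hf *.
have F0 : 0 <= F by exact: lux_ge0.
have Ff : F \is a fin_num by rewrite ge0_fin_numE.
(* Any m above the norm normalizes [f]; letting m tend to the norm also covers the case of norm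
   0. *)
suff main (m : R) : (0 < m)%R -> F < m%:E -> nrm p (fun x => maxX f x * w x) <= (K * m)%:E.
  apply/lee_addgt0Pr => e e0.
  have me : (0 < fine F + e / K)%R.
    by rewrite ltr_wpDl ?fine_ge0// divr_gt0.
  apply: le_trans (main _ me _) _.
    by rewrite -{1}(fineK Ff) lte_fin ltrDl divr_gt0.
  rewrite -{2}(fineK Ff) -EFinM -EFinD lee_fin mulrDr [(K * (e / K))%R]mulrC divfK//.
  by rewrite gt_eqF.
move=> m0 Fm.
have hm : mdl p (fun x => f x * w x) m <= 1 by exact: lux_lt.
have ffin := ae_lty_of_modular mf m0 hm.
pose fr x := (`|fine (f x)| / m)%R.
have mfr : measurable_fun (positive X) fr.
  apply: measurable_funM => //; apply: measurableT_comp => //.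
  exact: measurableT_comp.
have fr0 x : positive X x -> (0 <= fr x)%R by move=> _; apply: divr_ge0 => //; exact: ltW.
have frfw : {ae mu, forall x, positive X x -> `|f x * w x| = (m * fr x * wreal x)%:E}.
  apply: filterS2 ffin wae => x h1 h2 x0.
  rewrite (wrealE (h2 x0)) -{1}(fineK (h1 x0)) -EFinM abse_EFin; congr EFin.
  by rewrite normrM (ger0_norm (ltW (wreal_gt0 x))) /fr mulrCA divff ?mulr1// gt_eqF.
have h1 : \int[mu]_(x in positive X) ((fr x * wreal x) `^ p x)%:E <= 1.
  apply: le_trans hm; rewrite (modularE mDy mp _ _ _ frfw m0); last 3 first.
  - exact: emeasurable_funM.
  - by apply: measurable_funM; [exact: measurable_funM|exact: measurable_wreal].
  - by move=> x x0; apply: mulr_ge0 (ltW (wreal_gt0 x)); apply: mulr_ge0 (ltW m0) (fr0 x x0).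
  rewrite le_eqVlt; apply/orP; left; apply/eqP; apply: eq_integral => x _.
  congr ((_ `^ _)%R%:E); move: (fr x) (wreal x) => a a'.
  by field; rewrite gt_eqF.
have [frfin [H [mH H0 HC HB]]] := hC' fr mfr fr0 h1.
have fI b : (0 < b)%R -> \int[mu]_(y in below X b) `|f y| =
    (m * fine (\int[mu]_(y in below X b) (fr y)%:E))%:E.
  move=> b0; have sub := @below_pos b.
  have mfb : measurable_fun (below X b) fr by exact: measurable_funS mDy sub mfr.
  rewrite EFinM fineK; last first.
    by rewrite ge0_fin_numE ?frfin// integral_ge0// => x /sub /fr0; rewrite lee_fin.
  rewrite -(ge0_integralZl mu (mD b)); last 3 first.
  - exact/measurable_EFinP.
  - by move=> x /sub /fr0; rewrite lee_fin.
  - by rewrite lee_fin ltW.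
  apply: ge0_ae_eq_integral => //.
  - by apply: measurableT_comp => //; exact: measurable_funS mDy sub mf.
  - by apply: measurable_funeM; exact/measurable_EFinP.
  - by move=> x /sub /fr0 fx; rewrite -EFinM lee_fin mulr_ge0// ltW.
  apply: filterS ffin => x h /sub x0.
  by rewrite -{1}(fineK (h x0)) abse_EFin -EFinM /fr mulrCA divff ?mulr1// gt_eqF.
have Km0 : (0 < K * m)%R by rewrite mulr_gt0.
apply: lux_le => //.
(* The value +oo on the exceptional null set makes the majorization hold at every point, as
   [le_ge0_integral] demands, without changing the integral. *)
pose G x : \bar R := if (0 < w x) && (w x < +oo) then (K^-1)%:E * H x else +oo.
apply: (@le_trans _ _ (\int[mu]_(x in positive X) G x)).
  apply: le_ge0_integral => x x0; first exact: poweR_ge0.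
  rewrite /G; case: ifPn => [hw|_]; last exact: leey.
  have px := p_gt0 x0.
  have N0 := maxX_ge0 f x0.
  have := H0 x x0; case HE : (H x) => [h| |]// hge; last first.
    by rewrite gt0_muley ?leey// lte_fin invr_gt0.
  rewrite lee_fin in hge.
  have w00 := wreal_gt0 x.
  (* [HB] bounds the p-th power for each interval separately; its p-th root is a bound independent
     of b, which passes to the supremum. *)
  pose B := (m * (h `^ (p x)^-1 / wreal x))%R.
  have B0 : (0 <= B)%R by rewrite mulr_ge0 ?(ltW m0)// divr_ge0 ?powR_ge0// ltW.
  have NB : maxX f x <= B%:E.
    apply: ge_ereal_sup => _ [b xb <-].
    have b0 : (0 < b)%R by apply: lt_trans xb.
    rewrite fI// -EFinM lee_fin mulrCA /B; apply: ler_wpM2l; first exact: ltW.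
    have := HB x b x0 xb; rewrite HE lee_fin => hb.
    rewrite ler_pdivlMr// mulrC mulrA.
    set a := (fine _ / b * wreal x)%R in hb.
    have a0 : (0 <= a)%R.
      rewrite mulr_ge0 ?(ltW w00)// divr_ge0 ?(ltW b0)// fine_ge0// integral_ge0// => y /below_pos /fr0.
      by rewrite lee_fin.
    have -> : (wreal x * b^-1 * fine (\int[mu]_(y in below X b) (fr y)%:E) = a)%R by rewrite /a; ring.
    have -> : (a = (a `^ p x) `^ (p x)^-1)%R by rewrite -powRrM divff ?gt_eqF// powRr1.
    by apply: powR_le2l => //; rewrite ?powR_ge0// invr_ge0 ltW.
  have -> : `|maxX f x * w x| / (K * m)%:E = (fine (maxX f x) * wreal x / (K * m))%:E.
    have Nf : maxX f x \is a fin_num by rewrite ge0_fin_numE// (le_lt_trans NB)// ltry.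
    rewrite (wrealE hw) gee0_abs; last by rewrite mule_ge0// lee_fin ltW.
    by rewrite -{1}(fineK Nf) inver gt_eqF.
  rewrite poweR_EFin -EFinM lee_fin.
  have fNB : (fine (maxX f x) <= B)%R.
    have Nf : maxX f x \is a fin_num by rewrite ge0_fin_numE// (le_lt_trans NB)// ltry.
    by rewrite -lee_fin fineK.
  apply: (@le_trans _ _ ((K^-1 * h `^ (p x)^-1) `^ p x)%R).
    apply: powR_le2l; first exact: ltW.
      by rewrite divr_ge0 ?(ltW Km0)// mulr_ge0 ?fine_ge0// ltW.
    apply: (@le_trans _ _ (B * wreal x / (K * m))%R).
      by rewrite ler_wpM2r ?invr_ge0 ?(ltW Km0)// ler_wpM2r// ltW.
    rewrite le_eqVlt; apply/orP; left; apply/eqP; rewrite /B.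
    by field; rewrite !gt_eqF.
  rewrite powRM ?invr_ge0 ?(ltW K0) ?powR_ge0// -powRrM mulVf ?gt_eqF// powRr1//.
  rewrite ler_wpM2r// ge1r_powR ?invr_gt0 ?K0 ?invf_le1//.
  exact: ltW (p_gt1 x0).
have mG : measurable_fun (positive X) G.
  apply: measurable_fun_if => //.
  - apply: measurable_and.
      by apply: (measurable_fun_bool true); exact: emeasurable_fun_o_infty.
    by apply: (measurable_fun_bool true); exact: emeasurable_fun_infty_o.
  - apply: (@measurable_funS _ _ _ _ (positive X)) => //.
    exact: measurable_funeM.
have -> : \int[mu]_(x in positive X) G x = \int[mu]_(x in positive X) ((K^-1)%:E * H x).
  apply: ge0_ae_eq_integral => //.
  - exact: measurable_funeM.
  - move=> x x0; rewrite /G; case: ifP => // _.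
    by rewrite mule_ge0 ?H0// lee_fin invr_ge0 ltW.
  - by move=> x x0; rewrite mule_ge0 ?H0// lee_fin invr_ge0 ltW.
  by apply: filterS wae => x h x0; rewrite /G h.
rewrite ge0_integralZl//; last by rewrite lee_fin invr_ge0 ltW.
apply: (@le_trans _ _ ((K^-1)%:E * K%:E)).
  rewrite lee_wpmul2l ?lee_fin ?invr_ge0 ?(ltW K0)//.
  by apply: (le_trans HC); rewrite lee_fin.
by rewrite -EFinM mulVf// gt_eqF.
Qed.

End weighted_half_line.

(** * Transfer to the completed Lebesgue measure on (0, oo) *)

Lemma measurable_lebesgueR (R : realType) (A : set R) :
  measurable (A : set (measurableTypeR R)) -> measurable (A : set (lebesgueR R)).
Proof. by move=> mA; exact: (@sub_caratheodory). Qed.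

Lemma leb_itv (R : realType) (b : R) : (0 < b)%R -> @leb R `]0%R, b[ = b%:E.
Proof.
move=> b0; rewrite (_ : @leb R `]0%R, b[ = @lebesgue_measure R `]0%R, b[)//.
by rewrite lebesgue_measure_itv/= lte_fin b0 oppr0 adde0.
Qed.

Lemma measurable_id_lebesgueR (R : realType) (D : set (lebesgueR R)) :
  measurable_fun D (fun x : lebesgueR R => x : R).
Proof.
move=> mD Y mY; apply: measurableI => //.
by apply: measurable_lebesgueR.
Qed.

(** Log-Hoelder continuity only provides limits p(0), p(oo) >= 1, whereas the bases ask for s <= q
    <= M; these bounds pass from p to its limits. *)
Lemma bounded_limit_exponent (R : realType) (p : R -> R) (c s M : R) :
  (forall x, 0 < x -> s <= p x <= M) ->
  (forall e, 0 < e -> exists2 x, 0 < x & `|p x - c| <= e) -> s <= c <= M.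
Proof.
move=> pb h; apply/andP; split; apply/ler_addgt0Pr => e /h[x x0].
  rewrite ler_norml => /andP[h1 h2]; have /andP[] := pb _ x0; lra.
rewrite ler_norml => /andP[h1 h2]; have /andP[] := pb _ x0; lra.
Qed.

Lemma LH0_bounds (R : realType) (p : R -> R) (C c s M : R) : 0 < C ->
  (forall x, 0 < x -> s <= p x <= M) ->
  (forall x, 0 < x < 2^-1 -> `|p x - c| <= C / - ln x) -> s <= c <= M.
Proof.
move=> C0 pb h; apply: bounded_limit_exponent pb _ => e e0.
(* t >= 1 puts exp(-t) below 1/2, and t >= C / e makes C / t at most e. *)
pose t := Num.max 1 (C / e).
have t1 : 1 <= t by rewrite le_max lexx.
have t0 : 0 < t by lra.
have te : C / e <= t by rewrite le_max lexx orbT.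
exists (expR (- t)); first exact: expR_gt0.
apply: (le_trans (h _ _)).
  rewrite expR_gt0/= expRN ltf_pV2 ?posrE ?expR_gt0//.
  have : 1 + t < expR t by apply: expR_gt1Dx; rewrite gt_eqF.
  lra.
rewrite expRK opprK ler_pdivrMr// mulrC.
by move: te; rewrite ler_pdivrMr.
Qed.

Lemma LHoo_bounds (R : realType) (p : R -> R) (C c s M : R) : 0 < C ->
  (forall x, 0 < x -> s <= p x <= M) ->
  (forall x, 0 < x -> `|p x - c| <= C / ln (expR 1 + x)) -> s <= c <= M.
Proof.
move=> C0 pb h; apply: bounded_limit_exponent pb _ => e e0.
have t0 : 0 < C / e by rewrite divr_gt0.
exists (expR (C / e)); first exact: expR_gt0.
apply: (le_trans (h _ (expR_gt0 _))).
have l : C / e <= ln (expR 1 + expR (C / e)).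
  rewrite -{1}(expRK (C / e)) ler_ln ?posrE ?expR_gt0 ?addr_gt0 ?expR_gt0//.
  by rewrite lerDr expR_ge0.
rewrite ler_pdivrMr; last exact: lt_le_trans l.
by move: l; rewrite ler_pdivrMr// mulrC.
Qed.

Section lebesgue_half_line.
Local Open Scope ereal_scope.
Context (R : realType).
Implicit Types (p r : R -> R) (f w : R -> \bar R).

Definition lebR : {measure set (lebesgueR R) -> \bar R} := leb.

(** The identity, read as a map from the completed to the Borel structure; it instantiates [X]. *)
Definition coord (x : lebesgueR R) : R := x.

Lemma positive_coord : positive coord = `]0%R, +oo[%classic.
Proof. by apply/seteqP; split => x; rewrite /positive/= in_itv/= andbT. Qed.

Lemma below_coord (b : R) : below coord b = `]0%R, b[%classic.
Proof. by apply/seteqP; split => x; rewrite /below/= in_itv. Qed.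

Lemma lebR_below (b : R) : (0 < b)%R -> lebR (below coord b) = b%:E.
Proof. by move=> b0; rewrite below_coord; exact: leb_itv. Qed.

Lemma luxemburgE r f : luxemburg r f = lux lebR (positive coord) r f.
Proof. by rewrite positive_coord. Qed.

Lemma maxN_E f : maxN f = maxX lebR coord f.
Proof.
apply/funext => x; rewrite /maxN /maxX; congr ereal_sup.
Qed.

Section equivalence.
Context (p : R -> R) (w : R -> \bar R).
Hypotheses (p_exponent : exponent p) (w_weight : weight w).
Hypothesis p_gt1 : 1 < exponent_inf p.

Let wae : {ae lebR, forall x, positive coord x -> 0 < w x < +oo}.
Proof. by case: w_weight. Qed.

Let w0 x : positive coord x -> 0 <= w x.
Proof. by case: w_weight => _ + _ _; exact. Qed.

Let mw : measurable_fun (positive coord) w.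
Proof. by rewrite positive_coord; case: w_weight. Qed.

Let mp : measurable_fun (positive coord) p.
Proof. by rewrite positive_coord; case: p_exponent. Qed.

Lemma exponent_bounds : exists s M : R, (1 < s)%R /\
  forall x, (0 < x)%R -> (s <= p x <= M)%R.
Proof.
have [_ _ [M pM]] := p_exponent.
have le x : (0 < x)%R -> exponent_inf p <= (p x)%:E.
  by move=> x0; apply: ereal_inf_lbound; exists x.
have inf_fin : exponent_inf p \is a fin_num.
  rewrite ge0_fin_numE ?(ltW (lt_trans _ p_gt1))//.
  by apply: (le_lt_trans (le 1%R ltr01)); exact: ltry.
exists (fine (exponent_inf p)), M; split; first by rewrite -lte_fin fineK.
by move=> x x0; rewrite pM// -lee_fin fineK// le.
Qed.

Local Notation nrm := (lux lebR (positive coord)).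

Lemma Lpw_coord f : Lpw p w f <->
  measurable_fun (positive coord) f /\ nrm p (fun x => f x * w x) < +oo.
Proof. by rewrite positive_coord; split. Qed.

Lemma strong_type_coord : strong_type p w maxN <->
  exists2 K : R, (0 < K)%R & forall f : lebesgueR R -> \bar R,
    measurable_fun (positive coord) f -> nrm p (fun x => f x * w x) < +oo ->
    nrm p (fun x => maxX lebR coord f x * w x) <= K%:E * nrm p (fun x => f x * w x).
Proof.
split=> -[K K0 hK]; exists K => [//|f].
  move=> mf hf; rewrite -!luxemburgE -maxN_E; apply: hK.
  by apply/Lpw_coord; split.
by move=> /Lpw_coord[mf hf]; rewrite !luxemburgE maxN_E; exact: hK.
Qed.

Lemma weak_type_coord : weak_type p w maxN <->
  exists2 K : R, (0 < K)%R & forall (c : R) (f : lebesgueR R -> \bar R), (0 < c)%R ->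
    measurable_fun (positive coord) f -> nrm p (fun x => f x * w x) < +oo ->
    c%:E * nrm p (w \_ [set x | (0 < coord x)%R /\ c%:E < maxX lebR coord f x]) <=
      K%:E * nrm p (fun x => f x * w x).
Proof.
split=> -[K K0 hK]; exists K => [//|c f c0].
  move=> mf hf; rewrite -!luxemburgE -maxN_E; apply: hK; first exact: c0.
  by apply/Lpw_coord; split.
by move=> /Lpw_coord[mf hf]; rewrite !luxemburgE maxN_E; exact: hK.
Qed.

Lemma Ap0_coord : Ap0 p w <->
  exists2 C : R, (0 < C)%R & forall b, (0 < b)%R ->
    nrm p (w \_ (below coord b)) *
    nrm (fun x => hconj (p x)) ((fun x => (w x)^-1) \_ (below coord b)) <= (C * b)%:E.
Proof.
split=> -[C C0 hC]; exists C => [//|b b0]; have := hC b b0.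
  by rewrite below_coord !luxemburgE.
by rewrite below_coord !luxemburgE.
Qed.

Lemma weak_type_of_strong_type : strong_type p w maxN -> weak_type p w maxN.
Proof.
have [s [M [s1 pb]]] := exponent_bounds.
move=> /strong_type_coord[K K0 hK]; apply/weak_type_coord; exists K; first exact: K0.
exact: (@weak_of_strong _ _ _ lebR coord p w s M s1 pb w0 K hK).
Qed.

Lemma Ap0_of_weak_type : weak_type p w maxN -> Ap0 p w.
Proof.
have [s [M [s1 pb]]] := exponent_bounds.
move=> /weak_type_coord[K K0 hK]; apply/Ap0_coord; exists K; first exact: K0.
exact: (@ap_of_weak _ _ _ lebR coord (@measurable_id_lebesgueR R _) (@lebR_below)
  p w s M s1 mp pb mw w0 wae K K0 hK).
Qed.

Lemma strong_type_of_Ap0 : LH0 p -> LHoo p -> Ap0 p w -> strong_type p w maxN.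
Proof.
have [s [M [s1 pb]]] := exponent_bounds.
have sM : (s <= M)%R by have /andP[] := pb _ ltr01; exact: le_trans.
move=> [C0 [p0 [C00 _ h0]]] [Coo [poo [Coo0 _ hoo]]] /Ap0_coord[C CC hC].
apply/strong_type_coord.
exact: (@strong_of_ap _ _ _ lebR coord (@measurable_id_lebesgueR R _) (@lebR_below)
  p w s M s1 sM mp pb mw w0 wae C C0 p0 Coo poo CC hC C00 (LH0_bounds C00 pb h0) h0
  Coo0 (LHoo_bounds Coo0 pb hoo) hoo).
Qed.

End equivalence.
End lebesgue_half_line.

Local Open Scope ereal_scope.

Theorem theorem1p6 (R : realType) (p : R -> R) (w : R -> \bar R)
  (p_exponent : exponent p) (p_LH0 : LH0 p) (p_LHoo : LHoo p)
  (p_gt1 : 1 < exponent_inf p) (p_le : exponent_inf p <= exponent_sup p)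
  (p_lty : exponent_sup p < +oo) (w_weight : weight w) :
  (strong_type p w maxN <-> weak_type p w maxN) /\
  (weak_type p w maxN <-> Ap0 p w).
Proof.
have sw := weak_type_of_strong_type p_exponent w_weight p_gt1.
have wa := Ap0_of_weak_type p_exponent w_weight p_gt1.
have as_ := strong_type_of_Ap0 p_exponent w_weight p_gt1 p_LH0 p_LHoo.
split; split.
- exact: sw.
- by move=> /wa/as_.
- exact: wa.
- by move=> /as_/sw.
Qed.
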